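(* Let $G$ be a $\sigma$-compact locally compact Abelian group and let $(\Omega,\alpha)$ be a dynamical system on the translation bounded measures on $G$ (TMDS) with an $\alpha$-invariant probability measure $m$. Let $\mathcal{U}$ be the closure in $L^2(\Omega,m)$ of $\{f_\varphi:\varphi\in C_c(G)\}$ (a closed $T$-invariant subspace). Then the diffraction measure $\widehat{\gamma_m}$ is a spectral measure for the restriction $T|_{\mathcal{U}}$ of $T$ to $\mathcal{U}$; that is, for every Borel set $B\subset\widehat G$, $E_{T|_{\mathcal{U}}}(B)=0$ if and only if $\widehat{\gamma_m}(B)=0$.
   Context: $C_c(G)$ is the space of complex continuous compactly supported functions on $G$ with the inductive limit topology; $\mathcal{M}(G)=C_c(G)^*$ (complex Radon measures on $G$) carries the vague (weak-$*$) topology. Each $\mu\in\mathcal{M}(G)$ has a total variation $|\mu|$, the positive regular Borel measure with $\mu(\varphi)=\int_G\varphi u\,d|\mu|$ for a measurable $u$ with $|u|=1$ $|\mu|$-a.e. For $C>0$ and a nonempty relatively compact open $V\subset G$, $\mathcal{M}_{C,V}(G)=\{\mu\in\mathcal{M}(G): |\mu|(t+V)\le C \text{ for all } t\in G\}$. $G$ acts on $\mathcal{M}(G)$ by $\alpha_t\mu=\delta_t*\mu$, i.e. $(\alpha_t\mu)(\varphi)=\int_G\varphi(t+s)\,d\mu(s)$. A TMDS $(\Omega,\alpha)$ is a closed, $\alpha$-invariant subset $\Omega$ of some $\mathcal{M}_{C,V}(G)$ together with the action $\alpha$ ($\Omega$ is then compact Hausdorff and the action is continuous). Probability measures on $\Omega$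 are regular Borel. $T$ is the unitary representation of $G$ on $L^2(\Omega,m)$ given by $(T^th)(\omega)=h(\alpha_{-t}\omega)$; $\langle f,g\rangle=\int\overline fg\,dm$. For a closed $T$-invariant subspace $\mathcal{V}$, $T|_{\mathcal{V}}$ is the restricted representation, and $E_{T|_{\mathcal{V}}}$ is its projection valued measure on the Borel sets of $\widehat G$ given by Stone's theorem: $\langle f,T^tf\rangle=\int_{\widehat G}(\hat s,t)\,d\langle f,E_{T|_{\mathcal{V}}}(\hat s)f\rangle$ for $f\in\mathcal{V}$, $t\in G$. For $\varphi\in C_c(G)$ and $\mu\in\mathcal{M}(G)$, $f_\varphi(\mu)=\int_G\varphi(-s)\,d\mu(s)$ (restricted to $\Omega$ this is a continuous function); $\overline{\mu}(\varphi)=\overline{\mu(\overline{\varphi})}$. The autocorrelation measure is $\gamma_m(\varphi)=\int_\Omega\int_G f_\varphi(\alpha_{-t}\overline{\omega})\,\sigma(t)\,d\omega(t)\,dm(\omega)$, where $\sigma\in C_c(G)$ is any function with $\int_G\sigma(t)\,dt=1$; it is independent of $\sigma$ and positive definite. The diffraction measure $\widehat{\gamma_m}$ is its Fourier transform, a positive measure on $\widehat G$ (characterised by $\gamma_m(\varphi*\widetilde\varphi)=\int_{\widehat G}|\widehat{\varphi}(\hat s^{-1})|^2\,d\widehat{\gamma_m}(\hat s)$ for all $\varphi\in C_c(G)$, where $\widetilde\varphi(t)=\overline{\varphi(-t)}$ and $\widehat\varphi(\hat s)=\int_G\overline{(\hat s,t)}\varphi(t)\,dt$). *)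

(* Defs.v *)
From HB Require Import structures.
From mathcomp Require Import all_boot all_order all_algebra.
From mathcomp Require Import all_classical all_reals all_analysis.
From mathcomp Require Import complex.

Set Implicit Arguments.
Unset Strict Implicit.
Unset Printing Implicit Defensive.

Import Order.TTheory GRing.Theory Num.Theory.
Import numFieldNormedType.Exports.

Local Open Scope classical_set_scope.
Local Open Scope ring_scope.
Local Open Scope complex_scope.

Definition sigma_compact (T : topologicalType) : Prop :=
  exists K : nat -> set T,
    (forall n, compact (K n)) /\ \bigcup_n K n = [set: T].

(* The library only equips pointed types with a sigma-algebra; [borel x] is
   the type of [x] with [x] as its distinguished point (which plays no other
   role) and with the sigma-algebra generated by the open sets. *)
Definition based (T : topologicalType) (x : T) : Type := T.
HB.instance Definition _ (T : topologicalType) (x : T) :=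
  Topological.on (@based T x).
HB.instance Definition _ (T : topologicalType) (x : T) :=
  isPointed.Build (@based T x) x.

Notation borel x := (g_sigma_algebraType (@open (based x))).

Section Radon.
Variables (R : realType) (T : topologicalType) (x0 : T).

(* Regularity is inner regularity with respect to compact sets, on all Borel
   sets.  On sigma-compact locally compact Hausdorff spaces this agrees, for
   measures that are finite on compact sets, with the convention that asks
   for outer regularity on Borel sets and inner regularity on open sets.  In
   general, as on the dual group of a sigma-compact group, the two conventions
   assign different measures to locally null sets, which are null here. *)
Definition inner_regular (mu : set (borel x0) -> \bar R) : Prop :=
  forall A : set (borel x0), measurable A ->
    mu A = ereal_sup [set mu K | K in [set K : set T | compact K /\ K `<=` A]].

Definition radon (mu : set (borel x0) -> \bar R) : Prop :=
  (forall K : set T, compact K -> (mu K < +oo)%E) /\ inner_regular mu.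

End Radon.

Section ComplexIntegral.
Variables (R : realType) (d : measure_display) (T : measurableType d).
Variable mu : {measure set T -> \bar R}.
Implicit Types f g h : T -> R[i].

Definition cmeasurable f : Prop :=
  measurable_fun setT (fun x => complex.Re (f x)) /\
  measurable_fun setT (fun x => complex.Im (f x)).

(* Meaningful when the real and imaginary parts of [f] are integrable. *)
Definition cintegral f : R[i] :=
  (\int[mu]_x complex.Re (f x))%R +i* (\int[mu]_x complex.Im (f x))%R.

(* Elements of the complex Hilbert space L^2(T, mu) are handled through their
   representatives, i.e. square-integrable functions; equality in L^2 is
   [ae_equal]. *)
Definition L2 : set (T -> R[i]) :=
  [set f | (fun x => complex.Re (f x)) \in Lfun mu 2%:E /\
           (fun x => complex.Im (f x)) \in Lfun mu 2%:E].

Definition ae_equal f g : Prop := {ae mu, forall x, f x = g x}.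

Definition L2_dot f g : R[i] := cintegral (fun x => conjc (f x) * g x).

Definition L2_closure (S : set (T -> R[i])) : set (T -> R[i]) :=
  [set h | L2 h /\ forall e : R, 0 < e ->
     exists2 f, S f & (\int[mu]_x (Normc.normc (h x - f x) ^+ 2)%:E < e%:E)%E].

End ComplexIntegral.

Section CompactlySupported.
Variables (R : realType) (G : topologicalZmodType).
Notation C := (R[i]^o).

Definition supp (f : G -> C) : set G := closure [set x | f x != 0].

Definition cc_pred : {pred G -> C} :=
  mem [set f : G -> C | continuous f /\ compact (supp f)].

Lemma cc_predP (f : G -> C) :
  reflect (continuous f /\ compact (supp f)) (f \in cc_pred).
Proof. by apply: (iffP idP) => [/set_mem|/mem_set]. Qed.

Lemma compact_supp_sub (f : G -> C) (A : set G) :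
  compact A -> supp f `<=` A -> compact (supp f).
Proof. by move=> cA; apply: subclosed_compact => //; exact: closed_closure. Qed.

Lemma cc_submod_closed : submod_closed cc_pred.
Proof.
split.
  apply/cc_predP; split; first exact: cst_continuous.
  apply: (@compact_supp_sub _ set0); first exact: compact0.
  rewrite /supp (_ : [set x | _] = set0) ?closure0//.
  by apply/seteqP; split => // x /=; rewrite eqxx.
move=> a f g /cc_predP[cf sf] /cc_predP[cg sg]; apply/cc_predP; split.
  by move=> x; apply: cvgD; [apply: cvgZl_tmp; exact: cf|exact: cg].
apply: (@compact_supp_sub _ (supp f `|` supp g)); first exact: compactU.
rewrite /supp -closureU; apply: closure_subset => x /=.
apply: contra_neqP => /not_orP[/negP + /negP].
rewrite !negbK => /eqP fx /eqP gx.
by rewrite [LHS]/GRing.add/= [X in X + _]/GRing.scale/= fx gx scaler0 addr0.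
Qed.

HB.instance Definition _ :=
  GRing.isSubmodClosed.Build _ _ cc_pred cc_submod_closed.

Record Cc := MkCc { Cc_fun :> G -> C; _ : Cc_fun \in cc_pred }.

HB.instance Definition _ := [isSub for Cc_fun].
HB.instance Definition _ := [Choice of Cc by <:].
HB.instance Definition _ := [SubChoice_isSubLmodule of Cc by <:].


Lemma CcP (f : Cc) : continuous f /\ compact (supp f).
Proof. exact/cc_predP/valP. Qed.

Lemma supp_comp (f : G -> C) (h k : G -> G) :
  continuous h -> cancel h k -> supp (f \o h) `<=` k @` supp f.
Proof.
move=> ch hK x xs; exists (h x) => //.
move=> B /ch /xs[y /= [fy By]]; by exists (h y).
Qed.

Lemma cc_comp (f : Cc) (h k : G -> G) :
  continuous h -> continuous k -> cancel h k -> f \o h \in cc_pred.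
Proof.
move=> ch ck hK; have [cf sf] := CcP f; apply/cc_predP; split.
  by move=> x; apply: continuous_comp; [exact: ch|exact: cf].
apply: compact_supp_sub (supp_comp ch hK).
by apply: continuous_compact => //; exact: continuous_subspaceT.
Qed.

Lemma shift_continuous (t : G) : continuous (fun x : G => t + x).
Proof.
move=> x; apply: (@continuous_comp _ _ _ (fun x => (t, x))
  (fun x : G * G => x.1 + x.2)); last exact: add_continuous.
by apply: cvg_pair; [exact: cvg_cst|exact: cvg_id].
Qed.

Lemma Cc_shift_subproof (t : G) (f : Cc) : (fun x => f (t + x)) \in cc_pred.
Proof.
apply: (@cc_comp f (fun x => t + x) (fun x => - t + x)).
- exact: shift_continuous.
- exact: shift_continuous.
- exact: addKr.
Qed.

Definition Cc_shift (t : G) (f : Cc) : Cc := MkCc (Cc_shift_subproof t f).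

Lemma Cc_refl_subproof (f : Cc) : (fun x => f (- x)) \in cc_pred.
Proof.
by apply: (@cc_comp f -%R -%R); [exact: opp_continuous..|exact: opprK].
Qed.

Definition Cc_refl (f : Cc) : Cc := MkCc (Cc_refl_subproof f).

Lemma conjc_continuous : continuous (fun z : C => conjc z : C).
Proof.
move=> z; apply/(@cvgrPdist_lt _ C _ (nbhs (z : C))) => e e0.
have /(@cvgrPdist_lt _ C _ (nbhs (z : C)))/(_ e e0) := @cvg_id C (nbhs (z : C)).
apply: filterS => w; rewrite -rmorphB; apply: le_lt_trans.
by case: (z - w) => a b; rewrite !normc_def /= sqrrN.
Qed.

Lemma Cc_conj_subproof (f : Cc) : (fun x => conjc (f x) : C) \in cc_pred.
Proof.
have [cf sf] := CcP f; apply/cc_predP; split.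
  by move=> x; apply: continuous_comp; [exact: cf|exact: conjc_continuous].
apply: compact_supp_sub sf _.
by apply: closure_subset => x /=; rewrite conjc_eq0.
Qed.

Definition Cc_conj (f : Cc) : Cc := MkCc (Cc_conj_subproof f).

(** The inductive limit topology on C_c(G): the finest locally convex topology
    inducing on each C_K(G), K compact, a topology coarser than that of uniform
    convergence.  Its neighbourhoods of 0 are the sets containing an absolutely
    convex set that meets each C_K(G) in a neighbourhood of 0. *)

Definition absolutely_convex (W : set Cc) : Prop :=
  forall (a b : R[i]) (f g : Cc), `|a| + `|b| <= 1 -> W f -> W g ->
    W (a *: f + b *: g).

Definition indlim_nbhs0 (U : set Cc) : Prop :=
  exists W : set Cc, [/\ W `<=` U, absolutely_convex W &
    forall K : set G, compact K -> exists2 e : R[i], 0 < e &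
      forall f : Cc, supp f `<=` K -> (forall x, `|f x| < e) -> W f].

(* For linear maps, continuity at 0 is continuity. *)
Definition indlim_continuous (l : Cc -> C) : Prop :=
  forall e : R[i], 0 < e -> indlim_nbhs0 [set f | `|l f| < e].

End CompactlySupported.

Section RadonMeasures.
Variables (R : realType) (G : topologicalZmodType).
Notation C := (R[i]^o).
Notation Cc := (Cc R G).

(* The space M(G), the topological dual of C_c(G). *)
Record cmeas := CMeas {
  cm_fun :> {linear Cc -> C};
  cm_continuous : indlim_continuous cm_fun }.

HB.instance Definition _ := gen_eqMixin cmeas.
HB.instance Definition _ := gen_choiceMixin cmeas.

(* The vague topology. *)
HB.instance Definition _ := Topological.copy cmeas
  (initial_topology (fun mu : cmeas => (fun f => mu f) : {ptws Cc -> C})).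

(* The integral of g against mu.  The default value 0, used when g is not in
   C_c(G), never occurs below: [cm_int] is only applied to functions that are
   continuous with compact support. *)
Definition cm_int (mu : cmeas) (g : G -> C) : C := mu (insubd (0 : Cc) g).

Lemma indlim_continuous_comp (l l' : Cc -> C) (tau : Cc -> Cc)
    (c : R[i] -> R[i]) :
  indlim_continuous l -> (forall f, `|l' f| = `|l (tau f)|) ->
  (forall a, `|c a| = `|a|) ->
  (forall a b f g, tau (a *: f + b *: g) = c a *: tau f + c b *: tau g) ->
  (forall K : set G, compact K -> exists2 K' : set G, compact K' &
     forall f : Cc, supp f `<=` K -> supp (tau f) `<=` K') ->
  (forall (f : Cc) x, exists y, `|tau f x| = `|f y|) ->
  indlim_continuous l'.
Proof.
move=> lc ll' cn taul tauK taux e e0.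
have [W [Wl Wa WK]] := lc e e0; exists (tau @^-1` W); split.
- by move=> f /= /Wl /=; rewrite ll'.
- by move=> a b f g ab Wf Wg; rewrite /preimage/= taul; apply: Wa; rewrite ?cn.
- move=> K /tauK[K' /WK[d d0 dW] KK']; exists d => // f fK fd /=.
  by apply: dW => [|x]; [exact: KK'|have [y ->] := taux f x].
Qed.

Section Translation.
Variables (t : G) (mu : cmeas).

Definition translate_fun (f : Cc) : C := mu (Cc_shift t f).

Lemma translate_linear : linear translate_fun.
Proof.
move=> a f g; rewrite /translate_fun -linearP; congr (mu _).
exact/val_inj/funext.
Qed.

HB.instance Definition _ :=
  GRing.isLinear.Build R[i] Cc C *:%R translate_fun translate_linear.

Lemma translate_indlim_continuous : indlim_continuous translate_fun.
Proof.
apply: (@indlim_continuous_comp mu _ (Cc_shift t) id (cm_continuous mu)) => //.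
- by move=> a b f g; exact/val_inj/funext.
- move=> K cK; exists ((fun x => - t + x) @` K).
    apply: continuous_compact => //; apply: continuous_subspaceT.
    exact: shift_continuous.
  move=> f fK; apply: (subset_trans _ (image_subset _ fK)).
  by apply: supp_comp; [exact: shift_continuous|exact: addKr].
- by move=> f x; exists (t + x).
Qed.

(* The action alpha_t mu = delta_t * mu. *)
Definition translate : cmeas :=
  @CMeas translate_fun translate_indlim_continuous.

End Translation.

Section Conjugate.
Variable mu : cmeas.

Definition cm_conj_fun (f : Cc) : C := conjc (mu (Cc_conj f)).

Lemma cm_conj_linear : linear cm_conj_fun.
Proof.
move=> a f g; rewrite /cm_conj_fun.
have -> : Cc_conj (a *: f + g) = a^* *: Cc_conj f + Cc_conj g.
  by apply/val_inj/funext => x /=; rewrite rmorphD/= rmorphM.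
rewrite linearP rmorphD/=; congr (_ + _).
rewrite (_ : a^* *: mu (Cc_conj f) = a^* * mu (Cc_conj f))//.
by rewrite rmorphM/= conjcK.
Qed.

HB.instance Definition _ :=
  GRing.isLinear.Build R[i] Cc C *:%R cm_conj_fun cm_conj_linear.

Lemma norm_conjc (z : R[i]) : `|z^*| = `|z|.
Proof. by case: z => a b; rewrite !normc_def /= sqrrN. Qed.

Lemma cm_conj_indlim_continuous : indlim_continuous cm_conj_fun.
Proof.
apply: (@indlim_continuous_comp mu _ (@Cc_conj R G) conjc (cm_continuous mu)).
- by move=> f; exact: norm_conjc.
- exact: norm_conjc.
- move=> a b f g; apply/val_inj/funext => x /=.
  by rewrite rmorphD/= !rmorphM.
- move=> K cK; exists K => // f; apply: subset_trans.
  by apply: closure_subset => x /=; rewrite conjc_eq0.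
- by move=> f x; exists x; rewrite norm_conjc.
Qed.

Definition cm_conj : cmeas := @CMeas cm_conj_fun cm_conj_indlim_continuous.

End Conjugate.

Notation borelG := (borel (0 : G)).

Definition is_total_variation (mu : cmeas)
    (nu : {measure set borelG -> \bar R}) : Prop :=
  radon nu /\ exists u : borelG -> R[i],
    [/\ cmeasurable u, {ae nu, forall x, `|u x| = 1} &
        forall f : Cc, mu f = cintegral nu (fun x => f x * u x)].

(* The translation bounded measures of M_{C,V}(G). *)
Definition tbounded (c : R) (V : set G) : set cmeas :=
  [set mu | exists2 nu : {measure set borelG -> \bar R},
     is_total_variation mu nu &
     forall t : G, (nu ((fun x => (t + x)%R) @` V) <= c%:E)%E].

(* Dynamical systems on the translation bounded measures.  The empty system is
   excluded, as it carries no probability measure. *)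
Record tmds := Tmds {
  tmds_set : set cmeas;
  tmds_neq0 : tmds_set !=set0;
  tmds_closed : exists (c : R) (V : set G),
    [/\ 0 < c, V !=set0, open V, compact (closure V) &
        exists2 F : set cmeas, closed F & tmds_set = tbounded c V `&` F];
  tmds_invariant : forall t mu, tmds_set mu -> tmds_set (translate t mu) }.

Definition tmds_space (X : tmds) : Type := set_type (tmds_set X).
HB.instance Definition _ (X : tmds) := Topological.on (tmds_space X).

Definition tmds_point (X : tmds) : tmds_space X :=
  SigSub (mem_set (projT2 (cid (tmds_neq0 X)))).

Definition tmds_act (X : tmds) (t : G) (w : tmds_space X) : tmds_space X :=
  SigSub (mem_set (tmds_invariant t (set_mem (valP w)))).

Definition f_phi (phi : Cc) (mu : cmeas) : C := mu (Cc_refl phi).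

End RadonMeasures.

Notation borelG G := (borel (0 : G)).
Notation borelOmega X := (borel (tmds_point X)).

Section Dual.
Variables (R : realType) (G : topologicalZmodType).
Notation C := (R[i]^o).

Record dual_group := Dual {
  dual_fun :> G -> C;
  dual_continuous : continuous dual_fun;
  dual_norm1 : forall t, `|dual_fun t| = 1;
  dualD : forall s t, dual_fun (s + t) = dual_fun s * dual_fun t }.

HB.instance Definition _ := gen_eqMixin dual_group.
HB.instance Definition _ := gen_choiceMixin dual_group.
HB.instance Definition _ := Topological.copy dual_group
  (initial_topology
    (fun chi : dual_group => (chi : G -> C) : {compact-open, G -> C})).

Lemma dual1_subproof : continuous (fun _ : G => 1 : C).
Proof. exact: cst_continuous. Qed.

Definition dual1 : dual_group := @Dual (fun=> 1) dual1_subproof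
  (fun=> normr1 _) (fun _ _ => esym (mul1r _)).

Section Inverse.
Variable chi : dual_group.

Lemma dualV_continuous : continuous (fun t => (chi t)^-1 : C).
Proof.
move=> t; apply: cvgV; last exact: dual_continuous.
by rewrite -normr_eq0 dual_norm1 oner_neq0.
Qed.

Lemma dualV_norm1 t : `|(chi t)^-1| = 1.
Proof. by rewrite normfV dual_norm1 invr1. Qed.

Lemma dualVD s t : (chi (s + t))^-1 = (chi s)^-1 * (chi t)^-1.
Proof. by rewrite dualD invfM. Qed.

Definition dualV : dual_group := Dual dualV_continuous dualV_norm1 dualVD.

End Inverse.

End Dual.

Notation borelDual R G := (borel (dual1 R G)).

Section Fourier.
Variables (R : realType) (G : topologicalZmodType).
Notation C := (R[i]^o).

Definition is_haar (haar : {measure set borelG G -> \bar R}) : Prop :=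
  [/\ radon haar, haar setT != 0%E &
      forall (t : G) (A : set (borelG G)), measurable A ->
        haar ((fun x => t + x) @` (A : set G)) = haar A].

Variable haar : {measure set borelG G -> \bar R}.

Definition convolution (f g : G -> C) (t : G) : C :=
  cintegral haar (fun s => f s * g (t - s)).

Definition tilde (f : G -> C) (t : G) : C := conjc (f (- t)).

Definition fourier (f : G -> C) (chi : dual_group R G) : C :=
  cintegral haar (fun t => conjc (chi t) * f t).

End Fourier.

Section Diffraction.
Variables (R : realType) (G : topologicalZmodType).
Notation C := (R[i]^o).
Variables (X : tmds R G) (m : probability (borelOmega X) R).

(* The autocorrelation measure; it does not depend on sigma provided that sigma
   has Haar integral 1. *)
Definition autocorrelation (sigma : Cc R G) (phi : Cc R G) : C :=
  cintegral m (fun w : borelOmega X =>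
    cm_int (val w) (fun t =>
      f_phi phi (translate (- t) (cm_conj (val w))) * sigma t)).

(* The diffraction measure, as the positive Radon measure on the dual group
   characterised by its relation to the autocorrelation. The function
   [phi * phi~] is again in C_c(G), so [insubd] does not use its default. *)
Definition is_diffraction (haar : {measure set borelG G -> \bar R})
    (sigma : Cc R G) (dif : {measure set borelDual R G -> \bar R}) : Prop :=
  radon dif /\ forall phi : Cc R G,
    let c := autocorrelation sigma
               (insubd (0 : Cc R G) (convolution haar phi (tilde phi))) in
    (\int[dif]_chi (Normc.normc (fourier haar phi (dualV chi)) ^+ 2)%:E
       = (complex.Re c)%:E)%E /\ complex.Im c = 0.

End Diffraction.

Section Spectral.
Variables (R : realType) (G : topologicalZmodType).
Variables (X : tmds R G) (m : probability (borelOmega X) R).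
Notation fn := (borelOmega X -> R[i]).
Implicit Types (f g : fn) (A B : set (borelDual R G)).

Definition act_invariant : Prop :=
  forall (t : G) (A : set (borelOmega X)), measurable A ->
    m ((fun w => tmds_act t w) @^-1` A) = m A.

Definition translation_rep (t : G) f : fn := fun w => f (tmds_act (- t) w).

Definition U_space : set fn :=
  L2_closure m [set h | exists phi : Cc R G,
                  h = fun w => f_phi phi (val w)].

Definition represents (E : set (borelDual R G) -> fn -> fn) f
    (rho : {finite_measure set borelDual R G -> \bar R}) : Prop :=
  radon rho /\
  forall B, measurable B -> L2_dot m f (E B f) = (fine (rho B))%:C.

(* Projection valued measures on the closed subspace V of L^2(Omega, m): each
   [E B] is an orthogonal projection of V, and the measures <f, E(.) f> are
   regular. *)
Record is_pvm (V : set fn) (E : set (borelDual R G) -> fn -> fn) : Prop := {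
  pvm_stable : forall B f, measurable B -> V f -> V (E B f);
  pvm_ext : forall B f g, measurable B -> V f -> V g ->
    ae_equal m f g -> ae_equal m (E B f) (E B g);
  pvm_linear : forall B (a : R[i]) f g, measurable B -> V f -> V g ->
    ae_equal m (E B (fun w => a * f w + g w))
               (fun w => a * E B f w + E B g w);
  pvm_selfadjoint : forall B f g, measurable B -> V f -> V g ->
    L2_dot m f (E B g) = L2_dot m (E B f) g;
  pvm_total : forall f, V f -> ae_equal m (E setT f) f;
  (* in particular, [E B] is idempotent *)
  pvm_meet : forall A B f, measurable A -> measurable B -> V f ->
    ae_equal m (E (A `&` B) f) (E A (E B f));
  pvm_measure : forall f, V f -> exists rho, represents E f rho }.

(* [E] is the projection valued measure associated by Stone's theorem with the
   restriction of T to V. *)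
Definition is_stone_pvm (V : set fn) (E : set (borelDual R G) -> fn -> fn)
    : Prop :=
  is_pvm V E /\
  forall f rho, V f -> represents E f rho ->
    forall t : G, L2_dot m f (translation_rep t f) = cintegral rho (fun chi => chi t).

End Spectral.

(* Main.v *)
(** For [phi] in [C_c(G)] let [f(w) = w(phi)] and let [W(chi) = |F(chi)|^2] with
    [F(chi) = \int chi(t) phi(t) dt].  Exchanging the Haar integral with the
    integrals against [w] and against [m], the invariance of [m] yields
    [gamma_m(phi * phi~) = |f|^2] in [L^2(m)], so that [|f|^2] is the integral of
    [W] against the diffraction measure.  By polarisation, [<f, T^t f>] is the
    integral of [chi(t) W(chi)].  Finite Radon measures on the dual group are
    determined by their integrals against the characters, since trigonometric
    polynomials with values in [0, 1] separate disjoint compact sets up to any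
    error; hence [W] times the diffraction measure is the spectral measure of [f].
    A set is null for all these measures if and only if it is null for the
    diffraction measure, because at every character some [W] does not vanish;
    and [E] vanishes on it if and only if it is null for all of them, because the
    functions [f] are dense. *)

Require Import Defs.
From HB Require Import structures.
From mathcomp Require Import all_boot all_order all_algebra.
From mathcomp Require Import all_classical all_reals all_analysis.
From mathcomp Require Import complex.
From mathcomp Require Import measurable_realfun ring lra.
Import Order.TTheory GRing.Theory Num.Theory.
Import numFieldNormedType.Exports.
Local Open Scope classical_set_scope.
Local Open Scope ring_scope.
Local Open Scope complex_scope.

Set Implicit Arguments.
Unset Strict Implicit.
Unset Printing Implicit Defensive.

(** Two obstacles shape the proof. Neither [G] nor the space of [X] need be second countable, so
    each exchange of integrals rests on uniform approximation instead of product measurability. The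
    integrands form families that are equicontinuous in a Haar variable confined to a compact set,
    uniformly in the remaining variable; for the integrals against the points of [X], this
    uniformity is exactly what translation boundedness supplies. The dual group need not be
    sigma-compact, nor the diffraction measure finite. The product of [W] with that measure is
    therefore never built: weighted integrals over Borel sets are compared directly, first over
    compact sets and then, by tightness, over all Borel sets. Tightness follows from inner
    regularity because [W] is bounded and integrable, so that the sets where it exceeds a positive
    constant have finite measure. Since only null sets matter, one inequality on compact sets, used
    in both directions, is enough. The factors 2 in the norm estimates come from bounding real and
    imaginary parts separately. *)

Local Notation normc := Normc.normc.

(** * Complex numbers with a real-valued modulus *)

Section ComplexModulus.
Context {R : realType}.
Implicit Types z w : R[i].

Lemma normr_normc z : `|z| = (normc z)%:C.
Proof. by case: z => a b; rewrite normc_def. Qed.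

Lemma normc_ge0 z : 0 <= normc z.
Proof. by case: z => a b; rewrite /= sqrtr_ge0. Qed.

Lemma normcD z w : normc (z + w) <= normc z + normc w.
Proof. exact: (le_normcD (z : Rcomplex R)). Qed.

Lemma normcN z : normc (- z) = normc z.
Proof. by case: z => a b; rewrite /= !sqrrN. Qed.

Lemma normc_distC z w : normc (z - w) = normc (w - z).
Proof. by rewrite -normcN opprB. Qed.

Lemma normcM z w : normc (z * w) = normc z * normc w.
Proof. exact: Normc.normcM. Qed.

Lemma normcJ z : normc (conjc z) = normc z.
Proof. by case: z => a b; rewrite /= sqrrN. Qed.

Lemma sqr_normc z : normc z ^+ 2 = complex.Re z ^+ 2 + complex.Im z ^+ 2.
Proof. by case: z => a b; rewrite /= sqr_sqrtr// addr_ge0// sqr_ge0. Qed.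

Lemma conjcM_normc z : conjc z * z = (normc z ^+ 2)%:C.
Proof.
rewrite sqr_normc; case: z => a b; apply/eqP; rewrite eq_complex /=.
by apply/andP; split; apply/eqP; ring.
Qed.

Lemma normc_real (x : R) : normc x%:C = `|x|.
Proof. by rewrite /= expr0n addr0 sqrtr_sqr. Qed.

Lemma Re_le_normc z : `|complex.Re z| <= normc z.
Proof.
by case: z => a b /=; rewrite -sqrtr_sqr ler_sqrt ?lerDl ?addr_ge0 ?sqr_ge0.
Qed.

Lemma Im_le_normc z : `|complex.Im z| <= normc z.
Proof.
by case: z => a b /=; rewrite -sqrtr_sqr ler_sqrt ?lerDr ?addr_ge0 ?sqr_ge0.
Qed.

Lemma normc_le_ReIm z : normc z <= `|complex.Re z| + `|complex.Im z|.
Proof.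
have h : 0 <= `|complex.Re z| + `|complex.Im z| by rewrite addr_ge0.
rewrite -(@ler_pXn2r _ 2) ?nnegrE ?normc_ge0// sqr_normc sqrrD !real_normK ?num_real//.
by rewrite -addrA lerD2l lerDr mulrn_wge0// mulr_ge0.
Qed.

Lemma normc_eq0 z : (normc z = 0) -> z = 0.
Proof. exact: Normc.eq0_normc. Qed.

Lemma normc0_le z : (forall e : R, 0 < e -> normc z <= e) -> z = 0.
Proof.
move=> h; apply: normc_eq0; apply/eqP; rewrite eq_le normc_ge0 andbT.
by apply/ler_addgt0Pr => e e0; rewrite add0r h.
Qed.

Lemma ReD z w : complex.Re (z + w) = complex.Re z + complex.Re w.
Proof. by case: z; case: w. Qed.
Lemma ImD z w : complex.Im (z + w) = complex.Im z + complex.Im w.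
Proof. by case: z; case: w. Qed.
Lemma ReM z w : complex.Re (z * w)
  = complex.Re z * complex.Re w - complex.Im z * complex.Im w.
Proof. by case: z; case: w. Qed.
Lemma ImM z w : complex.Im (z * w)
  = complex.Re z * complex.Im w + complex.Im z * complex.Re w.
Proof. by case: z => a b; case: w. Qed.
Lemma ReJ z : complex.Re (conjc z) = complex.Re z.
Proof. by case: z. Qed.
Lemma ImJ z : complex.Im (conjc z) = - complex.Im z.
Proof. by case: z. Qed.

(** The expansion behind polarisation: with [c] equal to 1 and to the imaginary unit, the last term
    gives the real and, up to sign, the imaginary part of the scalar product. *)
Lemma sqr_normcD (x y c : R[i]) : normc c = 1 ->
  normc (x + c * y) ^+ 2 =
  normc x ^+ 2 + normc y ^+ 2 + 2 * complex.Re (c * (conjc x * y)).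
Proof.
move=> c1; have := sqr_normc c; rewrite c1 expr1n !sqr_normc.
case: x y c {c1} => a b [a' b'] [p q] /= pq.
transitivity (a ^+ 2 + b ^+ 2 + (p ^+ 2 + q ^+ 2) * (a' ^+ 2 + b' ^+ 2) +
  2 * (p * (a * a' - - b * b') - q * (a * b' + - b * a'))); first by ring.
by rewrite -pq mul1r.
Qed.

(** Continuity into [R[i]^o] quantifies over radii in [R[i]]; this form lets all later estimates be
    made with real numbers. *)
Lemma continuous_normcP (T : topologicalType) (f : T -> R[i]^o) x :
  {for x, continuous f} <->
  forall e : R, 0 < e -> \forall y \near x, normc (f y - f x) < e.
Proof.
split=> [cf e e0|h].
  have e0' : 0 < e%:C by rewrite ltcR.
  have /(@cvgrPdist_lt _ R[i]^o)/(_ _ e0') := cf.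
  by apply: filterS => y; rewrite normr_normc normc_distC ltcR.
apply/(@cvgrPdist_lt _ R[i]^o) => e e0.
have eE : e = (complex.Re e)%:C.
  by rewrite RRe_real// realE ltW.
move: e0; rewrite eE ltcR => /h; apply: filterS => y.
by rewrite normr_normc normc_distC ltcR.
Qed.

Lemma continuous_Re (T : topologicalType) (f : T -> R[i]^o) :
  continuous f -> continuous (fun x => complex.Re (f x)).
Proof.
move=> cf x; apply/cvgrPdist_lt => e e0.
have /continuous_normcP/(_ e e0) := cf x; apply: filterS => y.
apply: le_lt_trans; rewrite normc_distC.
by apply: le_trans (Re_le_normc _); rewrite ReD; case: (f y).
Qed.

Lemma continuous_Im (T : topologicalType) (f : T -> R[i]^o) :
  continuous f -> continuous (fun x => complex.Im (f x)).
Proof.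
move=> cf x; apply/cvgrPdist_lt => e e0.
have /continuous_normcP/(_ e e0) := cf x; apply: filterS => y.
apply: le_lt_trans; rewrite normc_distC.
by apply: le_trans (Im_le_normc _); rewrite ImD; case: (f y).
Qed.

Lemma continuous_cM (T : topologicalType) (f g : T -> R[i]) :
  continuous (f : T -> R[i]^o) -> continuous (g : T -> R[i]^o) ->
  continuous ((fun x => f x * g x) : T -> R[i]^o).
Proof. by move=> cf cg x; apply: cvgM; [exact: cf|exact: cg]. Qed.

Lemma continuous_clin (T : topologicalType) (a b : R[i]) (f g : T -> R[i]) :
  continuous (f : T -> R[i]^o) -> continuous (g : T -> R[i]^o) ->
  continuous ((fun x => a * f x + b * g x) : T -> R[i]^o).
Proof.
by move=> cf cg x; apply: (@cvgD _ R[i]^o); (apply: cvgM; first exact: cvg_cst);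
  [exact: cf|exact: cg].
Qed.

End ComplexModulus.

(** If [P K] failed, the sets [A] with [P (K \ A)] would form a proper filter containing [K]. At a
    cluster point [x], a neighbourhood [U] with [P U] puts the complement of [U] in the filter,
    although that complement misses [U]. Most compactness arguments below go through this
    principle. *)
Lemma compact_ind (T : topologicalType) (K : set T) (P : set T -> Prop) :
  compact K -> (forall A B, A `<=` B -> P B -> P A) -> P set0 ->
  (forall A B, P A -> P B -> P (A `|` B)) ->
  (forall x, K x -> exists2 U, nbhs x U & P U) -> P K.
Proof.
move=> cK Psub P0 PU Ploc; apply: contrapT => nPK.
pose F : set_system T := fun A => P (K `\` A).
have FF : ProperFilter F.
  split; first by rewrite /F setD0.
  split; first by rewrite /F setDT.
  - by move=> A B FA FB; rewrite /F setDIr; exact: PU.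
  - by move=> A B AB; apply: Psub; exact: setDS.
have [x [Kx clx]] : K `&` cluster F !=set0.
  by apply: cK => //; rewrite /F setDv.
have [U xU PUU] := Ploc _ Kx.
have /clx/(_ xU)[y []] // : F (~` U).
by rewrite /F setDE setCK; apply: Psub PUU => y [].
Qed.

(** * Complex integrals *)

Section BorelFunctions.
Context {R : realType} {T : topologicalType} (x0 : T).

Lemma open_borel (A : set T) : open A -> measurable (A : set (borel x0)).
Proof. by move=> oA; exact: sub_sigma_algebra. Qed.

Lemma closed_borel (A : set T) : closed A -> measurable (A : set (borel x0)).
Proof.
by move=> cA; rewrite -(setCK A); apply: measurableC; apply: open_borel; exact: closed_openC.
Qed.

(** Continuity is only asked relative to [K], because the integrands below are controlled on [K] and
    extended by 0. *)
Lemma continuous_within_borel (K : set T) (f : T -> R) : closed K ->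
  (forall x, K x -> forall e : R, 0 < e ->
     \forall y \near x, K y -> `|f y - f x| < e) ->
  (forall x, ~ K x -> f x = 0) ->
  measurable_fun setT (f : borel x0 -> R).
Proof.
move=> clK cf f0.
have mK : measurable (K : set (borel x0)) by exact: closed_borel.
have -> : (f : borel x0 -> R) = ((f : borel x0 -> R) \_ K).
  apply/funext => x; rewrite patchE; case: ifPn => // /negP xK.
  by rewrite f0// => Kx; apply: xK; rewrite inE.
apply/(measurable_restrictT _ mK).
apply: (measurability _ (RGenOInfty.measurableE R)) => _ [_ [a ->]] <-.
(* The union of all open sets whose trace on [K] lies in the superlevel set is open, hence Borel,
   and has the required trace; no choice of neighbourhoods is needed. *)
pose O := \bigcup_(A in [set A : set T | open A /\ A `&` K `<=` [set x | a < f x]]) A.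
rewrite (_ : K `&` _ = K `&` O).
  apply: measurableI => //; apply: open_borel.
  by apply: bigcup_open => A [].
apply/seteqP; split => x [Kx] /=.
  rewrite in_itv /= andbT => ax; split => //.
  have e0 : 0 < f x - a by rewrite subr_gt0.
  have : nbhs x [set y | K y -> `|f y - f x| < f x - a] := cf x Kx _ e0.
  rewrite nbhsE => -[A [oA Ax] AK].
  exists A => //=; split=> // y [Ay Ky] /=.
  by have := AK _ Ay Ky; rewrite ltr_norml => /andP[+ _]; rewrite opprB ltrBrDl addrC subrK.
move=> [A [oA AK] Ax]; split => //.
by rewrite in_itv/= andbT; apply: AK.
Qed.

Lemma continuous_borel (f : T -> R) : continuous f ->
  measurable_fun setT (f : borel x0 -> R).
Proof.
move=> cf; apply: (@continuous_within_borel setT) => //.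
  move=> x _ e e0; have /cvgrPdist_lt/(_ e e0) := cf x.
  by apply: filterS => y + _; rewrite distrC.
by move=> x /(_ I).
Qed.

Lemma continuous_cborel (f : T -> R[i]) : continuous (f : T -> R[i]^o) ->
  cmeasurable (f : borel x0 -> R[i]).
Proof.
move=> cf; split; apply: continuous_borel.
- exact: (@continuous_Re R T f).
- exact: (@continuous_Im R T f).
Qed.

End BorelFunctions.
Arguments continuous_cborel {R T x0 f} _.
Arguments open_borel {T} x0 {A} _.
Arguments closed_borel {T} x0 {A} _.

Section ComplexIntegration.
Context {R : realType} {d : measure_display} {T : measurableType d}.
Variable mu : {measure set T -> \bar R}.
Implicit Types f g : T -> R[i].

Definition cintegrable f : Prop :=
  mu.-integrable setT (EFin \o (fun x => complex.Re (f x))) /\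
  mu.-integrable setT (EFin \o (fun x => complex.Im (f x))).

Lemma integrable_lin (a b : R) (f g : T -> R) :
  mu.-integrable setT (EFin \o f) -> mu.-integrable setT (EFin \o g) ->
  mu.-integrable setT (EFin \o (fun x => a * f x + b * g x)).
Proof.
move=> fi gi.
have -> : EFin \o (fun x => a * f x + b * g x) =
  (fun x => a%:E * (f x)%:E)%E \+ (fun x => b%:E * (g x)%:E)%E.
  by apply/funext => x /=; rewrite EFinD !EFinM.
by apply: integrableD => //; exact: integrableZl.
Qed.

Lemma Rintegral_lin (a b : R) (f g : T -> R) :
  mu.-integrable setT (EFin \o f) -> mu.-integrable setT (EFin \o g) ->
  \int[mu]_x (a * f x + b * g x) = a * \int[mu]_x f x + b * \int[mu]_x g x.
Proof.
move=> fi gi; rewrite RintegralD//; first by rewrite !RintegralZl.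
- have := integrable_lin a 0 fi gi; congr (integrable _ _ _).
  by apply/funext => x /=; rewrite mul0r addr0.
- have := integrable_lin b 0 gi gi; congr (integrable _ _ _).
  by apply/funext => x /=; rewrite mul0r addr0.
Qed.

Lemma cintegrable_lin (a b : R[i]) f g : cintegrable f -> cintegrable g ->
  cintegrable (fun x => a * f x + b * g x).
Proof.
move=> [fr fi] [gr gi]; split.
- have := integrable_lin 1 1 (integrable_lin (complex.Re a) (- complex.Im a) fr fi)
    (integrable_lin (complex.Re b) (- complex.Im b) gr gi).
  congr (integrable _ _ _); apply/funext => x /=.
  by rewrite ReD !ReM; congr EFin; ring.
- have := integrable_lin 1 1 (integrable_lin (complex.Im a) (complex.Re a) fr fi)
    (integrable_lin (complex.Im b) (complex.Re b) gr gi).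
  congr (integrable _ _ _); apply/funext => x /=.
  by rewrite ImD !ImM; congr EFin; ring.
Qed.

Lemma cintegral_lin (a b : R[i]) f g : cintegrable f -> cintegrable g ->
  cintegral mu (fun x => a * f x + b * g x) =
  a * cintegral mu f + b * cintegral mu g.
Proof.
move=> [fr fi] [gr gi]; apply/eqP; rewrite eq_complex; apply/andP; split; apply/eqP.
- rewrite ReD !ReM /=; transitivity (\int[mu]_x (
    1 * (complex.Re a * complex.Re (f x) + (- complex.Im a) * complex.Im (f x)) +
    1 * (complex.Re b * complex.Re (g x) + (- complex.Im b) * complex.Im (g x)))).
    by congr Rintegral; apply/funext => x; rewrite ReD !ReM; ring.
  by rewrite !Rintegral_lin//; try exact: integrable_lin; ring.
- rewrite ImD !ImM /=; transitivity (\int[mu]_x (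
    1 * (complex.Im a * complex.Re (f x) + complex.Re a * complex.Im (f x)) +
    1 * (complex.Im b * complex.Re (g x) + complex.Re b * complex.Im (g x)))).
    by congr Rintegral; apply/funext => x; rewrite ImD !ImM; ring.
  by rewrite !Rintegral_lin//; try exact: integrable_lin; ring.
Qed.

Lemma cintegralZ (a : R[i]) f : cintegrable f ->
  cintegral mu (fun x => a * f x) = a * cintegral mu f.
Proof.
move=> fi; have := cintegral_lin a 0 fi fi; rewrite mul0r addr0 => <-.
by congr cintegral; apply/funext => x; rewrite mul0r addr0.
Qed.

Lemma cintegral_conj f :
  cintegrable f -> cintegral mu (fun x => conjc (f x)) = conjc (cintegral mu f).
Proof.
move=> [fr fi]; apply/eqP; rewrite eq_complex /=; apply/andP; split; apply/eqP.
  by congr Rintegral; apply/funext => x; rewrite ReJ.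
transitivity (\int[mu]_x (- 1 * complex.Im (f x))).
  by congr Rintegral; apply/funext => x; rewrite ImJ mulN1r.
by rewrite RintegralZl// mulN1r.
Qed.

Lemma cmeasurableM f g : cmeasurable f -> cmeasurable g ->
  cmeasurable (fun x => f x * g x).
Proof.
move=> [fr fi] [gr gi]; split.
- rewrite (_ : (fun x => _) = fun x => complex.Re (f x) * complex.Re (g x) -
    complex.Im (f x) * complex.Im (g x)); last by apply/funext => x; rewrite ReM.
  by apply: measurable_funB; apply: measurable_funM.
- rewrite (_ : (fun x => _) = fun x => complex.Re (f x) * complex.Im (g x) +
    complex.Im (f x) * complex.Re (g x)); last by apply/funext => x; rewrite ImM.
  by apply: measurable_funD; apply: measurable_funM.
Qed.

Lemma cmeasurableJ f : cmeasurable f -> cmeasurable (fun x => conjc (f x)).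
Proof.
move=> [fr fi]; split.
  by rewrite (_ : (fun x => _) = fun x => complex.Re (f x))//; apply/funext => x; rewrite ReJ.
rewrite (_ : (fun x => _) = fun x => - complex.Im (f x)).
  exact: measurableT_comp.
by apply/funext => x; rewrite ImJ.
Qed.

Lemma cmeasurable_real (w : T -> R) : measurable_fun setT w ->
  cmeasurable (fun x => (w x)%:C).
Proof. by move=> mw; split => //=; exact: measurable_cst. Qed.

Lemma cmeasurable_sqr_normc f : cmeasurable f ->
  measurable_fun setT (fun x => normc (f x) ^+ 2).
Proof.
move=> [fr fi].
rewrite (_ : (fun x => _) = fun x => complex.Re (f x) ^+ 2 + complex.Im (f x) ^+ 2).
  by apply: measurable_funD; exact: measurable_funX.
by apply/funext => x; rewrite sqr_normc.
Qed.

Lemma cintegrable_le f (w : T -> R) : cmeasurable f ->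
  (forall x, normc (f x) <= w x) -> mu.-integrable setT (EFin \o w) ->
  cintegrable f.
Proof.
move=> [fr fi] fw wi; split; apply: (le_integrable _ _ _ wi) => //.
- exact/measurable_EFinP.
- move=> x _; rewrite /= lee_fin; apply: le_trans (Re_le_normc _) _.
  exact: le_trans (fw x) (ler_norm _).
- exact/measurable_EFinP.
- move=> x _; rewrite /= lee_fin; apply: le_trans (Im_le_normc _) _.
  exact: le_trans (fw x) (ler_norm _).
Qed.

Lemma cintegral0 : cintegral mu (fun=> 0) = 0.
Proof. by rewrite /cintegral /= /Rintegral integral0. Qed.

Section Bounded.
Variables (A : set T) (mA : measurable A) (Afin : (mu A < +oo)%E).

Lemma integrable_supported (f : T -> R) (M : R) : measurable_fun setT f ->
  (forall x, `|f x| <= M) -> (forall x, ~ A x -> f x = 0) ->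
  mu.-integrable setT (EFin \o f).
Proof.
move=> mf fM f0.
have -> : EFin \o f = (EFin \o f) \_ A.
  apply/funext => x; rewrite patchE; case: ifPn => // /negP xA.
  by rewrite /= f0// => Ax; apply: xA; rewrite inE.
apply/(integrable_mkcond _ mA); apply: measurable_bounded_integrable => //.
- exact: measurable_funTS.
- exists M; split; first by rewrite num_real.
  by move=> N MN x _; apply: le_trans (ltW MN).
Qed.

Lemma Rintegral_supported_le (f : T -> R) (M : R) : 0 <= M ->
  measurable_fun setT f -> {ae mu, forall x, `|f x| <= M} ->
  (forall x, ~ A x -> f x = 0) -> `|\int[mu]_x f x| <= M * fine (mu A).
Proof.
move=> M0 mf fM f0; have mfA : measurable_fun A f by exact: measurable_funTS.
have -> : f = f \_ A.
  apply/funext => x; rewrite patchE; case: ifPn => // /negP xA.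
  by rewrite /= f0// => Ax; apply: xA; rewrite inE.
rewrite -Rintegral_mkcond /Rintegral.
have h : (`|\int[mu]_(x in A) (f x)%:E| <= M%:E * mu A)%E.
  apply: le_trans (le_abse_integral _ _ _) _ => //; first exact/measurable_EFinP.
  apply: integral_le_bound => //; first exact/measurable_EFinP.
  by apply: filterS fM => x fx _; rewrite lee_fin.
have Af : mu A \is a fin_num by rewrite ge0_fin_numE.
have If : (\int[mu]_(x in A) (f x)%:E)%E \is a fin_num.
  rewrite fin_num_abs; apply: le_lt_trans h _.
  by rewrite -(fineK Af) -EFinM ltry.
by rewrite -lee_fin EFinM fineK// -abse_EFin fineK.
Qed.

Lemma cintegrable_supported f (M : R) : cmeasurable f ->
  (forall x, normc (f x) <= M) -> (forall x, ~ A x -> f x = 0) -> cintegrable f.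
Proof.
move=> [mr mi] fM f0; split; apply: (@integrable_supported _ M) => // x.
- exact: le_trans (Re_le_normc _) _.
- by move=> /f0 ->.
- exact: le_trans (Im_le_normc _) _.
- by move=> /f0 ->.
Qed.

Lemma cintegral_supported_le f (M : R) : 0 <= M -> cmeasurable f ->
  {ae mu, forall x, normc (f x) <= M} -> (forall x, ~ A x -> f x = 0) ->
  normc (cintegral mu f) <= 2 * (M * fine (mu A)).
Proof.
move=> M0 [mr mi] fM f0; apply: le_trans (normc_le_ReIm _) _.
rewrite mulr_natl mulr2n; apply: lerD; apply: Rintegral_supported_le => //.
- by apply: filterS fM => x; apply: le_trans (Re_le_normc _).
- by move=> x /f0 ->.
- by apply: filterS fM => x; apply: le_trans (Im_le_normc _).
- by move=> x /f0 ->.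
Qed.

End Bounded.
End ComplexIntegration.

(** * Riemann sums and exchange of integrals *)

Section RiemannSums.
Context {R : realType} {T : topologicalType} {x0 : T}.
Variable mu : {measure set (borel x0) -> \bar R}.
Variables (K : set T) (compactK : compact K) (closedK : closed K).
Hypothesis muK : (mu K < +oo)%E.

(** The point is the order of quantifiers: the weights and nodes depend on the neighbourhoods [U]
    alone, so one sum serves every function that oscillates by at most [e] on them. The bound [M]
    enters only through integrability and not through the error. *)
Lemma riemann_sum (U : T -> set T) : (forall x, K x -> nbhs x (U x)) ->
  exists s : seq (R * T), forall (h : T -> R) (e M : R),
    measurable_fun setT (h : borel x0 -> R) ->
    (forall x, `|h x| <= M) -> (forall x, ~ K x -> h x = 0) ->
    (forall x y, K x -> K y -> U x y -> `|h y - h x| <= e) ->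
    `|\int[mu]_x h x - \sum_(p <- s) p.1 * h p.2| <= e * fine (mu K).
Proof.
move=> nU; have mK : measurable (K : set (borel x0)) by exact: closed_borel.
(* [A] need not be Borel, so the property concerns all Borel subsets of an open set around [A]. This
   is stable under unions, since a Borel [B] inside [W1] or [W2] splits into [B] intersected with
   [W1] and the rest, which lies in [W2]. *)
pose P (A : set T) := exists W : set T, [/\ open W, A `<=` W &
  forall B : set (borel x0), measurable B -> B `<=` W `&` K ->
  exists s : seq (R * T), forall (h : T -> R) (e M : R),
    measurable_fun setT (h : borel x0 -> R) ->
    (forall x, `|h x| <= M) ->
    (forall x y, K x -> K y -> U x y -> `|h y - h x| <= e) ->
    `|\int[mu]_(x in B) h x - \sum_(p <- s) p.1 * h p.2| <= e * fine (mu B)].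
have fin (B : set (borel x0)) : measurable B -> B `<=` K -> (mu B < +oo)%E.
  by move=> mB BK; apply: le_lt_trans muK; apply: le_measure; rewrite ?inE.
have int (B : set (borel x0)) (h : T -> R) (M : R) : measurable B -> B `<=` K ->
    measurable_fun setT (h : borel x0 -> R) -> (forall x, `|h x| <= M) ->
    mu.-integrable B (EFin \o h).
  move=> mB BK mh hM; apply: measurable_bounded_integrable => //.
  - exact: fin.
  - exact: measurable_funTS.
  - by exists M; split; [rewrite num_real|move=> N MN x _; apply: le_trans (ltW MN)].
have : P K.
  apply: compact_ind compactK _ _ _ _.
  - by move=> A B AB [W [oO BO HO]]; exists W; split => //; exact: subset_trans BO.
  - exists set0; split; [exact: open0|by []|move=> B mB]; rewrite set0I subset0 => ->.
    exists [::] => h e M mh hM hU.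
    by rewrite big_nil Rintegral_set0 measure0 subrr normr0 mulr0.
  - move=> A1 A2 [W1 [oO1 AO1 H1]] [W2 [oO2 AO2 H2]]; exists (W1 `|` W2).
    split; [exact: openU|exact: setUSS|move=> B mB BO].
    have mO1 : measurable (W1 : set (borel x0)) by exact: open_borel.
    have mB1 : measurable (B `&` W1) by exact: measurableI.
    have mB2 : measurable (B `\` W1) by exact: measurableD.
    have BK : B `<=` K by move=> x /BO[].
    have B1K : B `&` W1 `<=` K by move=> x [/BK].
    have B2K : B `\` W1 `<=` K by move=> x [/BK].
    have [||s1 hs1] := H1 (B `&` W1) => //; first by move=> x [/BO[_ ?] ?].
    have [||s2 hs2] := H2 (B `\` W1) => //; first by move=> x [/BO[[|]]].
    exists (s1 ++ s2) => h e M mh hM hU.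
    have BE : B = (B `&` W1) `|` (B `\` W1) by rewrite setUIDK.
    have -> : \int[mu]_(x in B) h x =
        \int[mu]_(x in B `&` W1) h x + \int[mu]_(x in B `\` W1) h x.
      rewrite -Rintegral_setU//.
      - by rewrite -BE.
      - by rewrite -BE; exact: int.
      - by apply/disj_setPS => x [[_ ?] [_ ?]].
    have -> : fine (mu B) = fine (mu (B `&` W1)) + fine (mu (B `\` W1)).
      rewrite -fineD ?ge0_fin_numE//; try exact: fin.
      by congr fine; rewrite addeC; exact: measureDI.
    rewrite big_cat /= opprD addrACA mulrDr.
    by apply: le_trans (ler_normD _ _) (lerD (hs1 _ _ _ mh hM hU) (hs2 _ _ _ mh hM hU)).
  - move=> x Kx; exists (interior (U x)); first by apply: nbhs_interior; exact: nU.
    exists (interior (U x)); split => //; first exact: open_interior.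
    (* A Borel piece inside [U x] needs the single node [x], weighted by the measure of the
       piece. *)
    move=> B mB BO; exists [:: (fine (mu B), x)] => h e M mh hM hU.
    have BK : B `<=` K by move=> y /BO[].
    rewrite big_seq1 /= mulrC -Rintegral_cst//.
    have hi := int _ _ _ mB BK mh hM.
    have ci (c : R) : mu.-integrable B (EFin \o (fun=> c)).
      by apply: (int _ _ `|c|) => //; exact: measurable_cst.
    rewrite -RintegralB//.
    have di : mu.-integrable B (EFin \o (fun y => h y - h x)).
      apply: (int _ _ (M + M)) => //; first exact: measurable_funB.
      by move=> y; apply: le_trans (ler_normB _ _) (lerD _ _).
    apply: le_trans (le_normr_Rintegral _ _) _ => //.
    rewrite -Rintegral_cst//; apply: le_Rintegral => //.
      exact: (integrable_norm di).
    by move=> y /BO[Oy Ky]; apply: hU => //; exact: interior_subset Oy.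
move=> [W [oO KO /(_ K mK)]] [|s hs]; first by move=> x; split => //; exact: KO.
exists s => h e M mh hM h0 hU.
have -> : \int[mu]_x h x = \int[mu]_(x in K) h x.
  rewrite [RHS]Rintegral_mkcond; congr Rintegral; apply/funext => x.
  rewrite patchE; case: ifPn => // /negP xK.
  by rewrite h0// => Kx; apply: xK; rewrite inE.
exact: hs mh hM hU.
Qed.

Lemma riemann_csum (U : T -> set T) : (forall x, K x -> nbhs x (U x)) ->
  exists s : seq (R * T), forall (h : T -> R[i]) (e M : R),
    cmeasurable (h : borel x0 -> R[i]) ->
    (forall x, normc (h x) <= M) -> (forall x, ~ K x -> h x = 0) ->
    (forall x y, K x -> K y -> U x y -> normc (h y - h x) <= e) ->
    normc (cintegral mu h - \sum_(p <- s) p.1%:C * h p.2) <= 2 * (e * fine (mu K)).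
Proof.
move=> /riemann_sum[s hs]; exists s => h e M [mr mi] hM h0 hU.
apply: le_trans (normc_le_ReIm _) _; rewrite mulr_natl mulr2n; apply: lerD.
- have -> : complex.Re (cintegral mu h - \sum_(p <- s) p.1%:C * h p.2) =
    \int[mu]_x complex.Re (h x) - \sum_(p <- s) p.1 * complex.Re (h p.2).
    rewrite raddfB/= raddf_sum; congr (_ - _); apply: eq_bigr => p _.
    by rewrite [LHS](ReM p.1%:C) /= mul0r subr0.
  apply: (hs _ _ M) => //.
  + by move=> x; exact: le_trans (Re_le_normc _) _.
  + by move=> x /h0 ->.
  + move=> x y Kx Ky /hU-/(_ Kx Ky); apply: le_trans.
    by apply: le_trans (Re_le_normc _); rewrite raddfB.
- have -> : complex.Im (cintegral mu h - \sum_(p <- s) p.1%:C * h p.2) =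
    \int[mu]_x complex.Im (h x) - \sum_(p <- s) p.1 * complex.Im (h p.2).
    rewrite raddfB/= raddf_sum; congr (_ - _); apply: eq_bigr => p _.
    by rewrite [LHS](ImM p.1%:C) /= mul0r addr0.
  apply: (hs _ _ M) => //.
  + by move=> x; exact: le_trans (Im_le_normc _) _.
  + by move=> x /h0 ->.
  + move=> x y Kx Ky /hU-/(_ Kx Ky); apply: le_trans.
    by apply: le_trans (Im_le_normc _); rewrite raddfB.
Qed.

Lemma continuous_within_cborel (f : T -> R[i]) :
  (forall x, K x -> forall e : R, 0 < e ->
     \forall y \near x, K y -> normc (f y - f x) <= e) ->
  (forall x, ~ K x -> f x = 0) -> cmeasurable (f : borel x0 -> R[i]).
Proof.
move=> cf f0; split; apply: (continuous_within_borel closedK).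
- move=> x Kx e e0; have := cf x Kx (e / 2) (divr_gt0 e0 (ltr0n _ 2)).
  apply: filterS => y /[apply] h; rewrite -raddfB/=.
  apply: le_lt_trans (Re_le_normc _) (le_lt_trans h _).
  by rewrite ltr_pdivrMr// ltr_pMr// ltr1n.
- by move=> x /f0 ->.
- move=> x Kx e e0; have := cf x Kx (e / 2) (divr_gt0 e0 (ltr0n _ 2)).
  apply: filterS => y /[apply] h; rewrite -raddfB/=.
  apply: le_lt_trans (Im_le_normc _) (le_lt_trans h _).
  by rewrite ltr_pdivrMr// ltr_pMr// ltr1n.
- by move=> x /f0 ->.
Qed.

(* Riemann sums approximate the integral of F(v, .) uniformly, so that a bounded
   linear functional commutes with the integral.  This replaces Fubini's theorem
   for the product sigma-algebra, which is too small when the topology is not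
   second countable. *)
Lemma linear_functional_integral (S : Type) (F : T -> S -> R[i])
    (V : set (S -> R[i])) (l : (S -> R[i]) -> R[i]) (M N : R) :
  (forall v s, normc (F v s) <= M) ->
  (forall v, ~ K v -> F v = fun=> 0) ->
  (forall v0, K v0 -> forall e : R, 0 < e ->
     \forall v \near v0, K v -> forall s, normc (F v s - F v0 s) <= e) ->
  (forall (a b : R[i]) f g, V f -> V g -> V (fun s => a * f s + b * g s)) ->
  (forall (a b : R[i]) f g, V f -> V g ->
     l (fun s => a * f s + b * g s) = a * l f + b * l g) ->
  0 <= N ->
  (forall f e, V f -> (forall s, normc (f s) <= e) -> normc (l f) <= N * e) ->
  (forall v, V (F v)) ->
  V (fun s => cintegral mu (F^~ s)) ->
  cintegral mu (fun v => l (F v)) = l (fun s => cintegral mu (F^~ s)).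
Proof.
move=> FM F0 Fc Vlin llin N0 lN VF VI.
have V0 : V (fun=> 0).
  by have := Vlin 0 0 _ _ VI VI; congr V; apply/funext => s; rewrite !mul0r addr0.
have l0 : l (fun=> 0) = 0.
  have := llin 0 0 _ _ V0 V0; rewrite !mul0r addr0 => h.
  by rewrite -[RHS]h; congr l; apply/funext => s; rewrite !mul0r addr0.
have lB f g e : V f -> V g -> (forall s, normc (f s - g s) <= e) ->
    normc (l f - l g) <= N * e.
  move=> Vf Vg fg; have := llin 1 (-1) _ _ Vf Vg; rewrite mul1r mulN1r => <-.
  by apply: lN; [exact: Vlin|move=> s; rewrite mul1r mulN1r].
have Fsm s : cmeasurable (F^~ s : borel x0 -> R[i]).
  apply: continuous_within_cborel => [v Kv e e0|v Kv]; last by rewrite F0.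
  by apply: filterS (Fc v Kv e e0) => w h /h.
have Nd (e : R) : 0 < e -> exists2 r : R, 0 < r & N * r <= e.
  move=> e0; exists (e / (N + 1)); first by rewrite divr_gt0// ltr_wpDl.
  rewrite mulrA ler_pdivrMr ?ltr_wpDl// mulrC ler_wpM2l ?(ltW e0)//.
  by rewrite lerDl.
have lFm : cmeasurable ((fun v : T => l (F v)) : borel x0 -> R[i]).
  apply: continuous_within_cborel => [v Kv e e0|v Kv]; last by rewrite F0.
  have [r r0 Nr] := Nd e e0.
  apply: filterS (Fc v Kv r r0) => w /[apply] h.
  exact: le_trans (lB _ _ _ (VF _) (VF _) h) Nr.
apply/eqP; rewrite -subr_eq0; apply/eqP; apply: normc0_le => e e0.
pose m := fine (mu K); have m0 : 0 <= m by rewrite fine_ge0.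
(* The two errors are [2 N r m], from the Riemann sum of [l (F v)], and [N (2 r m)], from [l]
   applied to the error of the sum; together [4 N m r]. *)
have [r r0 Nr] : exists2 r : R, 0 < r & 2 * (N * r * m) + N * (2 * (r * m)) <= e.
  have q0 : 0 < 4 * N * m + 1 by rewrite ltr_wpDl// !mulr_ge0.
  exists (e / (4 * N * m + 1)); first by rewrite divr_gt0.
  have -> : 2 * (N * (e / (4 * N * m + 1)) * m) + N * (2 * (e / (4 * N * m + 1) * m))
    = (e * (4 * N * m)) / (4 * N * m + 1) by ring.
  by rewrite ler_pdivrMr// ler_wpM2l ?(ltW e0)// lerDl.
have [s hs] := @riemann_csum
  (fun v0 => [set v | K v -> forall s, normc (F v s - F v0 s) <= r])
  (fun v Kv => Fc v Kv r r0).
(* On the Riemann sum itself [l] acts term by term, so the exchange is exact there. *)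
have [VS lS] : V (fun t => \sum_(p <- s) p.1%:C * F p.2 t) /\
    l (fun t => \sum_(p <- s) p.1%:C * F p.2 t) = \sum_(p <- s) p.1%:C * l (F p.2).
  elim: (s) => [|p s' [Vs ls]].
    rewrite big_nil -[X in _ /\ l _ = X]l0; split.
      by move: V0; congr V; apply/funext => t; rewrite big_nil.
    by congr l; apply/funext => t; rewrite big_nil.
  rewrite big_cons -ls.
  have -> : (fun t => \sum_(p0 <- p :: s') p0.1%:C * F p0.2 t) =
      (fun t => p.1%:C * F p.2 t + 1 * (\sum_(p0 <- s') p0.1%:C * F p0.2 t)).
    by apply/funext => t; rewrite big_cons mul1r.
  by split; [exact: Vlin|rewrite llin// mul1r].
have h1 : normc (cintegral mu (fun v => l (F v)) - \sum_(p <- s) p.1%:C * l (F p.2))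
    <= 2 * (N * r * m).
  apply: (hs _ _ (N * M)) => //.
  - by move=> v; exact: lN.
  - by move=> v /F0 ->.
  - by move=> v w Kv Kw /(_ Kw) h; exact: lB.
have h2 t : normc (cintegral mu (F^~ t) - \sum_(p <- s) p.1%:C * F p.2 t)
    <= 2 * (r * m).
  apply: (hs _ _ M) => //.
  - exact: Fsm.
  - by move=> v /F0 ->.
  - by move=> v w Kv Kw /(_ Kw).
rewrite -(subrKA (\sum_(p <- s) p.1%:C * l (F p.2))).
apply: le_trans (normcD _ _) (le_trans (lerD h1 _) Nr).
by rewrite normc_distC -lS; apply: lB.
Qed.

End RiemannSums.

(** * Equicontinuous families and compactly supported functions *)

Section Equicontinuity.
Context {R : realType} {T : topologicalType} {S : Type}.
Implicit Types (K : set T) (F : T -> S -> R[i]).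

(** Equicontinuity in [v], uniformly in [s]: [S] carries no topology here, so that it can be the
    group, the space of [X], or a mere index set. *)
Definition equicontinuous_on K F : Prop :=
  forall v0, K v0 -> forall e : R, 0 < e ->
    \forall v \near v0, K v -> forall s, normc (F v s - F v0 s) <= e.

Lemma equicontinuous_onM K F1 F2 (M1 M2 : R) :
  (forall v s, K v -> normc (F1 v s) <= M1) ->
  (forall v s, K v -> normc (F2 v s) <= M2) ->
  equicontinuous_on K F1 -> equicontinuous_on K F2 ->
  equicontinuous_on K (fun v s => F1 v s * F2 v s).
Proof.
move=> b1 b2 c1 c2 v0 Kv0 e e0.
pose r := e / (`|M1| + `|M2| + 1).
have q0 : 0 < `|M1| + `|M2| + 1 by rewrite ltr_wpDl// addr_ge0.
have r0 : 0 < r by rewrite divr_gt0.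
apply: filterS2 (c1 v0 Kv0 r r0) (c2 v0 Kv0 r r0) => v h1 h2 Kv s.
have -> : F1 v s * F2 v s - F1 v0 s * F2 v0 s =
  F1 v s * (F2 v s - F2 v0 s) + (F1 v s - F1 v0 s) * F2 v0 s by ring.
apply: le_trans (normcD _ _) _; rewrite !normcM.
apply: (@le_trans _ _ (`|M1| * r + r * `|M2|)).
  apply: lerD; apply: ler_pM; rewrite ?normc_ge0//; try exact: h1; try exact: h2.
  - exact: le_trans (b1 _ _ Kv) (ler_norm _).
  - exact: le_trans (b2 _ _ Kv0) (ler_norm _).
rewrite mulrC -mulrDr /r mulrAC ler_pdivrMr// ler_wpM2l ?(ltW e0)//.
by rewrite lerDl.
Qed.

Lemma equicontinuous_onJ K F : equicontinuous_on K F ->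
  equicontinuous_on K (fun v s => conjc (F v s)).
Proof.
move=> c v0 Kv0 e e0; apply: filterS (c v0 Kv0 e e0) => v h Kv s.
by rewrite -rmorphB normcJ; exact: h.
Qed.

Lemma equicontinuous_on_cst K (f : S -> R[i]) : equicontinuous_on K (fun=> f).
Proof.
move=> v0 Kv0 e e0; apply: nearW => v _ s.
by rewrite subrr Normc.normc0 ltW.
Qed.

End Equicontinuity.

Section CompactSupport.
Context {R : realType} {G : topologicalZmodType}.
Hypothesis G_hausdorff : hausdorff_space G.
Notation C := (R[i]^o).
Implicit Types (f : Cc R G) (K L : set G).

Lemma supp_subI K (f : G -> C) : compact K ->
  (forall x, ~ K x -> f x = 0) -> supp f `<=` K.
Proof.
move=> cK f0; have /closure_id -> := compact_closed G_hausdorff cK.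
apply: closureS => x /= fx; apply: contrapT => /f0 f0'.
by move: fx; rewrite f0' eqxx.
Qed.

Lemma cc_predI K (f : G -> C) : compact K -> continuous f ->
  (forall x, ~ K x -> f x = 0) -> f \in @cc_pred R G.
Proof.
move=> cK cf f0; apply/cc_predP; split => //.
exact: compact_supp_sub cK (supp_subI cK f0).
Qed.

Lemma supp0 f x : ~ supp f x -> f x = 0.
Proof.
by move=> nx; apply/eqP; apply: contrapT => /negP fx; apply: nx; exact: subset_closure.
Qed.

Lemma compact_supp f : compact (supp f).
Proof. by have [] := CcP f. Qed.

Lemma Cc_continuous f : continuous f.
Proof. by have [] := CcP f. Qed.

Lemma Cc_bounded f : exists M : R, forall x, normc (f x) <= M.
Proof.
have [M hM] : exists M : R, forall x, supp f x -> normc (f x) <= M.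
  apply: (@compact_ind _ (supp f)
    (fun A => exists M : R, forall x, A x -> normc (f x) <= M)).
  - exact: compact_supp.
  - by move=> A B AB [M hM]; exists M => x /AB /hM.
  - by exists 0.
  - move=> A B [M hM] [N hN]; exists (Num.max M N) => x.
    by rewrite le_max => -[/hM ->|/hN ->]; rewrite ?orbT.
  - move=> x _; have /continuous_normcP/(_ 1 ltr01) h := @Cc_continuous f x.
    eexists; first exact: h.
    exists (1 + normc (f x)) => y /= yx; rewrite -[f y](subrK (f x)).
    by apply: le_trans (normcD _ _) (lerD _ _); rewrite // ltW.
exists `|M| => x; have [/hM h|/supp0 ->] := pselect (supp f x).
  exact: le_trans h (ler_norm _).
by rewrite Normc.normc0.
Qed.

(** Compactness handles the [x] in the support. If only [x + w] lies in the support, the same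
    estimate at [x + w] with increment [- w] applies; if neither does, both values are 0. *)
Lemma Cc_uniformly_continuous f (e : R) : 0 < e ->
  \forall w \near (0 : G), forall x, normc (f (x + w) - f x) <= e.
Proof.
move=> e0.
have h : \forall w \near (0 : G), forall x, supp f x -> normc (f (x + w) - f x) <= e.
  apply: (@compact_ind _ (supp f) (fun A => \forall w \near (0 : G),
    forall x, A x -> normc (f (x + w) - f x) <= e)).
  - exact: compact_supp.
  - by move=> A B AB; apply: filterS => w h x /AB; exact: h.
  - exact: nearW.
  - by move=> A B; apply: filterS2 => w hA hB x [/hA|/hB].
  - move=> x _; have e20 : 0 < e / 2 by rewrite divr_gt0.
    have /continuous_normcP/(_ _ e20) h := @Cc_continuous f x.
    (* Continuity of addition at [(x, 0)] yields [U] and [V] such that both [y + w] and [y = y + 0]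
       stay close to [x] for [f]. *)
    have : (x, 0 : G).1 + (x, 0 : G).2 = x by rewrite /= addr0.
    move: h => /[swap] xE; rewrite -{1}xE.
    move=> /(@add_continuous G (x, 0)) [[U V] /= [Ux V0] UV].
    have V00 : V 0 := nbhs_singleton V0.
    exists U => //; apply: filterS V0 => w Vw y Uy.
    have h1 : normc (f (y + w) - f x) < e / 2 by apply: (UV (y, w)).
    have h2 : normc (f y - f x) < e / 2.
      by have := UV (y, 0) (conj Uy V00); rewrite /= addr0.
    rewrite -(subrKA (f x)); apply: le_trans (normcD _ _) _.
    by rewrite (splitr e) lerD// ?ltW// normc_distC.
have h' : \forall w \near (0 : G), forall x, supp f x -> normc (f (x - w) - f x) <= e.
  have h0 : nbhs (- 0 : G)
      [set w | forall x, supp f x -> normc (f (x + w) - f x) <= e].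
    by rewrite oppr0.
  exact: (@opp_continuous G 0 _ h0).
apply: filterS2 h h' => w h h' x.
have [/h//|nx] := pselect (supp f x).
have [/h'|nxw] := pselect (supp f (x + w)); first by rewrite addrK normc_distC.
by rewrite !supp0// subrr Normc.normc0 ltW.
Qed.

Lemma near_shift (P : G -> Prop) (v0 : G) :
  (\forall w \near (0 : G), P w) -> \forall v \near v0, P (v - v0).
Proof.
move=> h; have h0 : nbhs (- v0 + v0 : G) [set w | P w] by rewrite addNr.
have h1 : nbhs v0 [set v | P (- v0 + v)] := @shift_continuous G (- v0) v0 _ h0.
by apply: filterS h1 => v /=; rewrite addrC.
Qed.

(** Uniform continuity does not see the base point, so [h] may be arbitrary; it is used with the
    identity, the inversion and constants. *)
Lemma equicontinuous_on_Cc K f (S : Type) (h : S -> G) :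
  equicontinuous_on K (fun v s => f (v + h s) : R[i]).
Proof.
move=> v0 _ e /(Cc_uniformly_continuous f)/(near_shift v0); apply: filterS => v hv _ s.
suff -> : v + h s = v0 + h s + (v - v0) by exact: hv.
by rewrite addrAC (addrC v0) subrK.
Qed.

Lemma cc_mul_subproof f (g : G -> C) : continuous g ->
  (fun x => g x * f x) \in @cc_pred R G.
Proof.
move=> cg; apply: (@cc_predI (supp f)); first exact: compact_supp.
  by move=> x; apply: cvgM; [exact: cg|exact: Cc_continuous].
by move=> x /supp0 ->; rewrite mulr0.
Qed.

Definition Cc_mul (g : G -> C) (cg : continuous g) f : Cc R G :=
  MkCc (cc_mul_subproof f cg).

Lemma compact_sub K L : compact K -> compact L ->
  compact [set x - y | x in K & y in L].
Proof.
move=> cK cL.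
have -> : [set x - y | x in K & y in L] = (fun p : G * G => p.1 - p.2) @` (K `*` L).
  apply/seteqP; split => [_ [x Kx [y Ly <-]]|_ [[x y] [Kx Ly] <-]].
    by exists (x, y).
  by exists x => //; exists y.
apply: continuous_compact; last exact: compact_setX.
apply: continuous_subspaceT => p.
apply: (@continuous_comp _ _ _ (fun p : G * G => (p.1, - p.2))
  (fun x : G * G => x.1 + x.2)); last exact: add_continuous.
apply: cvg_pair; first exact: cvg_fst.
by apply: continuous_comp; [exact: cvg_snd|exact: opp_continuous].
Qed.

Lemma opp_shift_continuous (t : G) : continuous (fun x : G => t - x).
Proof.
move=> x; apply: (@continuous_comp _ _ _ -%R (fun y => t + y)).
  exact: opp_continuous.
exact: shift_continuous.
Qed.

End CompactSupport.

(** * Integrals depending on a parameter *)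

Section ParametricIntegral.
Context {R : realType} {T : topologicalType} {x0 : T}.
Variable mu : {measure set (borel x0) -> \bar R}.
Variables (K : set T) (compactK : compact K) (closedK : closed K).
Hypothesis muK : (mu K < +oo)%E.

Section General.
Variables (S : Type) (F : T -> S -> R[i]) (M : R).
Hypothesis F_le : forall v s, normc (F v s) <= M.
Hypothesis F_out : forall v, ~ K v -> F v = fun=> 0.
Hypothesis F_equi : equicontinuous_on K F.

Lemma equicontinuous_on_cmeasurable s : cmeasurable (F^~ s : borel x0 -> R[i]).
Proof.
apply: (continuous_within_cborel closedK) => [v Kv e e0|v /F_out -> //].
by apply: filterS (F_equi Kv e0) => w h /h.
Qed.

Lemma equicontinuous_on_cintegrable s : cintegrable mu (F^~ s).
Proof.
apply: (@cintegrable_supported _ _ _ mu K (closed_borel x0 closedK) muK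
  (F^~ s : borel x0 -> R[i]) M) => //.
  exact: equicontinuous_on_cmeasurable.
by move=> v /F_out ->.
Qed.

Lemma parametric_integral_le s :
  normc (cintegral mu (F^~ s)) <= 2 * (`|M| * fine (mu K)).
Proof.
apply: (@cintegral_supported_le _ _ _ mu K (closed_borel x0 closedK) muK
  (F^~ s : borel x0 -> R[i])) => //.
- exact: equicontinuous_on_cmeasurable.
- by apply: aeW => v; exact: le_trans (F_le v s) (ler_norm _).
- by move=> v /F_out ->.
Qed.

End General.

(** The integral is a uniform limit of Riemann sums with nodes independent of [s], and each such sum
    is a finite combination of the continuous functions [F v]. *)
Lemma parametric_integral_continuous (S : topologicalType)
    (F : T -> S -> R[i]) (M : R) :
  (forall v s, normc (F v s) <= M) ->
  (forall v, ~ K v -> F v = fun=> 0) ->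
  equicontinuous_on K F ->
  (forall v, continuous (F v : S -> R[i]^o)) ->
  continuous ((fun s => cintegral mu (F^~ s)) : S -> R[i]^o).
Proof.
move=> FM F0 Fe Fc s0; apply/continuous_normcP => e e0.
pose m := fine (mu K); have m0 : 0 <= m by rewrite fine_ge0.
have [r r0 re] : exists2 r : R, 0 < r & 2 * (r * m) <= e / 4.
  have q0 : 0 < 8 * m + 1 by rewrite ltr_wpDl// mulr_ge0.
  exists (e / (8 * m + 1)); first by rewrite divr_gt0.
  rewrite ler_pdivlMr//.
  have -> : 2 * (e / (8 * m + 1) * m) * 4 = (e * (8 * m)) / (8 * m + 1) by ring.
  by rewrite ler_pdivrMr// ler_wpM2l ?(ltW e0)// lerDl.
have [t ht] := @riemann_csum R T x0 mu K compactK closedK muK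
  (fun v0 => [set v | K v -> forall s, normc (F v s - F v0 s) <= r])
  (fun v Kv => Fe v Kv r r0).
pose g s := \sum_(p <- t) p.1%:C * F p.2 s.
have cg : continuous (g : S -> R[i]^o).
  rewrite /g; elim: (t) => [|p t' IH].
    rewrite (_ : (fun s => _) = fun=> 0); first exact: cst_continuous.
    by apply/funext => s; rewrite big_nil.
  rewrite (_ : (fun s => _) = fun s => p.1%:C * F p.2 s +
      \sum_(p <- t') p.1%:C * F p.2 s).
    move=> s; apply: (@cvgD _ R[i]^o); last exact: IH.
    by apply: cvgM; [exact: cvg_cst|exact: Fc].
  by apply/funext => s; rewrite big_cons.
have hg s : normc (cintegral mu (F^~ s) - g s) <= e / 4.
  apply: le_trans re; apply: (ht _ _ M) => //.
  - exact: equicontinuous_on_cmeasurable F0 Fe s.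
  - by move=> v /F0 ->.
  - by move=> v w Kv Kw /(_ Kw).
have e40 : 0 < e / 4 by rewrite divr_gt0.
have /continuous_normcP/(_ _ e40) := cg s0; apply: filterS => s hs.
have -> : cintegral mu (F^~ s) - cintegral mu (F^~ s0) =
    (cintegral mu (F^~ s) - g s) + ((g s - g s0) + (g s0 - cintegral mu (F^~ s0))).
  by ring.
apply: le_lt_trans (normcD _ _) _.
apply: (@le_lt_trans _ _ (e / 4 + (e / 4 + e / 4))).
  apply: lerD => //; apply: le_trans (normcD _ _) (lerD (ltW hs) _).
  by rewrite normc_distC.
by lra.
Qed.

End ParametricIntegral.

Section InvariantIntegral.
Context {R : realType} {d : measure_display} {T : measurableType d}.
Variables (mu : {measure set T -> \bar R}) (h : T -> T).
Hypothesis mh : measurable_fun setT h.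
Hypothesis hP : forall A, measurable A -> mu (h @^-1` A) = mu A.

Lemma Rintegral_invariant (f : T -> R) : measurable_fun setT f ->
  mu.-integrable setT (EFin \o (f \o h)) ->
  \int[mu]_x f (h x) = \int[mu]_x f x.
Proof.
move=> mf fi; rewrite /Rintegral; congr fine.
transitivity (\int[pushforward mu h]_x (f x)%:E)%E; last first.
  by apply: eq_measure_integral => A mA _; rewrite /= /pushforward -(hP mA).
rewrite (integral_pushforward mh) ?preimage_setT//.
exact/measurable_EFinP.
Qed.

Lemma cintegral_invariant (f : T -> R[i]) : cmeasurable f ->
  cintegrable mu (f \o h) -> cintegral mu (fun x => f (h x)) = cintegral mu f.
Proof.
move=> [mr mi] [ir ii]; rewrite /cintegral; congr (_ +i* _).
- exact: (@Rintegral_invariant (fun x => complex.Re (f x))).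
- exact: (@Rintegral_invariant (fun x => complex.Im (f x))).
Qed.

End InvariantIntegral.

(** * Functionals on continuous compactly supported functions *)

Section Functionals.
Context {R : realType} {G : topologicalZmodType}.
Hypothesis G_hausdorff : hausdorff_space G.
Notation C := (R[i]^o).
Implicit Types (f g : G -> R[i]) (L : set G).

(** Plain functions are used instead of elements of [Cc], because the integrands of [cm_int] and of
    the Haar integral are not given as such elements; the common [L] provides one norm bound for a
    whole family. *)
Definition continuous_on_supp L : set (G -> R[i]) :=
  [set f | continuous (f : G -> C) /\ forall x, ~ L x -> f x = 0].

Lemma continuous_on_supp_lin L (a b : R[i]) f g :
  continuous_on_supp L f -> continuous_on_supp L g ->
  continuous_on_supp L (fun x => a * f x + b * g x).
Proof.
move=> [cf f0] [cg g0]; split => [x|x Lx]; last first.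
  by rewrite f0// g0// !mulr0 addr0.
exact: (@continuous_clin R G a b f g cf cg).
Qed.

Lemma continuous_on_supp_cc L f : compact L -> continuous_on_supp L f ->
  (f : G -> C) \in @cc_pred R G.
Proof. by move=> cL [cf f0]; exact: (cc_predI G_hausdorff cL). Qed.

Lemma Cc_continuous_on_supp (f : Cc R G) : continuous_on_supp (supp f) f.
Proof. by split; [exact: Cc_continuous|move=> x /supp0]. Qed.

(** The common features of the Haar integral and of the points of [X] on functions supported in [L],
    which let one exchange lemma serve both. *)
Definition bounded_functional L (l : (G -> R[i]) -> R[i]) (N : R) : Prop :=
  [/\ 0 <= N,
    forall (a b : R[i]) f g, continuous_on_supp L f -> continuous_on_supp L g ->
      l (fun x => a * f x + b * g x) = a * l f + b * l g &
    forall f e, continuous_on_supp L f -> (forall x, normc (f x) <= e) ->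
      normc (l f) <= N * e].

Lemma bounded_functional0 L l N : bounded_functional L l N -> l (fun=> 0) = 0.
Proof.
move=> [_ ll _]; have c0 : continuous_on_supp L (fun=> 0).
  by split => //; exact: (@cst_continuous _ C).
have := ll 0 0 _ _ c0 c0; rewrite !mul0r addr0 => h.
by rewrite -[RHS]h; congr l; apply/funext => s; rewrite !mul0r addr0.
Qed.

Lemma bounded_functionalZ L l N (a : R[i]) f : bounded_functional L l N ->
  continuous_on_supp L f -> l (fun x => a * f x) = a * l f.
Proof.
move=> [_ ll _] cf; have := ll a 0 _ _ cf cf; rewrite mul0r addr0 => <-.
by congr l; apply/funext => s; rewrite mul0r addr0.
Qed.

(** The class required by [linear_functional_integral] is [continuous_on_supp L]; it contains the
    integrated function because parametric integrals are continuous and vanish wherever all [F v]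
    do. *)
Lemma bounded_functional_integral (T : topologicalType) (x0 : T)
    (mu : {measure set (borel x0) -> \bar R}) (K : set T)
    (F : T -> G -> R[i]) (M : R) L l N :
  compact K -> closed K -> (mu K < +oo)%E ->
  (forall v x, normc (F v x) <= M) ->
  (forall v, ~ K v -> F v = fun=> 0) ->
  equicontinuous_on K F ->
  (forall v, continuous_on_supp L (F v)) ->
  bounded_functional L l N ->
  cintegral mu (fun v => l (F v)) = l (fun x => cintegral mu (F^~ x)).
Proof.
move=> cK clK muK FM F0 Fe FL [N0 ll lN].
apply: (@linear_functional_integral R T x0 mu K cK clK muK G F
  (continuous_on_supp L) l M N) => //; first exact: continuous_on_supp_lin.
split.
  apply: (parametric_integral_continuous cK clK muK FM F0 Fe) => v.
  by have [] := FL v.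
move=> x Lx; rewrite -[RHS](cintegral0 mu); congr cintegral.
by apply/funext => v; have [_ ->] := FL v.
Qed.

Section Radon.
Variable mu : {measure set borelG G -> \bar R}.
Hypothesis mu_compact : forall K : set G, compact K -> (mu K < +oo)%E.

Lemma compact_borel (K : set G) : compact K -> measurable (K : set (borelG G)).
Proof. by move=> cK; apply: closed_borel; exact: compact_closed. Qed.

Lemma continuous_on_supp_cintegrable L f : compact L ->
  continuous_on_supp L f -> cintegrable mu f.
Proof.
move=> cL fL; have fcc := continuous_on_supp_cc cL fL; case: fL => cf f0.
have [M hM] := Cc_bounded (MkCc fcc).
apply: (@cintegrable_supported _ _ _ mu L (compact_borel cL) _ f M) => //.
- exact: mu_compact.
- exact: continuous_cborel.
Qed.

Lemma integral_bounded_functional L : compact L ->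
  bounded_functional L (cintegral mu) (2 * fine (mu L)).
Proof.
move=> cL; split.
- by rewrite mulr_ge0// fine_ge0.
- by move=> a b f g fL gL; apply: cintegral_lin; exact: continuous_on_supp_cintegrable cL _.
- move=> f e [cf f0] fe; rewrite mulrAC -mulrA.
  apply: (cintegral_supported_le (compact_borel cL)) => //.
  + exact: mu_compact.
  + exact: le_trans (normc_ge0 _) (fe 0).
  + exact: continuous_cborel.
  + exact: aeW.
Qed.

End Radon.

Section TmdsBound.
Variable X : tmds R G.

Lemma cm_intE (w : cmeas R G) (f : Cc R G) : cm_int w f = w f.
Proof. by rewrite /cm_int valKd. Qed.

(* [L] is covered by finitely many translates of the open set [V] of
   [tmds_closed], and the total variation of each [w] charges a translate by at
   most [c]. *)
Lemma tmds_bounded_functional L : compact L -> exists N : R,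
  forall w : tmds_space X, bounded_functional L (cm_int (val w)) N.
Proof.
move=> cL; have [c [V [c0 [v0 Vv0] oV cV [F _ XE]]]] := tmds_closed X.
have [n [B [mB LB nB]]] : exists n : nat, exists B : set (borelG G),
    [/\ measurable B, L `<=` B &
     forall nu : {measure set (borelG G) -> \bar R},
       (forall t : G, (nu ((fun x => (t + x)%R) @` V) <= c%:E)%E) ->
       (nu B <= (n%:R * c)%:E)%E].
  apply: (@compact_ind _ L (fun A => exists n : nat, exists B : set (borelG G),
    [/\ measurable B, A `<=` B &
     forall nu : {measure set (borelG G) -> \bar R},
       (forall t : G, (nu ((fun x => (t + x)%R) @` V) <= c%:E)%E) ->
       (nu B <= (n%:R * c)%:E)%E])) => //.
  - by move=> A B AB [n [D [mD BD h]]]; exists n, D; split => //; exact: subset_trans BD.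
  - by exists 0%N, set0; split => // nu _; rewrite measure0 mul0r.
  - move=> A1 A2 [n1 [B1 [mB1 AB1 h1]]] [n2 [B2 [mB2 AB2 h2]]].
    exists (n1 + n2)%N, (B1 `|` B2); split; [exact: measurableU|exact: setUSS|].
    move=> nu hnu; apply: le_trans (measureU2 _ _ _) _ => //.
    by rewrite natrD mulrDl EFinD leeD// ?h1 ?h2.
  (* As [v0] lies in [V], the translate of [V] by [x - v0] is a neighbourhood of [x]. *)
  - move=> x _; have oU : open [set y | V (- (x - v0) + y)].
      apply: (@open_comp _ _ (fun y => - (x - v0) + y)) => // y _.
      exact: shift_continuous.
    exists [set y | V (- (x - v0) + y)].
      by apply: open_nbhs_nbhs; split => //=; rewrite opprB subrK.
    exists 1%N, [set y | V (- (x - v0) + y)]; split => //; first exact: open_borel.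
    move=> nu /(_ (x - v0)); rewrite mul1r; congr (nu _ <= _)%E.
    apply/seteqP; split => [_ [y Vy <-]|y /= Vy]; first by rewrite /= addKr.
    by exists (- (x - v0) + y) => //; rewrite addNKr.
exists (2 * (n%:R * c)) => w.
have cmE f (fL : continuous_on_supp L f) :
    cm_int (val w) f = val w (MkCc (continuous_on_supp_cc cL fL)).
  by rewrite -cm_intE.
split.
- by rewrite !mulr_ge0// ltW.
- move=> a b f g fL gL; rewrite (cmE _ (continuous_on_supp_lin a b fL gL)).
  rewrite (cmE _ fL) (cmE _ gL).
  set u := MkCc _; set f' := MkCc _; set g' := MkCc _.
  have -> : u = a *: f' + b *: g' by exact/val_inj/funext.
  by rewrite linearP linearZ.
- move=> f e fL fe.
  have e0 : 0 <= e by exact: le_trans (normc_ge0 _) (fe 0).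
  have wX : tmds_set X (val w) by exact/set_mem/(valP w).
  have : (tbounded c V `&` F) (val w) by rewrite -XE.
  move=> -[[nu [[nuK _] [u [mu u1 hw]]] hnu] _].
  rewrite (cmE _ fL) hw /=.
  have nuL : (nu L <= (n%:R * c)%:E)%E.
    apply: le_trans (nB nu hnu).
    by apply: le_measure; rewrite ?inE//; exact: compact_borel.
  have fnuL : fine (nu L) <= n%:R * c.
    by rewrite -lee_fin fineK// ge0_fin_numE//; exact: nuK.
  apply: (@le_trans _ _ (2 * (e * fine (nu L)))); last first.
    by rewrite -mulrA ler_wpM2l// mulrC ler_wpM2r.
  have [cf f0] := fL.
  apply: (cintegral_supported_le (compact_borel cL)) => //.
  + exact: nuK.
  + by apply: cmeasurableM => //; exact: (continuous_cborel (x0 := 0 : G) cf).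
  + apply: filterS u1 => x; rewrite normr_normc => /eqP.
    by rewrite eq_complex /= => /andP[/eqP ux _]; rewrite normcM ux mulr1.
  + by move=> x Lx; rewrite f0// mul0r.
Qed.

End TmdsBound.

End Functionals.

Lemma continuous_borel_map (T U : topologicalType) (x0 : T) (y0 : U) (f : T -> U) :
  continuous f -> measurable_fun setT (f : borel x0 -> borel y0).
Proof.
move=> cf; apply: (@measurability _ _ (borel x0) (borel y0) setT f (@open (based y0)) erefl).
move=> _ [A oA <-]; rewrite setTI; apply: open_borel.
by move/continuousP: cf; exact.
Qed.

(** * Haar integrals: translation, inversion, convolution *)

Section Haar.
Context {R : realType} {G : topologicalZmodType}.
Hypothesis G_hausdorff : hausdorff_space G.
Variable haar : {measure set borelG G -> \bar R}.
Hypothesis haarP : is_haar haar.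
Notation C := (R[i]^o).
Implicit Types (f : G -> R[i]) (L : set G).

Lemma haar_compact K : compact K -> (haar K < +oo)%E.
Proof. by have [[h _] _ _] := haarP; exact: h. Qed.

Lemma continuous_on_supp_shift L f t : continuous_on_supp L f ->
  continuous_on_supp [set x - y | x in L & y in [set t]] (fun x => f (t + x)).
Proof.
move=> [cf f0]; split => [x|x Lx].
  by apply: (@continuous_comp _ _ _ (fun x => t + x) (f : G -> C));
    [exact: shift_continuous|exact: cf].
apply: f0 => Ltx; apply: Lx; exists (t + x) => //; exists t => //.
by rewrite addrC addKr.
Qed.

Lemma continuous_on_supp_opp L f t : continuous_on_supp L f ->
  continuous_on_supp [set x - y | x in [set t] & y in L] (fun x => f (t - x)).
Proof.
move=> [cf f0]; split => [x|x Lx].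
  by apply: (@continuous_comp _ _ _ (fun x => t - x) (f : G -> C));
    [exact: opp_shift_continuous|exact: cf].
apply: f0 => Ltx; apply: Lx; exists t => //; exists (t - x) => //.
by rewrite opprB addrC subrK.
Qed.

Lemma haar_integral_shift L f t : compact L -> continuous_on_supp L f ->
  cintegral haar (fun x => f (t + x)) = cintegral haar f.
Proof.
move=> cL fL.
apply: (@cintegral_invariant _ _ _ haar (fun x => t + x)).
- by apply: continuous_borel_map; exact: shift_continuous.
(* [is_haar] speaks of images, and the preimage under translation by [t] is the image under
   translation by [- t]. *)
- move=> A mA; have [_ _ hi] := haarP; rewrite -(hi (- t) _ mA); congr (haar _).
  apply/seteqP; split => [x /= Ax|_ [y Ay <-]]; last by rewrite /= addNKr.
  by exists (t + x) => //; rewrite addKr.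
- by apply: continuous_cborel; case: fL.
- apply: (continuous_on_supp_cintegrable G_hausdorff haar_compact _
    (continuous_on_supp_shift t fL)).
  by apply: compact_sub => //; exact: compact_set1.
Qed.

Lemma continuous_comp_add f (h : G -> G) : continuous (f : G -> C) ->
  continuous h -> continuous ((fun x => f (h x)) : G -> C).
Proof. by move=> cf ch x; apply: (@continuous_comp _ _ _ h (f : G -> C)); [exact: ch|exact: cf]. Qed.

Section Inversion.
Variable sigma : Cc R G.
Hypothesis sigma1 : cintegral haar sigma = 1.
Let S := supp sigma.
Let compactS : compact S := @compact_supp R G sigma.
Let SL : continuous_on_supp S sigma := @Cc_continuous_on_supp R G sigma.

Let integral_exchange (F : G -> G -> R[i]) (M : R) :
  (forall v x, normc (F v x) <= M) ->
  (forall v, ~ [set x - y | x in S & y in S] v -> F v = fun=> 0) ->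
  equicontinuous_on [set x - y | x in S & y in S] F ->
  (forall v, continuous_on_supp S (F v)) ->
  cintegral haar (fun v => cintegral haar (F v)) =
  cintegral haar (fun x => cintegral haar (F^~ x)).
Proof.
move=> FM F0 Fe FS.
apply: (bounded_functional_integral (K := [set x - y | x in S & y in S])
  (M := M) (L := S) (N := 2 * fine (haar S))) => //.
- exact: compact_sub.
- by apply: compact_closed => //; exact: compact_sub.
- by apply: haar_compact; exact: compact_sub.
- by apply: integral_bounded_functional => //; exact: haar_compact.
Qed.

(* Both sides of [I(sigma) J(sigma) = I(sigma) I(sigma)], where J is the Haar
   integral composed with inversion, are double integrals that differ by a
   translation. *)
Lemma haar_integral_opp t : cintegral haar (fun v => sigma (t - v)) = 1.
Proof.
have [M hM] := Cc_bounded sigma.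
have M0 : 0 <= M by exact: le_trans (normc_ge0 _) (hM 0).
have cs : continuous (sigma : G -> C) by exact: Cc_continuous.
(* By translation invariance the integral of [sigma (x - v)] does not depend on [x]. *)
have J x : cintegral haar (fun v => sigma (x - v)) = cintegral haar (fun v => sigma (- v)).
  have h := continuous_on_supp_opp 0 SL.
  have e : cintegral haar (fun v => sigma (0 - (- x + v))) =
      cintegral haar (fun v => sigma (0 - v)).
    apply: (haar_integral_shift (- x) _ h).
    by apply: compact_sub => //; exact: compact_set1.
  transitivity (cintegral haar (fun v => sigma (0 - v))); last first.
    by congr cintegral; apply/funext => v; rewrite sub0r.
  by rewrite -e; congr cintegral; apply/funext => v; rewrite sub0r opprD opprK.
have int1 x : cintegrable haar (fun v => sigma (x - v)).
  apply: (continuous_on_supp_cintegrable G_hausdorff haar_compact _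
    (continuous_on_supp_opp x SL)).
  by apply: compact_sub => //; exact: compact_set1.
have int0 : cintegrable haar sigma.
  exact: (continuous_on_supp_cintegrable G_hausdorff haar_compact compactS SL).
have MM (a b : R[i]) : normc a <= M -> normc b <= M -> normc (a * b) <= M * M.
  by move=> ha hb; rewrite normcM; apply: ler_pM; rewrite ?normc_ge0.
have e1 : cintegral haar (fun y => cintegral haar (fun x => sigma (x - y) * sigma x)) =
    cintegral haar (fun v => sigma (- v)).
  rewrite (@integral_exchange _ (M * M)).
  - rewrite -[RHS]mulr1 -sigma1 -cintegralZ//; congr cintegral; apply/funext => x.
    rewrite -(J x) mulrC -cintegralZ//; congr cintegral.
    by apply/funext => v; rewrite mulrC.
  - by move=> v x; exact: MM.
  - move=> v nv; apply/funext => x; have [Sx|/supp0 ->] := pselect (S x); last by rewrite mulr0.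
    have [Sxv|/supp0 ->] := pselect (S (x - v)); last by rewrite mul0r.
    exfalso; apply: nv; exists x => //; exists (x - v) => //.
    by rewrite opprB addrC subrK.
  - apply: (@equicontinuous_onM _ _ _ _ _ _ M M) => //; last exact: equicontinuous_on_cst.
    have := equicontinuous_on_Cc (K := [set x - y | x in S & y in S]) (Cc_refl sigma) -%R.
    by congr equicontinuous_on; apply/funext => v; apply/funext => x /=; rewrite opprD opprK addrC.
  - move=> v; split=> [x|x /supp0 ->]; last by rewrite mulr0.
    apply: cvgM; last exact: cs.
    apply: (@continuous_comp_add sigma (fun x => x - v)) => //.
    by move=> z; under eq_fun do rewrite addrC; exact: shift_continuous.
have e2 : cintegral haar (fun y => cintegral haar (fun x => sigma (y + x) * sigma x)) = 1.
  rewrite (@integral_exchange _ (M * M)).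
  - rewrite -[RHS]sigma1; congr cintegral; apply/funext => x.
    rewrite -[RHS]mulr1 -sigma1 -(haar_integral_shift x compactS SL) -cintegralZ//.
      by congr cintegral; apply/funext => v; rewrite mulrC addrC.
    apply: (continuous_on_supp_cintegrable G_hausdorff haar_compact _
      (continuous_on_supp_shift x SL)).
    by apply: compact_sub => //; exact: compact_set1.
  - by move=> v x; exact: MM.
  - move=> v nv; apply/funext => x; have [Sx|/supp0 ->] := pselect (S x); last by rewrite mulr0.
    have [Sxv|/supp0 ->] := pselect (S (v + x)); last by rewrite mul0r.
    by exfalso; apply: nv; exists (v + x) => //; exists x => //; rewrite addrK.
  - apply: (@equicontinuous_onM _ _ _ _ _ _ M M) => //; last exact: equicontinuous_on_cst.
    exact: (equicontinuous_on_Cc sigma id).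
  - move=> v; split=> [x|x /supp0 ->]; last by rewrite mulr0.
    apply: cvgM; last exact: cs.
    exact: (@continuous_comp_add sigma (fun x => v + x) cs (@shift_continuous G v)).
(* Replacing [x] by [y + x] turns the inner integrand of [e1] into that of [e2]. *)
have e3 y : cintegral haar (fun x => sigma (y + x - y) * sigma (y + x)) =
    cintegral haar (fun x => sigma (x - y) * sigma x).
  pose g x := sigma (x - y) * sigma x.
  have gS : continuous_on_supp S g.
    split=> [x|x]; last by rewrite /g => /supp0 ->; rewrite mulr0.
    apply: cvgM; last exact: cs.
    apply: (@continuous_comp_add sigma (fun x => x - y)) => //.
    by move=> z; under eq_fun do rewrite addrC; exact: shift_continuous.
  exact: (haar_integral_shift y compactS gS).
rewrite J -e1 -e2; congr cintegral; apply/funext => y; rewrite -e3.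
by congr cintegral; apply/funext => x; rewrite (addrC y x) addrK mulrC.
Qed.

End Inversion.

(** Written as the integral of [f s * conjc (f (s - t))], the convolution is a parametric integral
    over [supp f]. Its membership in C_c is what makes [insubd] return the convolution itself and
    not the default 0. *)
Lemma convolution_continuous_on_supp (f : Cc R G) :
  continuous_on_supp [set x - y | x in supp f & y in supp f]
    (convolution haar f (tilde f)).
Proof.
have [M hM] := Cc_bounded f.
have M0 : 0 <= M by exact: le_trans (normc_ge0 _) (hM 0).
have cf : continuous (f : G -> C) by exact: Cc_continuous.
have FE : convolution haar f (tilde f) =
    fun t => cintegral haar (fun s => f s * conjc (f (s - t))).
  by apply/funext => t; congr cintegral; apply/funext => s; rewrite /tilde opprB.
rewrite FE; split.
  apply: (@parametric_integral_continuous _ _ _ haar (supp f) _ _ _ G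
    (fun s t => f s * conjc (f (s - t))) (M * M)).
  - exact: compact_supp.
  - by apply: compact_closed => //; exact: compact_supp.
  - by apply: haar_compact; exact: compact_supp.
  - by move=> v s; rewrite normcM normcJ; apply: ler_pM; rewrite ?normc_ge0.
  - by move=> v /supp0 fv; apply/funext => s; rewrite fv mul0r.
  - apply: (@equicontinuous_onM _ _ _ _ _ _ M M) => //.
    + by move=> v s _; rewrite normcJ.
    + move=> v0 Kv0 e e0.
      have := @equicontinuous_on_Cc _ _ (supp f) f G (fun=> 0) v0 Kv0 e e0.
      by apply: filterS => v h Kv s; have := h Kv s; rewrite !addr0.
    + by apply: equicontinuous_onJ; exact: (equicontinuous_on_Cc f -%R).
  - move=> v t; apply: cvgM; first exact: cvg_cst.
    apply: (@continuous_comp _ _ _ (fun t => f (v - t) : C) (fun z : C => conjc z : C)).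
      apply: (@continuous_comp_add f (fun x => v - x)) => //.
      exact: opp_shift_continuous.
    exact: conjc_continuous.
move=> t nt; rewrite -[RHS](cintegral0 haar); congr cintegral; apply/funext => s.
have [Ss|/supp0 ->] := pselect (supp f s); last by rewrite mul0r.
have [Sst|/supp0 ->] := pselect (supp f (s - t)); last by rewrite conjc0 mulr0.
exfalso; apply: nt; exists s => //; exists (s - t) => //.
by rewrite opprB addrC subrK.
Qed.

End Haar.

(** * Continuity and integration on the space of [X] *)

Section TmdsFunctions.
Context {R : realType} {G : topologicalZmodType}.
Hypothesis G_hausdorff : hausdorff_space G.
Variable X : tmds R G.
Notation C := (R[i]^o).
Implicit Types (f : G -> R[i]) (K L : set G).

Lemma tmds_eval_continuous (phi : Cc R G) :
  continuous (fun w : tmds_space X => val w phi : C).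
Proof.
have c1 : continuous (set_val : tmds_space X -> cmeas R G).
  exact: (@initial_continuous _ (cmeas R G) set_val).
pose ev (mu : cmeas R G) : {ptws Cc R G -> C} := fun h => mu h.
have c2 : continuous ev by exact: (@initial_continuous (cmeas R G) {ptws Cc R G -> C} ev).
have c3 : continuous (fun h : {ptws Cc R G -> C} => h phi).
  exact: (@proj_continuous (Cc R G) (fun=> C) phi).
move=> w; exact: (continuous_comp (continuous_comp (c1 w) (c2 _)) (c3 _)).
Qed.

Lemma cm_int_continuous L f : compact L -> continuous_on_supp L f ->
  continuous (fun w : tmds_space X => cm_int (val w) f : C).
Proof.
move=> cL /(continuous_on_supp_cc G_hausdorff cL) fcc.
have -> : (fun w : tmds_space X => cm_int (val w) f : C) =
    (fun w : tmds_space X => val w (MkCc fcc)).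
  by apply/funext => w; rewrite -cm_intE.
exact: tmds_eval_continuous.
Qed.

(** Both the subspace topology and the vague topology are initial, so only evaluations have to be
    checked; evaluating [tmds_act t w] at [phi] is evaluating [w] at [Cc_shift t phi]. *)
Lemma tmds_act_continuous t : continuous (@tmds_act R G X t).
Proof.
apply: (@continuous_comp_initial (tmds_space X) (tmds_space X) (cmeas R G) set_val).
apply: (@continuous_comp_initial (cmeas R G) (tmds_space X) {ptws Cc R G -> C}
  (fun mu : cmeas R G => (fun h => mu h) : {ptws Cc R G -> C})).
move=> w.
pose g (w : tmds_space X) : {ptws Cc R G -> C} := fun h => val (tmds_act t w) h.
have FF : Filter (g x @[x --> w]).
  by apply: fmap_filter; exact: (@nbhs_filter (tmds_space X) w).
apply: (proj2 (@cvg_sup _ _ _ (g @ w) (g w) FF)) => phi A.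
have /= -> := @nbhsE (initial_topology (fun h : {ptws Cc R G -> C} => h phi)) (g w).
case=> B [[D oD <-] Dw] /filterS; apply.
apply: (@tmds_eval_continuous (Cc_shift t phi) w).
exact: open_nbhs_nbhs.
Qed.

Lemma tmds_act_measurable t :
  measurable_fun setT ((fun w => tmds_act t w) : borelOmega X -> borelOmega X).
Proof.
exact: (@continuous_borel_map (tmds_space X) (tmds_space X) (tmds_point X)
  (tmds_point X) (@tmds_act R G X t) (@tmds_act_continuous t)).
Qed.

(** The norm bound [N] of [tmds_bounded_functional] is common to all points [w], so a uniformly
    small change of [g v] changes all the values [cm_int (val w) (g v)] by a uniformly small
    amount. *)
Lemma equicontinuous_on_cm (T : topologicalType) (K : set T) L (g : T -> G -> R[i]) :
  compact L -> (forall v, K v -> continuous_on_supp L (g v)) ->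
  equicontinuous_on K g ->
  equicontinuous_on K (fun v (w : tmds_space X) => cm_int (val w) (g v)).
Proof.
move=> cL gL ge v0 Kv0 e e0.
have [N hN] := tmds_bounded_functional G_hausdorff X cL.
pose r := e / (`|N| + 1).
have q0 : 0 < `|N| + 1 by rewrite ltr_wpDl.
have r0 : 0 < r by rewrite divr_gt0.
apply: filterS (ge v0 Kv0 r r0) => v h Kv w.
have [N0 ll lN] := hN w.
have := ll 1 (-1) _ _ (gL _ Kv) (gL _ Kv0); rewrite mul1r mulN1r => <-.
apply: le_trans (lN _ r _ _) _.
- by apply: continuous_on_supp_lin; exact: gL.
- by move=> x; rewrite mul1r mulN1r; exact: h.
- rewrite /r mulrA ler_pdivrMr// mulrC ler_wpM2l ?(ltW e0)//.
  by rewrite (le_trans (ler_norm _))// lerDl.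
Qed.

Lemma tmds_cmeasurable (f : tmds_space X -> R[i]) :
  continuous (f : tmds_space X -> C) -> cmeasurable (f : borelOmega X -> R[i]).
Proof. exact: (@continuous_cborel R (tmds_space X) (tmds_point X) f). Qed.

Section Exchange.
Variable m : probability (borelOmega X) R.
Variable haar : {measure set borelG G -> \bar R}.
Hypothesis haarP : is_haar haar.

Let m_lty : (m setT < +oo)%E.
Proof. by apply: le_lt_trans (probability_le1 m measurableT) (ltry 1). Qed.

Lemma bounded_cintegrable (f : borelOmega X -> R[i]) (M : R) : cmeasurable f ->
  (forall w, normc (f w) <= M) -> cintegrable m f.
Proof.
move=> mf fM; apply: (@cintegrable_supported _ _ _ m setT _ _ f M) => //.
by move=> x /(_ I).
Qed.

Lemma cintegral_bounded_le (f : borelOmega X -> R[i]) (M : R) : cmeasurable f ->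
  (forall w, normc (f w) <= M) -> normc (cintegral m f) <= 2 * M.
Proof.
move=> mf fM.
have mT : fine (m setT) = 1 by exact: (congr1 fine (probability_setT m)).
rewrite (_ : 2 * M = 2 * (M * fine (m setT))); last by rewrite mT mulr1.
apply: cintegral_supported_le => //.
- exact: le_trans (normc_ge0 _) (fM (tmds_point X)).
- exact: aeW.
- by move=> x /(_ I).
Qed.

(** Here the bounded functional is the integral against [m], of norm at most 2, on the bounded
    continuous functions on the space of [X]. *)
Lemma tmds_integral_exchange K (F : G -> tmds_space X -> R[i]) (M : R) :
  compact K ->
  (forall v w, normc (F v w) <= M) ->
  (forall v, ~ K v -> F v = fun=> 0) ->
  equicontinuous_on K F ->
  (forall v, continuous (F v : tmds_space X -> C)) ->
  cintegral haar (fun v => cintegral m (F v)) =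
  cintegral m (fun w => cintegral haar (F^~ w)).
Proof.
move=> cK FM F0 Fe Fc.
have clK : closed K by exact: compact_closed.
have hK : (haar K < +oo)%E by exact: haar_compact haarP _ cK.
pose V : set (tmds_space X -> R[i]) := [set f | continuous (f : tmds_space X -> C) /\
  exists M, forall w, normc (f w) <= M].
have key := @linear_functional_integral R G 0 haar K cK clK hK (borelOmega X) F V
  (cintegral m) M 2 FM F0 Fe.
apply: key => //.
- move=> a b f g [cf [Mf hf]] [cg [Mg hg]]; split.
    exact: (@continuous_clin R (tmds_space X) a b f g cf cg).
  exists (normc a * Mf + normc b * Mg) => w; apply: le_trans (normcD _ _) _.
  by rewrite !normcM lerD// ler_wpM2l ?normc_ge0.
- move=> a b f g [cf [Mf hf]] [cg [Mg hg]].
  apply: cintegral_lin.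
    exact: (bounded_cintegrable (tmds_cmeasurable cf) hf).
  exact: (bounded_cintegrable (tmds_cmeasurable cg) hg).
- by move=> f e [cf _] fe; exact: (cintegral_bounded_le (tmds_cmeasurable cf) fe).
- by move=> v; split; [exact: Fc|exists M].
- split.
    exact: (@parametric_integral_continuous R G 0 haar K cK clK hK (tmds_space X)
      F M FM F0 Fe Fc).
  exists (2 * (`|M| * fine (haar K))) => w.
  exact: (parametric_integral_le clK hK FM F0 Fe).
Qed.

End Exchange.

End TmdsFunctions.

(** * The autocorrelation of a convolution *)

Section Autocorrelation.
Context {R : realType} {G : topologicalZmodType}.
Hypothesis G_hausdorff : hausdorff_space G.
Variables (haar : {measure set borelG G -> \bar R}) (haarP : is_haar haar).
Variables (X : tmds R G) (m : probability (borelOmega X) R).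
Hypothesis m_invariant : act_invariant m.
Variables (sigma : Cc R G) (sigma1 : cintegral haar sigma = 1).
Notation C := (R[i]^o).

Lemma cm_int_act L (f : G -> R[i]) v (w : tmds_space X) : compact L ->
  continuous_on_supp L f ->
  cm_int (val (tmds_act v w)) f = cm_int (val w) (fun x => f (v + x)).
Proof.
move=> cL /(continuous_on_supp_cc G_hausdorff cL) fcc.
exact: (etrans (cm_intE (val (tmds_act v w)) (MkCc fcc))
  (esym (cm_intE (val w) (Cc_shift v (MkCc fcc))))).
Qed.

Lemma cm_int_le K L (g : G -> G -> R[i]) (M : R) : compact L ->
  (forall v, K v -> continuous_on_supp L (g v)) ->
  (forall v x, normc (g v x) <= M) ->
  exists B, forall v (w : tmds_space X), K v -> normc (cm_int (val w) (g v)) <= B.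
Proof.
move=> cL gL gM; have [N hN] := tmds_bounded_functional G_hausdorff X cL.
exists (N * M) => v w Kv; have [_ _ h] := hN w.
by apply: h; [exact: gL|exact: gM].
Qed.

Lemma cm_intZ L (a : R[i]) (f : G -> R[i]) (w : tmds_space X) : compact L ->
  continuous_on_supp L f -> cm_int (val w) (fun x => a * f x) = a * cm_int (val w) f.
Proof.
move=> cL fL; have [N hN] := tmds_bounded_functional G_hausdorff X cL.
exact: (bounded_functionalZ a (hN w) fL).
Qed.

Lemma cm_int0 (w : tmds_space X) : cm_int (val w) (fun=> 0) = 0.
Proof.
have [N hN] := tmds_bounded_functional G_hausdorff X (@compact0 G).
exact: bounded_functional0 (hN w).
Qed.

Section Phi.
Variable phi : Cc R G.
Let S := supp phi.
Let Z := supp sigma.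
Let compactS : compact S := @compact_supp R G phi.
Let compactZ : compact Z := @compact_supp R G sigma.
(** The value of the translate [tmds_act v w] at [phi], as [DE] records; as an integral against the
    fixed [w], its equicontinuity in [v] follows from that of the integrands. *)
Let D v (w : tmds_space X) : R[i] := cm_int (val w) (fun x => phi (v + x)).

Let shift_supp (K : set G) : compact K -> forall v, K v ->
  continuous_on_supp [set x - y | x in S & y in K] (fun x => phi (v + x)).
Proof.
move=> cK v Kv; have [h1 h2] := continuous_on_supp_shift v (Cc_continuous_on_supp phi).
split => // x nx; apply: h2 => -[y Sy [_ -> yE]]; apply: nx.
by exists y => //; exists v.
Qed.

Let compact_shift_supp (K : set G) : compact K -> compact [set x - y | x in S & y in K].
Proof. by move=> cK; exact: compact_sub. Qed.

Let D_equi (K : set G) : compact K -> equicontinuous_on K D.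
Proof.
move=> cK.
exact: (@equicontinuous_on_cm R G G_hausdorff X G K _ (fun v x => phi (v + x))
  (compact_shift_supp cK) (shift_supp cK) (equicontinuous_on_Cc phi id)).
Qed.

Let D_le (K : set G) : compact K -> exists B, forall v w, K v -> normc (D v w) <= B.
Proof.
move=> cK; have [M hM] := Cc_bounded phi.
by apply: (cm_int_le (compact_shift_supp cK) (shift_supp cK) (M := M)) => v x.
Qed.

Let D_cont v : continuous (D v : tmds_space X -> C).
Proof.
exact: (@cm_int_continuous R G G_hausdorff X _ (fun x => phi (v + x))
  (compact_shift_supp (@compact_set1 G v)) (shift_supp (@compact_set1 G v) erefl)).
Qed.

Let DE v w : D v w = val (tmds_act v w) phi.
Proof. by rewrite -(cm_intE _ phi) (cm_int_act v w compactS (Cc_continuous_on_supp phi)). Qed.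

(** The substitution [u = t + v] puts [t] and [s] into separate factors, so that the integration in
    [s] against [w] can be carried out under the Haar integral. *)
Lemma convolution_shift t s :
  conjc (convolution haar phi (tilde phi) (t - s)) =
  cintegral haar (fun v => conjc (phi (t + v)) * phi (v + s)).
Proof.
pose f u := phi u * conjc (phi (u - (t - s))).
have fS : continuous_on_supp S f.
  split=> [|x /supp0 fx]; last by rewrite /f fx mul0r.
  apply: continuous_cM; first exact: Cc_continuous.
  move=> x; apply: (@continuous_comp _ _ _ (fun x => phi (x - (t - s)) : C)
    (fun z : C => conjc z : C)); last exact: conjc_continuous.
  apply: (@continuous_comp_add R G phi (fun x => x - (t - s))).
    exact: Cc_continuous.
  by move=> z; under eq_fun do rewrite addrC; exact: shift_continuous.
have -> : convolution haar phi (tilde phi) (t - s) = cintegral haar f.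
  by congr cintegral; apply/funext => u; rewrite /tilde /f opprB.
rewrite -(haar_integral_shift G_hausdorff haarP t compactS fS) -cintegral_conj.
  congr cintegral; apply/funext => v; rewrite /f rmorphM/= conjcK.
  by congr (_ * phi _); rewrite opprB addrC addrA subrK addrC.
apply: (continuous_on_supp_cintegrable G_hausdorff (haar_compact haarP) _
  (continuous_on_supp_shift t fS)).
by apply: compact_sub => //; exact: compact_set1.
Qed.

Let psi := insubd (0 : Cc R G) (convolution haar phi (tilde phi)).

Let psiE : psi = convolution haar phi (tilde phi) :> (G -> C).
Proof.
rewrite /psi val_insubd (continuous_on_supp_cc G_hausdorff _
  (convolution_continuous_on_supp G_hausdorff haarP phi))//.
exact: compact_sub.
Qed.

Let K t := [set x - y | x in S & y in [set t]].

Let K_out t v : ~ K t v -> phi (t + v) = 0.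
Proof.
move=> nK; apply: supp0 => tv; apply: nK; exists (t + v) => //; exists t => //.
by rewrite addrC addKr.
Qed.

Let compactK t : compact (K t).
Proof. by apply: compact_sub => //; exact: compact_set1. Qed.

Let inner_integrable t w : cintegrable haar (fun v => conjc (phi (t + v)) * D v w).
Proof.
have [M hM] := Cc_bounded phi.
have [B hB] := D_le (@compactK t).
apply: (@equicontinuous_on_cintegrable R G 0 haar (K t) (compact_closed G_hausdorff (@compactK t))
  (haar_compact haarP (@compactK t)) (tmds_space X)
  (fun v w => conjc (phi (t + v)) * D v w) (M * `|B|)).
- move=> v w'; have [Kv|/K_out ->] := pselect (K t v).
    rewrite normcM normcJ; apply: ler_pM; rewrite ?normc_ge0//.
    exact: le_trans (hB _ _ Kv) (ler_norm _).
  rewrite conjc0 mul0r Normc.normc0 mulr_ge0//.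
  exact: le_trans (normc_ge0 _) (hM 0).
- by move=> v /K_out ->; apply/funext => w'; rewrite conjc0 mul0r.
- apply: (@equicontinuous_onM _ _ _ _ _ _ M B) => //.
  + by move=> v w' _; rewrite normcJ.
  + apply: equicontinuous_onJ.
    have := equicontinuous_on_Cc (K := K t) phi (fun _ : tmds_space X => t).
    by congr equicontinuous_on; apply/funext => v; apply/funext => w' /=; rewrite addrC.
  + exact: D_equi.
Qed.

(** The left side is the conjugate of [w] applied to the conjugate of [psi (t - s)] as a function of
    [s]; after [convolution_shift] and an exchange, [w] meets only [phi (v + s)], which gives
    [D v w]. *)
Lemma f_phi_translate_conj (w : tmds_space X) t :
  f_phi psi (translate (- t) (cm_conj (val w))) =
  cintegral haar (fun v => phi (t + v) * conjc (D v w)).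
Proof.
have -> : f_phi psi (translate (- t) (cm_conj (val w))) =
    conjc (cm_int (val w) (fun s => conjc (convolution haar phi (tilde phi) (t - s)))).
  rewrite -psiE; transitivity (conjc (val w (Cc_conj (Cc_shift (- t) (Cc_refl psi))))) => //.
  rewrite -cm_intE; congr (conjc (cm_int _ _)); apply/funext => s /=.
  by rewrite opprD opprK.
rewrite (_ : (fun s => _) =
    fun s => cintegral haar (fun v => conjc (phi (t + v)) * phi (v + s))); last first.
  by apply/funext => s; exact: convolution_shift.
have [M hM] := Cc_bounded phi.
pose L := [set x - y | x in S & y in K t].
have [N hN] := tmds_bounded_functional G_hausdorff X (compact_shift_supp (@compactK t) : compact L).
have key : cintegral haar
      (fun v => cm_int (val w) (fun s => conjc (phi (t + v)) * phi (v + s))) =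
    cm_int (val w) (fun s => cintegral haar (fun v => conjc (phi (t + v)) * phi (v + s))).
  apply: (@bounded_functional_integral R G G 0 haar (K t)
    (fun v s => conjc (phi (t + v)) * phi (v + s)) (M * M) L (cm_int (val w)) N).
  - exact: compactK.
  - exact: compact_closed.
  - exact: haar_compact haarP _ _.
  - by move=> v x; rewrite normcM normcJ; apply: ler_pM; rewrite ?normc_ge0.
  - by move=> v /K_out ->; apply/funext => x; rewrite conjc0 mul0r.
  - apply: (@equicontinuous_onM _ _ _ _ _ _ M M) => //.
    + by move=> v w' _; rewrite normcJ.
    + apply: equicontinuous_onJ.
      have := equicontinuous_on_Cc (K := K t) phi (fun _ : G => t).
      by congr equicontinuous_on; apply/funext => v; apply/funext => w' /=; rewrite addrC.
    + exact: (equicontinuous_on_Cc phi id).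
  - move=> v; have [Kv|/K_out ->] := pselect (K t v).
      have [h1 h2] := shift_supp (@compactK t) Kv; split.
        by apply: continuous_cM; [exact: cst_continuous|exact: h1].
      by move=> x /h2 ->; rewrite mulr0.
    rewrite conjc0; split=> [x|x _]; last by rewrite mul0r.
    by under eq_fun do rewrite mul0r; exact: cvg_cst.
  - exact: hN.
rewrite -key (_ : (fun v => cm_int _ _) = fun v => conjc (phi (t + v)) * D v w); last first.
  apply/funext => v.
  exact: (@cm_intZ _ _ (fun s => phi (v + s)) w (compact_shift_supp (@compact_set1 G v))
    (shift_supp (@compact_set1 G v) erefl)).
rewrite -cintegral_conj//; congr cintegral; apply/funext => v.
by rewrite rmorphM/= conjcK.
Qed.

Let K' := [set x - y | x in S & y in Z].

Let compactK' : compact K'.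
Proof. exact: compact_sub. Qed.

(** The factor of the autocorrelation integrand in which [w] is integrated against the weight
    [sigma]; it vanishes for [v] outside [K']. *)
Let A v (w : tmds_space X) : R[i] := cm_int (val w) (fun t => sigma t * phi (v + t)).

Let A_supp v : continuous_on_supp Z (fun t => sigma t * phi (v + t)).
Proof.
split=> [|x /supp0 ->]; last by rewrite mul0r.
apply: continuous_cM; first exact: Cc_continuous.
exact: (@continuous_comp_add R G phi (fun x => v + x) (@Cc_continuous _ _ phi)
  (@shift_continuous G v)).
Qed.

Let A_out v : ~ K' v -> (fun t => sigma t * phi (v + t)) = fun=> 0.
Proof.
move=> nK; apply/funext => t.
have [Zt|/supp0 ->] := pselect (Z t); last by rewrite mul0r.
have [Svt|/supp0 ->] := pselect (S (v + t)); last by rewrite mulr0.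
by exfalso; apply: nK; exists (v + t) => //; exists t => //; rewrite addrK.
Qed.

Let A_fun_equi : equicontinuous_on K' (fun v t => sigma t * phi (v + t)).
Proof.
have [M hM] := Cc_bounded phi; have [Ms hMs] := Cc_bounded sigma.
apply: (@equicontinuous_onM _ _ _ _ _ _ Ms M) => //; first exact: equicontinuous_on_cst.
exact: (equicontinuous_on_Cc phi id).
Qed.

(** For fixed [w] the number [D v w] is a constant in [t], so the remaining integral against [w]
    passes under the Haar integral and sees only [sigma t * phi (v + t)]. *)
Lemma cm_int_autocorrelation (w : tmds_space X) :
  cm_int (val w) (fun t =>
    f_phi psi (translate (- t) (cm_conj (val w))) * sigma t) =
  cintegral haar (fun v => A v w * conjc (D v w)).
Proof.
have [M hM] := Cc_bounded phi; have [Ms hMs] := Cc_bounded sigma.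
have [B hB] := D_le compactK'.
have [N hN] := tmds_bounded_functional G_hausdorff X compactZ.
pose F v t := conjc (D v w) * (sigma t * phi (v + t)).
have cmF v : cm_int (val w) (F v) = A v w * conjc (D v w).
  by rewrite mulrC; exact: (@cm_intZ _ _ _ w compactZ (A_supp v)).
have -> : (fun t => f_phi psi (translate (- t) (cm_conj (val w))) * sigma t) =
    fun t => cintegral haar (F^~ t).
  apply/funext => t; rewrite f_phi_translate_conj mulrC -cintegralZ.
    by congr cintegral; apply/funext => v; rewrite /F (addrC t); ring.
  have [h1 h2] := inner_integrable t w; split; last first.
    have := integrable_lin (-1) 0 h2 h2; congr (integrable _ _ _); apply/funext => v /=.
    by rewrite mul0r addr0 mulN1r -ImJ rmorphM/= conjcK.
  by move: h1; congr (integrable _ _ _); apply/funext => v /=; rewrite -ReJ rmorphM/= conjcK.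
have key : cintegral haar (fun v => cm_int (val w) (F v)) =
    cm_int (val w) (fun t => cintegral haar (F^~ t)).
  apply: (@bounded_functional_integral R G G 0 haar K' F (`|B| * (Ms * M)) Z
    (cm_int (val w)) N).
  - exact: compactK'.
  - exact: compact_closed.
  - exact: haar_compact haarP _ _.
  - move=> v x; rewrite /F; have [Kv|/A_out h] := pselect (K' v).
      rewrite !normcM normcJ; apply: ler_pM; rewrite ?mulr_ge0 ?normc_ge0//.
        exact: le_trans (hB _ _ Kv) (ler_norm _).
      by apply: ler_pM; rewrite ?normc_ge0.
    rewrite (congr1 (fun f => f x) h) mulr0 Normc.normc0.
    by rewrite !mulr_ge0//; exact: le_trans (normc_ge0 _) (_ 0).
  - move=> v /A_out h; apply/funext => x.
    by rewrite /F (congr1 (fun f => f x) h) mulr0.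
  - apply: (@equicontinuous_onM _ _ _ _ _ _ B (Ms * M)).
    + by move=> v x Kv; rewrite normcJ; exact: hB.
    + by move=> v x _; rewrite normcM; apply: ler_pM; rewrite ?normc_ge0.
    + apply: equicontinuous_onJ => v0 Kv0 e e0.
      by apply: filterS (D_equi compactK' Kv0 e0) => v h Kv _; exact: h.
    + exact: A_fun_equi.
  - move=> v; have [h1 h2] := A_supp v; split.
      by apply: continuous_cM; [exact: cst_continuous|exact: h1].
    by move=> x /h2 h; rewrite /F h mulr0.
  - exact: hN.
by rewrite -key; congr cintegral; apply/funext => v; rewrite cmF.
Qed.

(** Chosen so that the translate [tmds_act v w] applied to [B_fun v] equals [A v w]: translation
    cancels the [- v] in [sigma] and shifts [phi]. *)
Let B_fun v t := sigma (- v + t) * phi t.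

Let B_supp v : continuous_on_supp S (B_fun v).
Proof.
split=> [|x /supp0 h]; last by rewrite /B_fun h mulr0.
apply: continuous_cM; last exact: Cc_continuous.
exact: (@continuous_comp_add R G sigma (fun x => - v + x) (@Cc_continuous _ _ sigma)
  (@shift_continuous G (- v))).
Qed.

Let B_out v : ~ K' v -> B_fun v = fun=> 0.
Proof.
move=> nK; apply/funext => t; rewrite /B_fun.
have [St|/supp0 ->] := pselect (S t); last by rewrite mulr0.
have [Zt|/supp0 ->] := pselect (Z (- v + t)); last by rewrite mul0r.
exfalso; apply: nK; exists t => //; exists (- v + t) => //.
by rewrite opprD opprK addrC subrK.
Qed.

Let B_equi : equicontinuous_on K' B_fun.
Proof.
have [M hM] := Cc_bounded phi; have [Ms hMs] := Cc_bounded sigma.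
apply: (@equicontinuous_onM _ _ _ _ _ _ Ms M) => //; last exact: equicontinuous_on_cst.
have := equicontinuous_on_Cc (K := K') (Cc_refl sigma) -%R.
by congr equicontinuous_on; apply/funext => v; apply/funext => x /=; rewrite opprD opprK.
Qed.

(** The integral of [sigma (- v + t)] over [v] is 1 for every [t]. Since [v] enters with a minus
    sign, this is where invariance of the Haar integral under inversion is used. *)
Lemma cm_int_average (w : tmds_space X) :
  cintegral haar (fun v => cm_int (val w) (B_fun v)) = val w phi.
Proof.
have [M hM] := Cc_bounded phi; have [Ms hMs] := Cc_bounded sigma.
have [N hN] := tmds_bounded_functional G_hausdorff X compactS.
rewrite (@bounded_functional_integral R G G 0 haar K' B_fun (Ms * M) S
    (cm_int (val w)) N) //.
- rewrite -(cm_intE (val w) phi); congr (cm_int _ _); apply/funext => t.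
  have int : cintegrable haar (fun v => sigma (t - v)).
    apply: (continuous_on_supp_cintegrable G_hausdorff (haar_compact haarP) _
      (continuous_on_supp_opp t (Cc_continuous_on_supp sigma))).
    by apply: compact_sub => //; exact: compact_set1.
  rewrite -[RHS]mulr1 -(haar_integral_opp G_hausdorff haarP sigma1 t) -cintegralZ//.
  by congr cintegral; apply/funext => v; rewrite /B_fun mulrC addrC.
- exact: compact_closed.
- exact: haar_compact haarP _ _.
- by move=> v x; rewrite normcM; apply: ler_pM; rewrite ?normc_ge0.
Qed.

(* Averaging over the action moves the dependence on v from both factors to
   sigma alone, which then integrates to 1. *)
Lemma autocorrelation_convolution :
  autocorrelation m sigma psi =
  cintegral m (fun w => (normc (val w phi) ^+ 2)%:C).
Proof.
have [M hM] := Cc_bounded phi; have [Ms hMs] := Cc_bounded sigma.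
have [BD hBD] := D_le compactK'.
have MM (a b : R[i]) : normc a <= Ms -> normc b <= M -> normc (a * b) <= Ms * M.
  by move=> ha hb; rewrite normcM; apply: ler_pM; rewrite ?normc_ge0.
have [BA hBA] := @cm_int_le K' Z (fun v t => sigma t * phi (v + t)) (Ms * M) compactZ
  (fun v _ => A_supp v)
  (fun v t => MM _ _ (hMs _) (hM _)).
have [BB hBB] := @cm_int_le K' S B_fun (Ms * M) compactS (fun v _ => B_supp v)
  (fun v t => MM _ _ (hMs _) (hM _)).
have [BP hBP] : exists BP, forall w : tmds_space X, normc (val w phi) <= BP.
  have [B hB] := D_le (@compact_set1 G 0); exists B => w.
  rewrite -(cm_intE _ phi) -(_ : D 0 w = cm_int (val w) phi); first exact: hB.
  by congr (cm_int _ _); apply/funext => x; rewrite add0r.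
pose F1 v (w : tmds_space X) : R[i] := A v w * conjc (D v w).
pose F2 v (w : tmds_space X) : R[i] := cm_int (val w) (B_fun v) * conjc (val w phi).
have F1_cont v : continuous (F1 v : tmds_space X -> C).
  apply: continuous_cM; first exact: cm_int_continuous compactZ (A_supp v).
  move=> w; apply: (@continuous_comp _ _ _ (fun w => D v w : C)
    (fun z : C => conjc z : C)); [exact: D_cont|exact: conjc_continuous].
have F2_cont v : continuous (F2 v : tmds_space X -> C).
  apply: continuous_cM; first exact: cm_int_continuous compactS (B_supp v).
  move=> w; apply: (@continuous_comp _ _ _ (fun w : tmds_space X => val w phi : C)
    (fun z : C => conjc z : C)); [exact: tmds_eval_continuous|exact: conjc_continuous].
have F1_le v w : normc (F1 v w) <= `|BA| * `|BD|.
  have [Kv|/A_out h] := pselect (K' v).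
    rewrite /F1 normcM normcJ; apply: ler_pM; rewrite ?normc_ge0//.
      exact: le_trans (hBA _ _ Kv) (ler_norm _).
    exact: le_trans (hBD _ _ Kv) (ler_norm _).
  by rewrite /F1 /A h cm_int0 mul0r Normc.normc0 mulr_ge0.
have F2_le v w : normc (F2 v w) <= `|BB| * `|BP|.
  have [Kv|/B_out h] := pselect (K' v).
    rewrite /F2 normcM normcJ; apply: ler_pM; rewrite ?normc_ge0//.
      exact: le_trans (hBB _ _ Kv) (ler_norm _).
    exact: le_trans (hBP _) (ler_norm _).
  by rewrite /F2 h cm_int0 mul0r Normc.normc0 mulr_ge0.
(* [F1 v w] is [F2 v] at the translate of [w] by [v]; the integral against the invariant [m] forgets
   the translation. *)
have F12 v : cintegral m (F1 v) = cintegral m (F2 v).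
  rewrite -(@cintegral_invariant _ _ _ m (fun w : borelOmega X => tmds_act v w : borelOmega X) _ _
    (F2 v)).
  - congr cintegral; apply/funext => w; rewrite /F2 -DE.
    rewrite (cm_int_act v w compactS (B_supp v)); congr (cm_int _ _ * _).
    by apply/funext => t; rewrite /B_fun addKr.
  - exact: tmds_act_measurable.
  - exact: m_invariant.
  - exact: (tmds_cmeasurable (F2_cont v)).
  - apply: (@bounded_cintegrable _ _ _ m (fun w => F2 v (tmds_act v w)) (`|BB| * `|BP|)).
      apply: (@tmds_cmeasurable _ _ X (fun w => F2 v (tmds_act v w))).
      move=> w; apply: (@continuous_comp (tmds_space X) (tmds_space X) C (tmds_act v) (F2 v)).
        exact: tmds_act_continuous.
      exact: F2_cont.
    by move=> w; exact: F2_le.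
have ex1 : cintegral haar (fun v => cintegral m (F1 v)) =
    cintegral m (fun w => cintegral haar (F1^~ w)).
  apply: (@tmds_integral_exchange _ _ G_hausdorff X m haar haarP K' F1 (`|BA| * `|BD|)).
  - exact: compactK'.
  - exact: F1_le.
  - by move=> v /A_out h; apply/funext => w; rewrite /F1 /A h cm_int0 mul0r.
  - apply: (@equicontinuous_onM _ _ _ _ _ _ BA BD).
    + by move=> v w Kv; exact: hBA.
    + by move=> v w Kv; rewrite normcJ; exact: hBD.
    + exact: (@equicontinuous_on_cm R G G_hausdorff X G K' Z (fun v t => sigma t * phi (v + t))
        compactZ (fun v _ => A_supp v) A_fun_equi).
    + by apply: equicontinuous_onJ; exact: D_equi.
  - exact: F1_cont.
have B_cm := @equicontinuous_on_cm R G G_hausdorff X G K' S B_fun compactS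
  (fun v _ => B_supp v) B_equi.
have ex2 : cintegral haar (fun v => cintegral m (F2 v)) =
    cintegral m (fun w => cintegral haar (F2^~ w)).
  apply: (@tmds_integral_exchange _ _ G_hausdorff X m haar haarP K' F2 (`|BB| * `|BP|)).
  - exact: compactK'.
  - exact: F2_le.
  - by move=> v /B_out h; apply/funext => w; rewrite /F2 h cm_int0 mul0r.
  - apply: (@equicontinuous_onM _ _ _ _ _ _ BB BP).
    + by move=> v w Kv; exact: hBB.
    + by move=> v w _; rewrite normcJ.
    + exact: B_cm.
    + by apply: equicontinuous_onJ; exact: equicontinuous_on_cst.
  - exact: F2_cont.
have F2_int w : cintegral haar (F2^~ w) = (normc (val w phi) ^+ 2)%:C.
  rewrite -conjcM_normc -{2}(cm_int_average w) -cintegralZ.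
    by congr cintegral; apply/funext => v; rewrite mulrC.
  apply: (@equicontinuous_on_cintegrable R G 0 haar K'
    (compact_closed G_hausdorff compactK') (haar_compact haarP compactK') (tmds_space X)
    (fun v w => cm_int (val w) (B_fun v)) `|BB|).
  - move=> v w'; have [Kv|/B_out ->] := pselect (K' v).
      exact: le_trans (hBB _ _ Kv) (ler_norm _).
    by rewrite cm_int0 Normc.normc0.
  - by move=> v /B_out ->; apply/funext => w'; exact: cm_int0.
  - exact: B_cm.
transitivity (cintegral m (fun w => cintegral haar (F1^~ w))).
  by congr cintegral; apply/funext => w; exact: cm_int_autocorrelation.
transitivity (cintegral haar (fun v => cintegral m (F1 v))); first exact/esym/ex1.
transitivity (cintegral haar (fun v => cintegral m (F2 v))).
  by congr cintegral; apply/funext => v; exact: F12.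
transitivity (cintegral m (fun w => cintegral haar (F2^~ w))); first exact: ex2.
by congr cintegral; apply/funext => w; exact: F2_int.
Qed.

End Phi.

End Autocorrelation.

(** * Trigonometric polynomials on the dual group *)

Section DualTopology.
Context {R : realType} {G : topologicalZmodType}.
Notation C := (R[i]^o).
Notation D := (dual_group R G).
Implicit Types chi psi : D.

Lemma normcB_continuous (c : C) :
  continuous ((fun z => Normc.normc (z - c)) : C -> R).
Proof.
move=> z; apply/(@cvgrPdist_lt R R^o C (nbhs (z : C))) => e e0.
have /continuous_normcP/(_ e e0) := @cvg_id C (nbhs (z : C)); apply: filterS => w h.
apply: le_lt_trans h; rewrite ler_norml; apply/andP; split.
  rewrite lerNl opprB lerBlDr (_ : w - c = (w - z) + (z - c)) ?normcD//.
  by ring.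
rewrite lerBlDr (_ : z - c = (z - w) + (w - c)); last by ring.
by apply: le_trans (normcD _ _) _; rewrite normc_distC.
Qed.

(** Uniform closeness on [K] is a compact-open neighbourhood: by compactness it suffices to work
    near one [t0], where [chi] is almost constant and a single condition of the form compact set
    into open set controls [psi]. *)
Lemma near_dual chi (K : set G) (e : R) : compact K -> 0 < e ->
  nbhs chi [set psi : D | forall t, K t -> normc (psi t - chi t) <= e].
Proof.
move=> cK e0; pose P (A : set G) :=
  nbhs chi [set psi : D | forall t, A t -> K t -> normc (psi t - chi t) <= e].
have FF : Filter (nbhs chi) by exact: (@nbhs_filter D chi).
suff PK : P K by refine (@filterS _ _ FF _ _ _ PK) => psi h t Kt; exact: h.
apply: (@compact_ind G K P cK).
- by move=> A B AB PB; refine (@filterS _ _ FF _ _ _ PB) => psi h t /AB; exact: h.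
- by refine (@filterS _ _ FF _ _ _ (@filterT _ _ FF)) => psi _ t [].
- move=> A B PA PB; refine (@filterS2 _ _ FF _ _ _ _ PA PB) => psi hA hB t [At|Bt].
    exact: hA.
  exact: hB.
- move=> t0 Kt0; have e40 : 0 < e / 4 by rewrite divr_gt0.
  have /continuous_normcP/(_ _ e40) h0 := @dual_continuous _ _ chi t0.
  pose r t := normc (chi t - chi t0).
  have cr : continuous r.
    move=> t; apply: (@continuous_comp _ _ _ (chi : G -> C)
      (fun z : C => normc (z - chi t0))); first exact: dual_continuous.
    exact: normcB_continuous.
  (* A closed neighbourhood is needed, so that its trace on [K] is compact. With radius [e / 4] for
     [chi] on [Q] and [e / 2] for [psi] around [chi t0], the difference stays below [e]. *)
  pose Q := [set t | r t <= e / 4].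
  have cQ : closed Q.
    apply: (@closed_comp _ _ r [set x | x <= e / 4]); last exact: closed_le.
    by move=> t _; exact: cr.
  pose W : set C := [set z | normc (z - chi t0) < e / 2].
  have oW : open W.
    apply: (@open_comp _ _ (fun z : C => normc (z - chi t0)) [set x | x < e / 2]);
      last exact: open_lt.
    by move=> z _; exact: normcB_continuous.
  have cKQ : compact (K `&` Q) by exact: compact_closedI.
  exists Q; first by apply: filterS h0 => t /ltW.
  have oB := compact_open_open cKQ oW.
  have chiB : [set g : {compact-open, G -> C} | [set g x | x in K `&` Q] `<=` W]
      (chi : {compact-open, G -> C}).
    move=> _ [t [_ Qt] <-]; rewrite /W /=; apply: le_lt_trans Qt _.
    by lra.
  have nB : nbhs chi ((fun chi : D => (chi : G -> C) : {compact-open, G -> C}) @^-1`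
      [set g : {compact-open, G -> C} | [set g x | x in K `&` Q] `<=` W]).
    apply: (@initial_continuous D {compact-open, G -> C}
      (fun chi : D => (chi : G -> C) : {compact-open, G -> C})).
    exact: open_nbhs_nbhs.
  refine (@filterS _ _ FF _ _ _ nB) => psi /= h t Qt Kt.
  have h1 : normc (psi t - chi t0) < e / 2 by apply: h; exists t.
  have h2 : normc (chi t - chi t0) <= e / 4 by exact: Qt.
  rewrite (_ : psi t - chi t = (psi t - chi t0) + (chi t0 - chi t)); last by ring.
  apply: le_trans (normcD _ _) _; rewrite [X in _ + X]normc_distC.
  by lra.
Qed.

Lemma dual_eval_continuous t : continuous (fun chi : D => chi t : C).
Proof.
move=> chi; apply/continuous_normcP => e e0.
have e20 : 0 < e / 2 by rewrite divr_gt0.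
refine (@filterS _ _ (@nbhs_filter D chi) _ _ _
  (near_dual chi (@compact_set1 G t) e20)) => psi /(_ t erefl) h.
by apply: le_lt_trans h _; lra.
Qed.

Lemma dual_ext chi psi : (forall t, chi t = psi t) -> chi = psi.
Proof.
case: chi psi => [f1 a1 b1 c1] [f2 a2 b2 c2] /= h.
have e : f1 = f2 by exact/funext.
by subst f2; congr Dual; exact: Prop_irrelevance.
Qed.

Lemma dual_hausdorff : hausdorff_space D.
Proof.
move=> chi psi h; apply: dual_ext => t; apply: (@norm_hausdorff _ C).
move=> A B nA nB.
have [z [Az Bz]] := h _ _ (@dual_eval_continuous t chi A nA) (@dual_eval_continuous t psi B nB).
by exists (z t).
Qed.

Lemma normc_dual chi t : normc (chi t) = 1.
Proof. by have := dual_norm1 chi t; rewrite normr_normc => /(congr1 (@complex.Re R)). Qed.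

Lemma dual_neq0 chi t : chi t != 0.
Proof. by rewrite -normr_eq0 dual_norm1 oner_neq0. Qed.

Lemma dual0 chi : chi 0 = 1.
Proof.
by apply: (mulfI (dual_neq0 chi 0)); rewrite -dualD addr0 mulr1.
Qed.

Lemma dualN chi t : chi (- t) = conjc (chi t).
Proof.
apply: (mulIf (dual_neq0 chi t)); rewrite -dualD addNr dual0 conjcM_normc.
by rewrite normc_dual expr1n.
Qed.

Definition trigonometric (p : D -> R[i]) : Prop :=
  exists s : seq (R[i] * G), forall chi, p chi = \sum_(q <- s) q.1 * chi q.2.

Lemma trigonometric_eval a t : trigonometric (fun chi => a * chi t).
Proof. by exists [:: (a, t)] => chi; rewrite big_seq1. Qed.

Lemma trigonometric_cst a : trigonometric (fun=> a).
Proof. by exists [:: (a, 0)] => chi; rewrite big_seq1 dual0 mulr1. Qed.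

Lemma trigonometricD p q : trigonometric p -> trigonometric q ->
  trigonometric (fun chi => p chi + q chi).
Proof.
by move=> [s hs] [t ht]; exists (s ++ t) => chi; rewrite big_cat hs ht.
Qed.

Lemma trigonometricM p q : trigonometric p -> trigonometric q ->
  trigonometric (fun chi => p chi * q chi).
Proof.
move=> [s hs] [t ht].
exists [seq (x.1 * y.1, x.2 + y.2) | x <- s, y <- t] => chi.
rewrite hs ht big_distrl /= big_allpairs_dep /=; apply: eq_bigr => x _.
by rewrite big_distrr /=; apply: eq_bigr => y _; rewrite dualD; ring.
Qed.

Lemma trigonometric_continuous p : trigonometric p -> continuous (p : D -> C).
Proof.
move=> [s hs]; rewrite (_ : p = fun chi => \sum_(q <- s) q.1 * chi q.2); last exact/funext.
elim: s {hs} => [|q s IH].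
  rewrite (_ : (fun=> _) = fun=> 0); first exact: cst_continuous.
  by apply/funext => chi; rewrite big_nil.
rewrite (_ : (fun _ => _) = (fun chi : D => q.1 * chi q.2 + 1 * \sum_(q <- s) q.1 * chi q.2)).
  exact: (continuous_clin (@dual_eval_continuous q.2) IH).
by apply/funext => chi; rewrite big_cons mul1r.
Qed.

(** Closed under products and under [1 - f], hence under the polynomials [1 - (1 - x ^ n) ^ m] used
    for amplification; this replaces an approximation theorem. *)
Definition trig01 : set (D -> R) :=
  [set g | (forall chi, 0 <= g chi <= 1) /\ trigonometric (fun chi => (g chi)%:C)].

Lemma trig01M f g : trig01 f -> trig01 g -> trig01 (fun chi => f chi * g chi).
Proof.
move=> [f01 tf] [g01 tg]; split=> [chi|].
  have /andP[? ?] := f01 chi; have /andP[? ?] := g01 chi.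
  by rewrite mulr_ge0//= mulr_ile1.
have := trigonometricM tf tg; congr trigonometric.
by apply/funext => chi; rewrite rmorphM.
Qed.

Lemma trig01C f : trig01 f -> trig01 (fun chi => 1 - f chi).
Proof.
move=> [f01 tf]; split=> [chi|].
  by have /andP[? ?] := f01 chi; rewrite subr_ge0 lerBlDr lerDl; apply/andP.
have := trigonometricD (trigonometric_cst 1) (trigonometricM (trigonometric_cst (-1)) tf).
by congr trigonometric; apply/funext => chi; rewrite mulN1r rmorphB.
Qed.

Lemma trig01_1 : trig01 (fun=> 1).
Proof.
split=> [chi|]; first by rewrite ler01 lexx.
exact: trigonometric_cst.
Qed.

Lemma trig01_0 : trig01 (fun=> 0).
Proof.
have := trig01C trig01_1; congr trig01; apply/funext => chi; exact: subrr.
Qed.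

Lemma trig01X f n : trig01 f -> trig01 (fun chi => f chi ^+ n).
Proof.
move=> tf; elim: n => [|n IH].
  by have := trig01_1; congr trig01; apply/funext => chi; rewrite expr0.
by have := trig01M tf IH; congr trig01; apply/funext => chi; rewrite exprS.
Qed.

Lemma trig01_continuous f : trig01 f -> continuous f.
Proof. by move=> [_ /trigonometric_continuous/continuous_Re]. Qed.

(** The real part is half the sum with the conjugate, and the conjugate of [chi t] is [chi (- t)];
    hence the coefficients 1/4. *)
Lemma trig01_Re (c : R[i]) t : normc c = 1 ->
  trig01 (fun chi => (1 + complex.Re (c * chi t)) / 2).
Proof.
move=> c1; split=> [chi|].
  have : `|complex.Re (c * chi t)| <= 1.
    by apply: le_trans (Re_le_normc _) _; rewrite normcM c1 normc_dual mul1r.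
  by rewrite ler_norml => /andP[? ?]; apply/andP; split; lra.
have := trigonometricD (trigonometric_cst (2^-1)%:C)
  (trigonometricD (trigonometric_eval (c * (4^-1)%:C) t)
    (trigonometric_eval (conjc c * (4^-1)%:C) (- t))).
congr trigonometric; apply/funext => chi; rewrite dualN.
case: c {c1} => a b; case: (chi t) => x y; apply/eqP; rewrite eq_complex /=.
by apply/andP; split; apply/eqP; field.
Qed.

(** At some [t] the characters differ. Rotating by the conjugate of [chi t] moves the value of [chi]
    to 1, the only unimodular number with real part 1. *)
Lemma trig01_separate chi psi : chi <> psi ->
  exists2 g, trig01 g & g chi = 1 /\ g psi < 1.
Proof.
move=> neq; have [t nt] : exists t, chi t <> psi t.
  by apply: contrapT => h; apply: neq; apply: dual_ext => t; apply: contrapT => nt; apply: h; exists t.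
exists (fun xi : D => (1 + complex.Re (conjc (chi t) * xi t)) / 2).
  by apply: trig01_Re; rewrite normcJ normc_dual.
split; first by rewrite conjcM_normc normc_dual expr1n /=; lra.
pose z := conjc (chi t) * psi t.
have z1 : normc z = 1 by rewrite normcM normcJ !normc_dual mulr1.
have zlt : complex.Re z < 1.
  rewrite lt_neqAle; apply/andP; split; last first.
    by rewrite -z1; exact: le_trans (ler_norm _) (Re_le_normc _).
  apply/eqP => Rez; apply: nt.
  have Imz : complex.Im z = 0.
    have := sqr_normc z; rewrite z1 Rez !expr1n => /eqP.
    by rewrite -subr_eq0 opprD addrA subrr sub0r oppr_eq0 sqrf_eq0 => /eqP.
  have zE : z = 1 by apply/eqP; rewrite eq_complex Rez Imz /= !eqxx.
  apply: (mulfI (dual_neq0 chi (- t))).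
  by rewrite dualN -/z zE conjcM_normc normc_dual expr1n.
by rewrite -/z; lra.
Qed.

End DualTopology.

Section Amplification.
Context {R : realType}.

Lemma bernoulli_le (y : R) m : 0 <= y <= 1 -> 1 - (1 - y) ^+ m <= m%:R * y.
Proof.
move=> /andP[y0 y1]; elim: m => [|m IH]; first by rewrite expr0 subrr mul0r.
have h : 0 <= (1 - y) ^+ m <= 1 by rewrite exprn_ge0 ?exprn_ile1//; lra.
by rewrite exprS -[m.+1]addn1 natrD; move: h => /andP[? ?]; nra.
Qed.

(** The upper bound [1 / (1 + m y)] for [(1 - y) ^ m], which complements [bernoulli_le]: one serves
    above the threshold [b], the other below [a]. *)
Lemma bernoulli_inv (y : R) m : 0 <= y <= 1 -> (1 - y) ^+ m * (1 + m%:R * y) <= 1.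
Proof.
move=> /andP[y0 y1]; elim: m => [|m IH]; first by rewrite expr0 mul0r addr0 mul1r.
have h : 0 <= (1 - y) ^+ m <= 1 by rewrite exprn_ge0 ?exprn_ile1//; lra.
apply: le_trans IH; rewrite exprSr -mulrA ler_wpM2l//; first by case/andP: h.
rewrite -[m.+1]addn1 natrD.
have m0 : 0 <= m%:R :> R by [].
by nra.
Qed.

(* The polynomial [1 - (1 - x^n)^m] is close to 0 below a and to 1 above b when
   m is about [1 / (e b^n)] and n is large. *)
Lemma amplify (a b e : R) : 0 <= a -> a < b -> b <= 1 -> 0 < e ->
  exists n m, forall x, 0 <= x <= 1 ->
    (b <= x -> 1 - e <= 1 - (1 - x ^+ n) ^+ m) /\
    (x <= a -> 1 - (1 - x ^+ n) ^+ m <= e).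
Proof.
move=> a0 ab b1 e0; have b0 : 0 < b by exact: le_lt_trans ab.
have q0 : 0 <= a / b by rewrite divr_ge0// ltW.
have q1 : `|a / b| < 1 by rewrite ger0_norm// ltr_pdivrMr// mul1r.
(* With [m <= 1 / (e b ^ n) + 1] and [b <= 1], the product [m a ^ n] is at most
   [(a / b) ^ n (1 / e + 1)]; [n] is chosen to make this less than [e]. *)
have d0 : 0 < e / (e^-1 + 1) by rewrite divr_gt0// addr_gt0// invr_gt0.
have [n qn] : exists n, (a / b) ^+ n < e / (e^-1 + 1).
  have /cvgrPdist_lt/(_ _ d0)[N _ /(_ N (leqnn N))] := cvg_expr q1.
  rewrite /= sub0r normrN => h; exists N; exact: le_lt_trans (ler_norm _) h.
have bn0 : 0 < b ^+ n by rewrite exprn_gt0.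
pose u := (e * b ^+ n)^-1; have u0 : 0 < u by rewrite invr_gt0 mulr_gt0.
pose m := (Num.trunc u).+1.
have mu : u < m%:R by exact: truncnS_gt.
have mu1 : m%:R <= u + 1.
  rewrite /m -[X in X%:R]addn1 natrD lerD2r.
  by have /andP[] := truncn_itv (ltW u0).
exists n, m => x /andP[x0 x1].
have xn01 : 0 <= x ^+ n <= 1 by rewrite exprn_ge0 ?exprn_ile1.
split=> [bx|xa].
  rewrite lerD2l lerN2; have h := bernoulli_inv m xn01.
  have bxn : b ^+ n <= x ^+ n by rewrite lerXn2r// nnegrE ltW.
  have mx : e^-1 <= m%:R * x ^+ n.
    apply: (@le_trans _ _ (u * b ^+ n)).
      by rewrite /u invfM -mulrA mulVf ?mulr1// gt_eqF.
    by apply: ler_pM => //; exact: ltW.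
  have p0 : 0 <= (1 - x ^+ n) ^+ m by rewrite exprn_ge0// subr_ge0; case/andP: xn01.
  have : (1 - x ^+ n) ^+ m * e^-1 <= 1.
    by apply: le_trans h; rewrite ler_wpM2l//; lra.
  by rewrite ler_pdivrMr// mul1r.
apply: le_trans (bernoulli_le m xn01) _.
have xan : x ^+ n <= a ^+ n by rewrite lerXn2r.
have an : a ^+ n = (a / b) ^+ n * b ^+ n by rewrite expr_div_n mulfVK// gt_eqF.
apply: (@le_trans _ _ ((u + 1) * a ^+ n)).
  by apply: ler_pM => //; case/andP: xn01.
rewrite mulrDl mul1r.
have -> : u * a ^+ n = (a / b) ^+ n * e^-1.
  by rewrite an /u; field; rewrite !gt_eqF.
have anq : a ^+ n <= (a / b) ^+ n.
  by rewrite an; apply: ler_piMr; [exact: exprn_ge0|apply: exprn_ile1 => //; exact: ltW].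
apply: (@le_trans _ _ ((a / b) ^+ n * (e^-1 + 1))); first by rewrite mulrDr mulr1 lerD2l.
by rewrite -ler_pdivlMr ?ltW// addr_gt0// invr_gt0.
Qed.

End Amplification.

Section Separation.
Context {R : realType} {G : topologicalZmodType}.
Notation D := (dual_group R G).
Implicit Types K L : set D.

Definition trig_separated K L : Prop := forall e : R, 0 < e ->
  exists2 g, trig01 g & (forall chi, K chi -> 1 - e <= g chi) /\
    (forall chi, L chi -> g chi <= e).

Lemma trig_separatedS K K' L L' : K' `<=` K -> L' `<=` L ->
  trig_separated K L -> trig_separated K' L'.
Proof.
move=> KK LL h e /h[g tg [gK gL]]; exists g => //.
by split=> chi; [move=> /KK; exact: gK|move=> /LL; exact: gL].
Qed.

(** [1 - (1 - g1) (1 - g2)] is near 1 as soon as one factor is, and is at most [g1 + g2] on [L]; the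
    dual case below uses the product. *)
Lemma trig_separatedUl K1 K2 L : trig_separated K1 L -> trig_separated K2 L ->
  trig_separated (K1 `|` K2) L.
Proof.
move=> h1 h2 e e0; have e20 : 0 < e / 2 by rewrite divr_gt0.
have [g1 t1 [a1 b1]] := h1 _ e20; have [g2 t2 [a2 b2]] := h2 _ e20.
exists (fun chi => 1 - (1 - g1 chi) * (1 - g2 chi)).
  by apply: trig01C; apply: trig01M; exact: trig01C.
have [r1 _] := t1; have [r2 _] := t2.
split=> chi; have /andP[? ?] := r1 chi; have /andP[? ?] := r2 chi.
  by case=> [/a1|/a2] h; nra.
by move=> Lchi; have := b1 _ Lchi; have := b2 _ Lchi; nra.
Qed.

Lemma trig_separatedUr K L1 L2 : trig_separated K L1 -> trig_separated K L2 ->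
  trig_separated K (L1 `|` L2).
Proof.
move=> h1 h2 e e0; have e20 : 0 < e / 2 by rewrite divr_gt0.
have [g1 t1 [a1 b1]] := h1 _ e20; have [g2 t2 [a2 b2]] := h2 _ e20.
exists (fun chi => g1 chi * g2 chi); first exact: trig01M.
have [r1 _] := t1; have [r2 _] := t2.
split=> chi; have /andP[? ?] := r1 chi; have /andP[? ?] := r2 chi; last first.
  by case=> [/b1|/b2] h; nra.
by move=> Kchi; have := a1 _ Kchi; have := a2 _ Kchi; nra.
Qed.

(** The thresholds [a] and [b] cut the interval from [g psi] to [g chi = 1] into thirds. The
    neighbourhoods are fixed before the error [e]; amplification then reaches every [e]. *)
Lemma trig_separated_nbhs (chi psi : D) : chi <> psi ->
  exists A B, [/\ nbhs chi A, nbhs psi B & trig_separated A B].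
Proof.
move=> /trig01_separate[g tg [g1 glt]]; have [r _] := tg.
have /andP[gp0 _] := r psi.
pose a := g psi + (1 - g psi) / 3; pose b := g psi + 2 * (1 - g psi) / 3.
have cg := trig01_continuous tg.
exists [set x | b < g x], [set x | g x < a]; split.
- apply: open_nbhs_nbhs; split; last by rewrite /b /= g1; lra.
  by apply: (@open_comp _ _ g [set x | b < x]); [move=> x _; exact: cg|exact: open_gt].
- apply: open_nbhs_nbhs; split; last by rewrite /a /=; lra.
  by apply: (@open_comp _ _ g [set x | x < a]); [move=> x _; exact: cg|exact: open_lt].
move=> e e0; have [|||n [m hnm]] := @amplify R a b e _ _ _ e0.
- by rewrite /a; lra.
- by rewrite /a /b; lra.
- by rewrite /b; lra.
exists (fun x => 1 - (1 - g x ^+ n) ^+ m).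
  by apply: trig01C; apply: trig01X; apply: trig01C; exact: trig01X.
by split=> x /= /ltW h; have [h1 h2] := hnm _ (r x); [exact: h1|exact: h2].
Qed.

(** Compactness is used twice, as for disjoint compact sets in a Hausdorff space: over [K] for a
    fixed point of [L], shrinking its neighbourhood at each union, and then over [L]. *)
Lemma compact_trig_separated K L : compact K -> compact L ->
  (forall chi, K chi -> ~ L chi) -> trig_separated K L.
Proof.
move=> cK cL KL.
have point psi : L psi -> exists2 B, nbhs psi B & trig_separated K B.
  move=> Lpsi.
  apply: (@compact_ind D K (fun A => exists2 B, nbhs psi B & trig_separated A B) cK).
  - by move=> A A' AA [B nB h]; exists B => //; exact: trig_separatedS AA (@subset_refl _ B) h.
  - exists setT; first exact: (@filterT _ _ (@nbhs_filter D psi)).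
    move=> e e0; exists (fun=> 0); first exact: trig01_0.
    by split=> // chi _; exact: ltW.
  - move=> A1 A2 [B1 nB1 h1] [B2 nB2 h2]; exists (B1 `&` B2).
      exact: (@filterI _ _ (@nbhs_filter D psi)).
    apply: trig_separatedUl.
      exact: (trig_separatedS (@subset_refl _ A1) (@subIsetl _ B1 B2) h1).
    exact: (trig_separatedS (@subset_refl _ A2) (@subIsetr _ B1 B2) h2).
  - move=> chi Kchi.
    have [|A [B [nA nB h]]] := @trig_separated_nbhs chi psi.
      by move=> e; apply: (KL chi Kchi); rewrite e.
    by exists A => //; exists B.
apply: (@compact_ind D L (fun B => trig_separated K B) cL).
- by move=> A B AB; exact: trig_separatedS (@subset_refl _ K) AB.
- move=> e e0; exists (fun=> 1); first exact: trig01_1.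
  by split=> // chi _; rewrite gerBl ltW.
- by move=> A B; exact: trig_separatedUr.
- exact: point.
Qed.

End Separation.

(** * Comparison of weighted measures through trigonometric polynomials *)

Section TrigonometricUniqueness.
Context {R : realType} {G : topologicalZmodType}.
Notation D := (dual_group R G).
Notation BD := (borelDual R G).

Lemma compact_borelDual (K : set D) : compact K -> measurable (K : set BD).
Proof.
move=> cK; apply: closed_borel; apply: compact_closed => //.
exact: dual_hausdorff.
Qed.

Lemma trig01_measurable (g : D -> R) : trig01 g -> measurable_fun setT (g : BD -> R).
Proof. by move=> /trig01_continuous; exact: continuous_borel. Qed.

(** Inner regularity of the measure with density [w], stated through integrals so that this measure
    need not be constructed. *)
Definition tight (mu : {measure set BD -> \bar R}) (w : BD -> R) : Prop :=
  forall A : set BD, measurable A -> forall e : R, 0 < e ->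
    exists K : set D, [/\ compact K, K `<=` A & \int[mu]_(x in A `\` K) w x < e].

Section Integrable.
Variables (mu : {measure set BD -> \bar R}) (w : BD -> R).
Hypotheses (w0 : forall x, 0 <= w x) (wi : mu.-integrable setT (EFin \o w)).

Lemma integrable_trig01M (g : D -> R) : trig01 g ->
  mu.-integrable setT (EFin \o (fun x => g x * w x)).
Proof.
move=> tg; have [r _] := tg.
have mw : measurable_fun setT w by apply/measurable_EFinP; exact: measurable_int wi.
apply: (le_integrable _ _ _ wi) => //.
  by apply/measurable_EFinP; apply: measurable_funM => //; exact: trig01_measurable.
move=> x _; have /andP[? ?] := r x.
by rewrite /= lee_fin !ger0_norm ?mulr_ge0// ler_piMl.
Qed.

Lemma integrable_patch (A : set BD) : measurable A ->
  mu.-integrable setT (EFin \o (w \_ A)).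
Proof.
move=> mA; have := (integrable_mkcond (EFin \o w) mA).1 (integrableS _ mA _ wi).
rewrite restrict_EFin; apply => //; exact: subsetT.
Qed.

Lemma Rintegral_ge0_le (A B : set BD) : measurable A -> measurable B -> A `<=` B ->
  \int[mu]_(x in A) w x <= \int[mu]_(x in B) w x.
Proof.
move=> mA mB AB; rewrite [leLHS]Rintegral_mkcond [leRHS]Rintegral_mkcond.
apply: le_Rintegral => //.
- exact: integrable_patch.
- exact: integrable_patch.
- move=> x _; rewrite !patchE; case: ifPn => xA; case: ifPn => //.
  by move=> /negP; rewrite inE => xB; exfalso; apply: xB; apply: AB; rewrite inE in xA.
Qed.

End Integrable.

Section Compare.
Variables (mu1 mu2 : {measure set BD -> \bar R}) (w1 w2 : BD -> R).
Hypotheses (w10 : forall x, 0 <= w1 x) (w20 : forall x, 0 <= w2 x).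
Hypotheses (wi1 : mu1.-integrable setT (EFin \o w1))
  (wi2 : mu2.-integrable setT (EFin \o w2)).
Hypotheses (tight1 : tight mu1 w1) (tight2 : tight mu2 w2).
Hypothesis trig_eq : forall g, trig01 g ->
  \int[mu1]_x (g x * w1 x) = \int[mu2]_x (g x * w2 x).

(** Test with a polynomial [g] close to 1 on [K] and to 0 on a compact [L] that carries almost all
    the second weight outside [K]; the rest of the complement is small whatever [g] does there. *)
Lemma compact_Rintegral_le (K : set D) : compact K ->
  \int[mu1]_(x in K) w1 x <= \int[mu2]_(x in K) w2 x.
Proof.
move=> cK; have mK := compact_borelDual cK; apply/ler_addgt0Pr => e e0.
have I1 : 0 <= \int[mu1]_x w1 x by exact: Rintegral_ge0.
have I2 : 0 <= \int[mu2]_x w2 x by exact: Rintegral_ge0.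
set J1 := \int[mu1]_x w1 x in I1; set J2 := \int[mu2]_x w2 x in I2.
have e20 : 0 < e / 2 by rewrite divr_gt0.
have [L [cL LK hL]] := tight2 (measurableC mK) e20.
have q0 : 0 < 2 * (J1 + J2 + 1) by rewrite mulr_gt0// ltr_wpDl// addr_ge0.
(* The separation error costs at most [r J1] on [K] and [r J2] in the upper bound, together at most
   [e / 2]; the other [e / 2] pays for the set [N]. *)
pose r := e / (2 * (J1 + J2 + 1)); have r0 : 0 < r by rewrite divr_gt0.
have [g tg [gK gL]] := compact_trig_separated cK cL
  (fun chi Kchi Lchi => LK chi Lchi Kchi) r0.
have [gr _] := tg; have mL := compact_borelDual cL.
pose N : set BD := ~` K `\` L; have mN : measurable N by apply: measurableD => //; exact: measurableC.
have lower : (1 - r) * \int[mu1]_(x in K) w1 x <= \int[mu1]_x (g x * w1 x).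
  rewrite Rintegral_mkcond -RintegralZl//; last exact: integrable_patch.
  apply: le_Rintegral => //.
  - have := integrable_lin (1 - r) 0 (integrable_patch wi1 mK) wi1.
    by congr integrable; apply/funext => x /=; rewrite mul0r addr0.
  - exact: integrable_trig01M.
  - move=> x _; rewrite patchE; case: ifPn => [|_].
      by rewrite inE => Kx; rewrite ler_wpM2r//; exact: gK.
    by rewrite mulr0 mulr_ge0//; have /andP[] := gr x.
have upper : \int[mu2]_x (g x * w2 x) <=
    \int[mu2]_(x in K) w2 x + (r * J2 + \int[mu2]_(x in N) w2 x).
  have iK := integrable_patch wi2 mK; have iN := integrable_patch wi2 mN.
  have -> : \int[mu2]_(x in K) w2 x + (r * J2 + \int[mu2]_(x in N) w2 x) =
      \int[mu2]_x (1 * (w2 \_ K) x + 1 * (r * w2 x + 1 * (w2 \_ N) x)).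
    rewrite (@Rintegral_lin _ _ _ mu2 1 1 (w2 \_ K) (fun x => r * w2 x + 1 * (w2 \_ N) x))//;
      last exact: integrable_lin.
    rewrite (@Rintegral_lin _ _ _ mu2 r 1 w2 (w2 \_ N))//.
    by rewrite !mul1r -!Rintegral_mkcond.
  apply: le_Rintegral => //.
  - exact: integrable_trig01M.
  - by apply: integrable_lin => //; exact: integrable_lin.
  - move=> x _; have /andP[g0 g1] := gr x; have wx := w20 x.
    have rw : 0 <= r * w2 x by rewrite mulr_ge0// ltW.
    have gw : g x * w2 x <= w2 x by rewrite ler_piMl.
    have N0 : 0 <= (w2 \_ N) x by rewrite patchE; case: ifP.
    have K0 : 0 <= (w2 \_ K) x by rewrite patchE; case: ifP.
    have [Kx|nKx] := pselect (K x).
      by rewrite [(w2 \_ K) x]patchE mem_set//; lra.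
    have [Lx|nLx] := pselect (L x).
      have : g x * w2 x <= r * w2 x by rewrite ler_wpM2r//; exact: gL.
      by lra.
    by rewrite [(w2 \_ N) x]patchE mem_set//; lra.
have K1 : \int[mu1]_(x in K) w1 x <= J1.
  by apply: Rintegral_ge0_le.
have rJ : r * J1 + r * J2 <= e / 2.
  rewrite -mulrDr /r mulrAC ler_pdivrMr//.
  have -> : e / 2 * (2 * (J1 + J2 + 1)) = e * (J1 + J2 + 1) by field.
  by rewrite ler_wpM2l ?(ltW e0)// lerDl.
have rK : r * \int[mu1]_(x in K) w1 x <= r * J1 by rewrite ler_wpM2l// ltW.
have := le_trans lower (eq_ind_r (fun z => z <= _) upper (trig_eq tg)).
move: hL; rewrite -/N => hL; lra.
Qed.

(** Tightness of the first weight reduces [B] to a compact subset, where the comparison applies. The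
    hypotheses are symmetric, so the converse is another instance. *)
Lemma null_Rintegral (B : set BD) : measurable B ->
  \int[mu2]_(x in B) w2 x = 0 -> \int[mu1]_(x in B) w1 x = 0.
Proof.
move=> mB B0; apply/eqP; rewrite eq_le; apply/andP; split; last exact: Rintegral_ge0.
apply/ler_addgt0Pr => e e0; rewrite add0r.
have [K [cK KB hK]] := tight1 mB e0; have mK := compact_borelDual cK.
have -> : \int[mu1]_(x in B) w1 x =
    \int[mu1]_(x in K) w1 x + \int[mu1]_(x in B `\` K) w1 x.
  rewrite -Rintegral_setU//.
  - by rewrite setDUK.
  - exact: measurableD.
  - by rewrite setDUK//; apply: integrableS wi1.
  - by apply/disj_setPS => x [Kx [_]].
have h : \int[mu1]_(x in K) w1 x <= 0.
  rewrite -B0; apply: le_trans (compact_Rintegral_le cK) _.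
  by apply: Rintegral_ge0_le.
by lra.
Qed.

End Compare.

End TrigonometricUniqueness.

(** * Tightness of inner regular measures with bounded density *)

Section Tightness.
Context {R : realType} {G : topologicalZmodType}.
Notation D := (dual_group R G).
Notation BD := (borelDual R G).
Variables (mu : {measure set BD -> \bar R}) (w : BD -> R) (M : R).
Hypothesis mu_regular : inner_regular mu.
Hypotheses (w0 : forall x, 0 <= w x) (wM : forall x, w x <= M).
Hypothesis wi : mu.-integrable setT (EFin \o w).

Let mw : measurable_fun setT w.
Proof. by apply/measurable_EFinP; exact: measurable_int wi. Qed.

Let small n : set BD := [set x | w x <= n.+1%:R^-1].

Let m_small n : measurable (small n).
Proof.
rewrite -[small n]setTI; apply: measurable_fun_le => //.
Qed.

(** The restrictions of [w] to the sets [small n] tend to 0, being at most [1 / (n + 1)]; as [mu]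
    may be infinite, domination by the integrable [w] is what gives convergence of the integrals. *)
Let small_integral (e : R) : 0 < e -> exists n, \int[mu]_(x in small n) w x < e.
Proof.
move=> e0; pose f n := w \_ (small n).
have mf n : measurable_fun setT (EFin \o f n).
  by apply/measurable_EFinP; apply/(measurable_restrictT _ (m_small n)); exact: measurable_funTS.
have f_ge0 n x : 0 <= f n x by rewrite /f patchE; case: ifP.
have f_le n x : f n x <= w x by rewrite /f patchE; case: ifP.
have f_small n x : f n x <= n.+1%:R^-1.
  rewrite /f patchE; case: ifPn => [xs|_]; last by rewrite invr_ge0.
  by have : small n x by exact: set_mem.
have f_cvg x : (EFin \o f n) x @[n --> \oo] --> (0 : \bar R)%E.
  apply: cvg_EFin; first by apply: nearW.
  apply: (@squeeze_cvgr _ _ _ _ (fun=> 0) (fun n => n.+1%:R^-1)).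
  - by apply: nearW => n; rewrite /= f_ge0 f_small.
  - exact: cvg_cst.
  - exact: cvg_harmonic.
have f_dom : {ae mu, forall x, forall n, setT x -> (`|(EFin \o f n) x| <= (EFin \o w) x)%E}.
  by apply: aeW => x n _; rewrite /= lee_fin ger0_norm.
have f_ae : {ae mu, forall x, setT x -> (EFin \o f n) x @[n --> \oo] --> (cst 0%E x : \bar R)}.
  by apply: aeW => x _; exact: f_cvg.
have [_ _] := @dominated_convergence _ _ _ mu setT measurableT
  (fun n => EFin \o f n) (cst 0%E) (EFin \o w) mf (measurable_cst _) f_ae wi f_dom.
rewrite integral0 => /fine_cvg/cvgrPdist_lt/(_ _ e0)[n _ /(_ n (leqnn n))].
rewrite /= sub0r normrN => h; exists n; rewrite Rintegral_mkcond.
exact: le_lt_trans (ler_norm _) h.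
Qed.

Lemma inner_regular_tight : tight mu w.
Proof.
move=> A mA e e0; have e20 : 0 < e / 2 by rewrite divr_gt0.
have M0 : 0 <= M by exact: le_trans (w0 (dual1 R G)) (wM _).
have [n hn] := small_integral e20.
pose A' : set BD := A `\` small n; have mA' : measurable A' by exact: measurableD.
have iA (B : set BD) : measurable B -> mu.-integrable B (EFin \o w).
  by move=> mB; apply: integrableS wi.
(* Markov's inequality: outside [small n], 1 is less than [(n + 1) w], whose integral is finite.
   Inner regularity then leaves out little of [A'] in measure, and the bound [M] converts measure
   into integral. *)
have A'fin : (mu A' < +oo)%E.
  rewrite -[mu A']mul1e -integral_cst//.
  have inw : mu.-integrable A' (fun x => n.+1%:R%:E * (w x)%:E)%E.
    by apply: integrableZl => //; exact: iA.
  apply: le_lt_trans (integrable_lty _ inw) => //.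
  apply: ge0_le_integral => //.
  - exact: measurable_int inw.
  - move=> x [_ /negP]; rewrite -ltNge => xw; rewrite -EFinM lee_fin ltW//.
    by rewrite mulrC -ltr_pdivrMr// div1r.
have A'fn : mu A' \is a fin_num by rewrite ge0_fin_numE.
pose r := e / (2 * (M + 1)).
have q0 : 0 < 2 * (M + 1) by rewrite mulr_gt0// ltr_wpDl.
have r0 : 0 < r by rewrite divr_gt0.
have supfin : ereal_sup [set mu K | K in [set K : set D | compact K /\ K `<=` A']] \is a fin_num.
  by rewrite -(mu_regular mA').
have [_ [K [cK KA'] <-]] := ub_ereal_sup_adherent r0 supfin.
rewrite -(mu_regular mA') => hK; have mK := compact_borelDual cK.
have mN : measurable (A' `\` K) by exact: measurableD.
have muN : fine (mu (A' `\` K)) <= r.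
  have muK : mu K \is a fin_num.
    rewrite ge0_fin_numE//; apply: le_lt_trans A'fin.
    by apply: le_measure; rewrite ?inE.
  have -> : mu (A' `\` K) = (mu A' - mu K)%E.
    by rewrite measureD// (setIidr KA').
  rewrite fineB//.
  by move: hK; rewrite -(fineK A'fn) -(fineK muK) -EFinB lte_fin; lra.
exists K; split => //; first by move=> x /KA'[].
have muN_lty : (mu (A' `\` K) < +oo)%E.
  apply: le_lt_trans A'fin.
  by apply: le_measure; [exact: mem_set|exact: mem_set|exact: subDsetl].
have intN : \int[mu]_(x in A' `\` K) w x <= M * fine (mu (A' `\` K)).
  rewrite Rintegral_mkcond; apply: le_trans (ler_norm _) _.
  apply: Rintegral_supported_le => //.
  - by apply/(measurable_restrictT _ mN); exact: measurable_funTS.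
  - by apply: aeW => x; rewrite patchE; case: ifP; rewrite ?normr0// ger0_norm.
  - by move=> x nx; rewrite patchE memNset.
have -> : A `\` K = (A `&` small n) `|` (A' `\` K).
  apply/seteqP; split => x.
    move=> [Ax nK]; have [sx|nsx] := pselect (small n x); first by left.
    by right.
  move=> [[Ax sx]|[[Ax _] nK]] //; split => // /KA'[_]; exact.
rewrite Rintegral_setU//; first last.
- by apply/disj_setPS => x [[_ sx] [[_ nsx] _]].
- by apply: iA; apply: measurableU => //; exact: measurableI.
- exact: measurableI.
have h1 : \int[mu]_(x in A `&` small n) w x <= \int[mu]_(x in small n) w x.
  by apply: Rintegral_ge0_le => //; exact: measurableI.
have h2 : M * fine (mu (A' `\` K)) <= e / 2.
  apply: (@le_trans _ _ (M * r)); first by rewrite ler_wpM2l.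
  rewrite /r mulrA ler_pdivrMr//.
  have -> : e / 2 * (2 * (M + 1)) = e * (M + 1) by field.
  by rewrite mulrC ler_wpM2l ?(ltW e0)// lerDl.
by lra.
Qed.

End Tightness.

(** * The spectral measures of the functions f_phi *)

Section CharacterIntegrals.
Context {R : realType} {G : topologicalZmodType}.
Notation D := (dual_group R G).
Notation BD := (borelDual R G).
Implicit Types mu : {measure set BD -> \bar R}.

Lemma dual_eval_cmeasurable s : cmeasurable ((fun chi : D => chi s) : BD -> R[i]).
Proof. exact: (@continuous_cborel R D (dual1 R G) _ (@dual_eval_continuous R G s)). Qed.

Lemma cintegrable_character mu (w : BD -> R) s : (forall x, 0 <= w x) ->
  mu.-integrable setT (EFin \o w) ->
  cintegrable mu (fun chi : BD => (chi : D) s * (w chi)%:C).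
Proof.
move=> w0 wi.
have mw : measurable_fun setT w by apply/measurable_EFinP; exact: measurable_int wi.
apply: (cintegrable_le _ _ wi).
  by apply: cmeasurableM; [exact: dual_eval_cmeasurable|exact: cmeasurable_real].
by move=> chi; rewrite normcM normc_dual mul1r normc_real ger0_norm.
Qed.

Lemma cintegral_trigonometric mu (w : BD -> R) (s : seq (R[i] * G)) :
  (forall x, 0 <= w x) -> mu.-integrable setT (EFin \o w) ->
  cintegrable mu (fun chi : BD => (\sum_(q <- s) q.1 * (chi : D) q.2) * (w chi)%:C) /\
  cintegral mu (fun chi : BD => (\sum_(q <- s) q.1 * (chi : D) q.2) * (w chi)%:C) =
  \sum_(q <- s) q.1 * cintegral mu (fun chi : BD => (chi : D) q.2 * (w chi)%:C).
Proof.
move=> w0 wi; elim: s => [|q s [IH1 IH2]].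
  rewrite big_nil (_ : (fun _ => _) = fun=> 0); last first.
    by apply/funext => chi; rewrite big_nil mul0r.
  split; last exact: cintegral0.
  by split; exact: integrable0.
have cq := cintegrable_character q.2 w0 wi.
rewrite (_ : (fun _ => _) = fun chi : BD => q.1 * ((chi : D) q.2 * (w chi)%:C) +
    1 * ((\sum_(q <- s) q.1 * (chi : D) q.2) * (w chi)%:C)); last first.
  by apply/funext => chi; rewrite big_cons mul1r mulrDl mulrA.
split; first exact: cintegrable_lin.
by rewrite cintegral_lin// big_cons mul1r IH2.
Qed.

Lemma trig01_Rintegral_eq mu1 mu2 (w1 w2 : BD -> R) :
  (forall x, 0 <= w1 x) -> (forall x, 0 <= w2 x) ->
  mu1.-integrable setT (EFin \o w1) -> mu2.-integrable setT (EFin \o w2) ->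
  (forall s, cintegral mu1 (fun chi : BD => (chi : D) s * (w1 chi)%:C) =
             cintegral mu2 (fun chi : BD => (chi : D) s * (w2 chi)%:C)) ->
  forall g, trig01 g -> \int[mu1]_x (g x * w1 x) = \int[mu2]_x (g x * w2 x).
Proof.
move=> w10 w20 wi1 wi2 chE g [_ [s gE]].
have gw (mu : {measure set BD -> \bar R}) w : \int[mu]_x (g x * w x) =
    complex.Re (cintegral mu
      (fun chi : BD => (\sum_(q <- s) q.1 * (chi : D) q.2) * (w chi)%:C)).
  rewrite /=; congr Rintegral; apply/funext => chi.
  by rewrite -gE ReM /= mulr0 subr0.
rewrite !gw; congr complex.Re.
have [_ ->] := cintegral_trigonometric s w10 wi1.
have [_ ->] := cintegral_trigonometric s w20 wi2.
by apply: eq_bigr => q _; rewrite chE.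
Qed.

End CharacterIntegrals.

Section FourierWeight.
Context {R : realType} {G : topologicalZmodType}.
Hypothesis G_hausdorff : hausdorff_space G.
Variables (haar : {measure set borelG G -> \bar R}) (haarP : is_haar haar).
Notation C := (R[i]^o).
Notation D := (dual_group R G).
Notation BD := (borelDual R G).
Implicit Types (phi : Cc R G) (chi : D).

(** The Fourier transform at the inverse character, since [is_diffraction] evaluates it at
    [dualV chi]. *)
Definition fourierV phi chi : R[i] := cintegral haar (fun t => chi t * phi t).

Lemma fourier_dualV phi chi : fourier haar phi (dualV chi) = fourierV phi chi.
Proof.
congr cintegral; apply/funext => t /=; congr (_ * _).
rewrite -[RHS]conjcK; congr conjc; apply: (mulfI (dual_neq0 chi t)).
by rewrite divff ?dual_neq0// mulrC conjcM_normc normc_dual expr1n.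
Qed.

Let character_supp phi chi :
  continuous_on_supp (supp phi) (fun t => chi t * phi t).
Proof.
split=> [|x /supp0 ->]; last by rewrite mulr0.
by apply: continuous_cM; [exact: dual_continuous|exact: Cc_continuous].
Qed.

Let character_cintegrable phi chi : cintegrable haar (fun t => chi t * phi t).
Proof.
exact: (continuous_on_supp_cintegrable G_hausdorff (haar_compact haarP)
  (@compact_supp R G phi) (character_supp phi chi)).
Qed.

Lemma fourierV_lin (a : R[i]) phi psi chi :
  fourierV (phi + a *: psi) chi = fourierV phi chi + a * fourierV psi chi.
Proof.
have := cintegral_lin 1 a (character_cintegrable phi chi) (character_cintegrable psi chi).
rewrite mul1r => <-; congr cintegral; apply/funext => t /=.
by transitivity (chi t * (phi t + a * psi t)); [|ring].
Qed.

(** Translation becomes multiplication by a unimodular factor, so the weight does not change; this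
    lets polarisation isolate the cross term. *)
Lemma fourierV_shift s phi chi :
  fourierV (Cc_shift (- s) phi) chi = chi s * fourierV phi chi.
Proof.
rewrite -cintegralZ; last exact: character_cintegrable.
have h := haar_integral_shift G_hausdorff haarP s
  (@compact_supp R G (Cc_shift (- s) phi)) (character_supp (Cc_shift (- s) phi) chi).
rewrite /fourierV -h; congr cintegral; apply/funext => t /=.
by rewrite dualD addKr mulrA.
Qed.

Let bounded phi : bounded_functional (supp phi) (cintegral haar) (2 * fine (haar (supp phi))).
Proof.
by apply: integral_bounded_functional => //; [exact: haar_compact|exact: compact_supp].
Qed.

Lemma fourierV_le phi : exists B, forall chi, normc (fourierV phi chi) <= B.
Proof.
have [M hM] := Cc_bounded phi; exists (2 * fine (haar (supp phi)) * M) => chi.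
have [_ _ h] := bounded phi; apply: h; first exact: character_supp.
by move=> t; rewrite normcM normc_dual mul1r.
Qed.

Lemma fourierV_continuous phi : continuous (fourierV phi : D -> C).
Proof.
move=> chi; apply/continuous_normcP => e e0.
have [M hM] := Cc_bounded phi; have [N0 ll lN] := bounded phi.
set N := 2 * fine (haar (supp phi)) in N0 lN.
have M0 : 0 <= M by exact: le_trans (normc_ge0 _) (hM 0).
pose r := e / (N * M + 1).
have q0 : 0 < N * M + 1 by rewrite ltr_wpDl// mulr_ge0.
have r0 : 0 < r by rewrite divr_gt0.
refine (@filterS _ _ (@nbhs_filter D chi) _ _ _
  (near_dual chi (@compact_supp R G phi) r0)) => psi h.
have := ll 1 (-1) _ _ (character_supp phi psi) (character_supp phi chi).
rewrite mul1r mulN1r => <-.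
apply: (@le_lt_trans _ _ (N * (r * M))).
  apply: lN; first by apply: continuous_on_supp_lin; exact: character_supp.
  move=> t; rewrite mul1r mulN1r -mulrBl normcM.
  have [St|/supp0 ->] := pselect (supp phi t).
    by apply: ler_pM; rewrite ?normc_ge0//; exact: h.
  by rewrite Normc.normc0 mulr0 mulr_ge0// ltW.
rewrite mulrCA /r mulrAC ltr_pdivrMr// ltr_pM2l//.
by rewrite ltrDl.
Qed.

Definition fourier_weight phi (chi : BD) : R := normc (fourierV phi chi) ^+ 2.

Lemma fourier_weight_ge0 phi chi : 0 <= fourier_weight phi chi.
Proof. exact: sqr_ge0. Qed.

Lemma fourier_weight_le phi : exists B, forall chi, fourier_weight phi chi <= B.
Proof.
have [B hB] := fourierV_le phi; exists (B ^+ 2) => chi.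
have B0 : 0 <= B by exact: le_trans (normc_ge0 _) (hB chi).
by rewrite lerXn2r// nnegrE normc_ge0.
Qed.

Lemma fourier_weight_measurable phi : measurable_fun setT (fourier_weight phi).
Proof.
apply: cmeasurable_sqr_normc.
exact: (@continuous_cborel R D (dual1 R G) _ (@fourierV_continuous phi)).
Qed.

(** Take [conjc chi] times [sigma]: the characters cancel and the integral of [sigma], which is 1,
    remains. *)
Lemma fourierV_nonzero (sigma : Cc R G) chi : cintegral haar sigma = 1 ->
  exists phi, fourier_weight phi chi = 1.
Proof.
move=> sigma1.
have cchi : continuous (fun t => conjc (chi t) : C).
  move=> t; apply: (@continuous_comp _ _ _ (chi : G -> C) (fun z : C => conjc z : C)).
    exact: dual_continuous.
  exact: conjc_continuous.
exists (Cc_mul G_hausdorff cchi sigma).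
rewrite /fourier_weight (_ : fourierV _ _ = 1) ?Normc.normc1 ?expr1n//.
rewrite -sigma1; congr cintegral; apply/funext => t /=.
by rewrite mulrA (mulrC (chi t)) conjcM_normc normc_dual expr1n mul1r.
Qed.

End FourierWeight.

(** * Square-integrable functions and projections *)

Section SquareIntegrable.
Context {R : realType} {d : measure_display} {T : measurableType d}.
Variable m : probability T R.
Implicit Types f g h : T -> R[i].

Let m_lty : (m setT < +oo)%E.
Proof. by apply: le_lt_trans (probability_le1 m measurableT) (ltry 1). Qed.

Lemma bounded_Lfun2 (f : T -> R) (M : R) : measurable_fun setT f ->
  (forall x, `|f x| <= M) -> f \in Lfun m 2%:E.
Proof.
move=> mf fM; rewrite inE/=; apply/andP; split; rewrite inE//=.
rewrite /finite_norm unlock poweR_lty//.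
rewrite (eq_integral (fun x => (`|f x| ^+ 2)%:E)); last first.
  by move=> x _; rewrite /= powR_mulrn.
apply: integrable_lty => //.
apply: (@integrable_supported _ _ _ m setT measurableT m_lty (fun x => `|f x| ^+ 2) (M ^+ 2)).
- by apply: measurable_funX; exact: measurableT_comp.
- move=> x; rewrite ger0_norm ?sqr_ge0// lerXn2r// nnegrE//.
  exact: le_trans (normr_ge0 _) (fM x).
- by move=> x /(_ I).
Qed.

Lemma bounded_L2 f (M : R) : cmeasurable f -> (forall x, normc (f x) <= M) -> L2 m f.
Proof.
move=> [mr mi] fM; split; apply: (@bounded_Lfun2 _ M) => // x.
- exact: le_trans (Re_le_normc _) _.
- exact: le_trans (Im_le_normc _) _.
Qed.

Lemma L2_0 : L2 m (fun=> 0).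
Proof.
apply: (@bounded_L2 _ 0); first by split; exact: measurable_cst.
by move=> x; rewrite Normc.normc0.
Qed.

Lemma L2_cmeasurable f : L2 m f -> cmeasurable f.
Proof.
by move=> [] /[!inE] /andP[/[!inE]/= mr _] /andP[/[!inE]/= mi _]; split.
Qed.

Lemma L2_integrable f : L2 m f ->
  m.-integrable setT (EFin \o (fun x => normc (f x) ^+ 2)).
Proof.
move=> [/Lfun2_integrable_sqr hr /Lfun2_integrable_sqr hi].
have := integrable_lin 1 1 hr hi; congr (integrable _ _ _).
by apply/funext => x /=; rewrite !mul1r sqr_normc.
Qed.

(** The arithmetic-geometric inequality stands in for Cauchy-Schwarz, both for integrability of
    products and for the absorption argument in [pvm_closure_zero]. *)
Lemma normc_mul_le (z w : R[i]) :
  normc (conjc z * w) <= 2^-1 * normc z ^+ 2 + 2^-1 * normc w ^+ 2.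
Proof.
rewrite normcM normcJ; have := sqr_ge0 (normc z - normc w); nra.
Qed.

Lemma L2_dot_cintegrable f g : L2 m f -> L2 m g ->
  cintegrable m (fun x => conjc (f x) * g x).
Proof.
move=> Lf Lg.
apply: (@cintegrable_le _ _ _ m _
  (fun x => 2^-1 * normc (f x) ^+ 2 + 2^-1 * normc (g x) ^+ 2)).
- by apply: cmeasurableM; [apply: cmeasurableJ|]; exact: L2_cmeasurable.
- by move=> x; exact: normc_mul_le.
- by apply: integrable_lin; exact: L2_integrable.
Qed.

Lemma L2_dotE f : L2_dot m f f = (\int[m]_x (normc (f x) ^+ 2))%:C.
Proof.
rewrite /L2_dot; apply/eqP; rewrite eq_complex /=; apply/andP; split; apply/eqP.
  by congr Rintegral; apply/funext => x; rewrite conjcM_normc.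
transitivity (\int[m]_x (0 : R)); last by rewrite /Rintegral integral0.
by congr Rintegral; apply/funext => x; rewrite conjcM_normc.
Qed.

Lemma cintegral_ae f g : cmeasurable f -> cmeasurable g -> ae_equal m f g ->
  cintegral m f = cintegral m g.
Proof.
move=> [fr fi] [gr gi] fg; rewrite /cintegral /Rintegral; congr (fine _ +i* fine _).
- apply: ae_eq_integral => //; try exact/measurable_EFinP.
  by apply: filterS fg => x /= -> _.
- apply: ae_eq_integral => //; try exact/measurable_EFinP.
  by apply: filterS fg => x /= -> _.
Qed.

Lemma L2_dot_ae f g g' : L2 m f -> L2 m g -> L2 m g' -> ae_equal m g g' ->
  L2_dot m f g = L2_dot m f g'.
Proof.
move=> Lf Lg Lg' gg; apply: cintegral_ae.
- by apply: cmeasurableM; [apply: cmeasurableJ|]; exact: L2_cmeasurable.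
- by apply: cmeasurableM; [apply: cmeasurableJ|]; exact: L2_cmeasurable.
- by apply: filterS gg => x /= ->.
Qed.

Lemma L2_norm_eq0 f : L2 m f -> \int[m]_x (normc (f x) ^+ 2) = 0 ->
  ae_equal m f (fun=> 0).
Proof.
move=> Lf f0; have fi := L2_integrable Lf.
have : (\int[m]_x `|(normc (f x) ^+ 2)%:E|)%E = 0%E.
  rewrite (eq_integral (EFin \o fun x => normc (f x) ^+ 2)); last first.
    by move=> x _; rewrite /= ger0_norm ?sqr_ge0.
  by rewrite -[LHS]fineK ?integrable_fin_num//; congr EFin.
move/(ae_eq_integral_abs _ measurableT); move/(_ (measurable_int _ fi)).
apply: filterS => x /= /(_ I) [] /eqP; rewrite sqrf_eq0 => /eqP.
exact: normc_eq0.
Qed.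

End SquareIntegrable.

Section Projection.
Context {R : realType} {G : topologicalZmodType}.
Variables (X : tmds R G) (m : probability (borelOmega X) R).
Notation fn := (borelOmega X -> R[i]).
Variables (S : set fn) (E : set (borelDual R G) -> fn -> fn).
Hypothesis S_sub : forall f, S f -> L2_closure m S f.
Hypothesis E_pvm : is_pvm m (L2_closure m S) E.
Variables (B : set (borelDual R G)) (mB : measurable B).
Let V := L2_closure m S.

Let VL2 f : V f -> L2 m f.
Proof. by case. Qed.

Let EL2 f : V f -> L2 m (E B f).
Proof. by move=> Vf; apply: VL2; exact: (pvm_stable E_pvm). Qed.

(** Self-adjointness moves one copy of the idempotent [E B] to the left; thus the spectral measure
    of [f] vanishes on [B] exactly when the projection kills [f]. *)
Lemma pvm_dot f : V f ->
  L2_dot m f (E B f) = (\int[m]_x (normc (E B f x) ^+ 2))%:C.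
Proof.
move=> Vf; have VEf : V (E B f) by exact: (pvm_stable E_pvm).
rewrite -L2_dotE -(pvm_selfadjoint E_pvm mB Vf VEf).
apply: L2_dot_ae; [exact: VL2|exact: EL2|exact: EL2|].
by have := pvm_meet E_pvm mB mB Vf; rewrite setIid.
Qed.

(* If [u] lies in the kernel of the projection, then [|E f|^2 = <f - u, E f>]. *)
Lemma pvm_closure_zero :
  (forall f, S f -> L2_dot m f (E B f) = 0) -> forall f, V f -> ae_equal m (E B f) (fun=> 0).
Proof.
move=> S0 f Vf; apply: L2_norm_eq0; first exact: EL2.
set h := E B f; have Lh : L2 m h by exact: EL2.
have H0 : 0 <= \int[m]_x (normc (h x) ^+ 2) by apply: Rintegral_ge0 => x _; exact: sqr_ge0.
apply/eqP; rewrite eq_le H0 andbT; apply/ler_addgt0Pr => e e0; rewrite add0r.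
have [_ /(_ e e0)[u Su hu]] := Vf.
have Vu := S_sub Su; have Lu := VL2 Vu; have Lf := VL2 Vf.
have Eu0 : ae_equal m (E B u) (fun=> 0).
  apply: L2_norm_eq0; first exact: EL2.
  by have := S0 u Su; rewrite pvm_dot// => /(congr1 (@complex.Re R)).
have uh : L2_dot m u h = 0.
  rewrite (pvm_selfadjoint E_pvm mB Vu Vf).
  have := @cintegral_ae _ _ _ m (fun x => conjc (E B u x) * f x) (fun=> 0).
  rewrite cintegral0; apply.
  - apply: cmeasurableM; last exact: (L2_cmeasurable Lf).
    by apply: cmeasurableJ; exact: (L2_cmeasurable (EL2 Vu)).
  - exact: (L2_cmeasurable (L2_0 m)).
  - by apply: filterS Eu0 => x /= ->; rewrite conjc0 mul0r.
have Lfh := L2_dot_cintegrable Lf Lh; have Luh := L2_dot_cintegrable Lu Lh.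
have hE : (\int[m]_x (normc (h x) ^+ 2))%:C =
    cintegral m (fun x => conjc (f x - u x) * h x).
  rewrite -(pvm_dot Vf) -[LHS]subr0 -uh.
  have := cintegral_lin 1 (-1) Lfh Luh; rewrite mul1r mulN1r => <-.
  by congr cintegral; apply/funext => x; rewrite rmorphB/=; ring.
have mfu : cmeasurable (fun x => f x - u x).
  have [fr fi] := L2_cmeasurable Lf; have [ur ui] := L2_cmeasurable Lu; split.
  - by under eq_fun do rewrite raddfB; exact: measurable_funB.
  - by under eq_fun do rewrite raddfB; exact: measurable_funB.
have ifu : m.-integrable setT (EFin \o (fun x => normc (f x - u x) ^+ 2)).
  apply/integrableP; split; first by apply/measurable_EFinP; exact: cmeasurable_sqr_normc.
  apply: le_lt_trans (ltry e); apply: le_trans (ltW hu).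
  rewrite le_eqVlt; apply/orP; left; apply/eqP; apply: eq_integral => x _.
  by rewrite /= ger0_norm ?sqr_ge0.
have hu' : \int[m]_x (normc (f x - u x) ^+ 2) < e.
  by rewrite -lte_fin fineK// integrable_fin_num.
have ih := L2_integrable Lh.
(* The half of the norm of [h] on the right is absorbed on the left, leaving the squared distance
   from [f] to [u], which is less than [e]. *)
have : \int[m]_x (normc (h x) ^+ 2) <=
    \int[m]_x (2^-1 * normc (f x - u x) ^+ 2 + 2^-1 * normc (h x) ^+ 2).
  have -> : \int[m]_x (normc (h x) ^+ 2) =
      complex.Re (cintegral m (fun x => conjc (f x - u x) * h x)).
    by rewrite -hE.
  have ci : cintegrable m (fun x => conjc (f x - u x) * h x).
    apply: (@cintegrable_le _ _ _ m _
      (fun x => 2^-1 * normc (f x - u x) ^+ 2 + 2^-1 * normc (h x) ^+ 2)).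
    - by apply: cmeasurableM; [exact: cmeasurableJ|exact: (L2_cmeasurable Lh)].
    - by move=> x; exact: normc_mul_le.
    - exact: integrable_lin.
  apply: le_Rintegral => //.
  - by case: ci.
  - exact: integrable_lin.
  - move=> x _; apply: le_trans (normc_mul_le _ _).
    exact: le_trans (ler_norm _) (Re_le_normc _).
rewrite Rintegral_lin//; lra.
Qed.

End Projection.

(** * Null sets of the diffraction measure and of the spectral measures *)

Section DiffractionSpectrum.
Context {R : realType} {G : topologicalZmodType}.
Hypothesis G_hausdorff : hausdorff_space G.
Variables (haar : {measure set borelG G -> \bar R}) (haarP : is_haar haar).
Variables (X : tmds R G) (m : probability (borelOmega X) R).
Hypothesis m_invariant : act_invariant m.
Variables (sigma : Cc R G) (sigma1 : cintegral haar sigma = 1).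
Variable dif : {measure set borelDual R G -> \bar R}.
Hypothesis difP : is_diffraction m haar sigma dif.
Notation D := (dual_group R G).
Notation BD := (borelDual R G).
Implicit Types (phi : Cc R G).
Local Notation W := (fourier_weight haar).

Lemma tmds_eval_le phi : exists B, forall w : tmds_space X, normc (val w phi) <= B.
Proof.
have [N hN] := tmds_bounded_functional G_hausdorff X (@compact_supp R G phi).
have [M hM] := Cc_bounded phi; exists (N * M) => w.
have [_ _ h] := hN w; rewrite -cm_intE; apply: h => //.
exact: Cc_continuous_on_supp.
Qed.

Lemma tmds_eval_cmeasurable phi : cmeasurable ((fun w => val w phi) : borelOmega X -> R[i]).
Proof. exact: (tmds_cmeasurable (@tmds_eval_continuous _ _ X phi)). Qed.

Lemma tmds_eval_L2 phi : L2 m (fun w => val w phi).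
Proof.
have [B hB] := tmds_eval_le phi.
exact: bounded_L2 (tmds_eval_cmeasurable phi) hB.
Qed.

Lemma diffraction_norm phi :
  (\int[dif]_chi (W phi chi)%:E = (\int[m]_w normc (val w phi) ^+ 2)%:E)%E.
Proof.
have [_ /(_ phi)[h _]] := difP.
transitivity (\int[dif]_chi (normc (fourier haar phi (dualV (chi : D))) ^+ 2)%:E)%E.
  by apply: eq_integral => chi _; rewrite fourier_dualV.
by rewrite h (autocorrelation_convolution G_hausdorff haarP m_invariant sigma1 phi).
Qed.

Lemma weight_integrable phi : dif.-integrable setT (EFin \o W phi).
Proof.
apply/integrableP; split.
  by apply/measurable_EFinP; exact: fourier_weight_measurable.
rewrite (eq_integral (EFin \o W phi)); last first.
  by move=> chi _; rewrite /= ger0_norm ?fourier_weight_ge0.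
by rewrite diffraction_norm ltry.
Qed.

Lemma diffraction_Rnorm phi :
  \int[dif]_chi W phi chi = \int[m]_w normc (val w phi) ^+ 2.
Proof. by rewrite /Rintegral diffraction_norm. Qed.

(* Polarisation of [diffraction_norm] at [phi + c T_s phi]. *)
Lemma diffraction_polarised phi s (c : R[i]) : normc c = 1 ->
  complex.Re (c * cintegral dif (fun chi : BD => (chi : D) s * (W phi chi)%:C)) =
  complex.Re (c * L2_dot m (fun w => val w phi) (fun w => val w (Cc_shift (- s) phi))).
Proof.
have aux (A x y : R) : 2 * A + 2 * x = A + A + 2 * y -> x = y by lra.
move=> c1; set psi := Cc_shift (- s) phi.
have Wi := weight_integrable phi; have W0 := fourier_weight_ge0 haar phi.
have ci := cintegrable_character s W0 Wi.
have Wpsi chi : W psi chi = W phi chi.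
  by rewrite /fourier_weight fourierV_shift// normcM normc_dual mul1r.
(* Since [z = c chi(s)] is unimodular, the squared modulus of [1 + z] is [2 + 2 Re z]. *)
have lhs : \int[dif]_chi W (phi + c *: psi) chi =
    2 * \int[dif]_chi W phi chi +
    2 * complex.Re (c * cintegral dif (fun chi : BD => (chi : D) s * (W phi chi)%:C)).
  rewrite -cintegralZ//= -Rintegral_lin//.
    congr Rintegral; apply/funext => chi.
    rewrite /fourier_weight fourierV_lin// fourierV_shift//.
    have cs : normc (c * (chi : D) s) = 1 by rewrite normcM c1 normc_dual mulr1.
    set z := c * (chi : D) s in cs *; set F := fourierV haar phi chi.
    have -> : F + c * ((chi : D) s * F) = (1 + z) * F by rewrite /z; ring.
    rewrite normcM exprMn.
    have -> : complex.Re (c * ((chi : D) s * (normc F ^+ 2)%:C)) =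
        complex.Re z * normc F ^+ 2 by rewrite mulrA ReM /= mulr0 subr0.
    have := sqr_normc z; rewrite cs expr1n => z2.
    have -> : normc (1 + z) ^+ 2 = 2 + 2 * complex.Re z.
      rewrite (sqr_normc (1 + z)) ReD ImD /= add0r.
      transitivity (1 + 2 * complex.Re z + (complex.Re z ^+ 2 + complex.Im z ^+ 2)).
        by ring.
      by rewrite -z2; ring.
    by ring.
  by have [] := cintegrable_lin c 0 ci ci; under eq_fun do rewrite mul0r addr0.
have rhs : \int[m]_w normc (val w (phi + c *: psi)) ^+ 2 =
    \int[m]_w normc (val w phi) ^+ 2 + \int[m]_w normc (val w psi) ^+ 2 +
    2 * complex.Re (c * L2_dot m (fun w => val w phi) (fun w => val w psi)).
  have d := L2_dot_cintegrable (tmds_eval_L2 phi) (tmds_eval_L2 psi).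
  have dc := cintegrable_lin c 0 d d.
  rewrite -cintegralZ//=.
  have i1 := L2_integrable (tmds_eval_L2 phi); have i2 := L2_integrable (tmds_eval_L2 psi).
  transitivity (\int[m]_w (1 * (1 * normc (val w phi) ^+ 2 + 1 * normc (val w psi) ^+ 2) +
     2 * complex.Re (c * (conjc (val w phi) * val w psi)))).
    congr Rintegral; apply/funext => w.
    have -> : val w (phi + c *: psi) = val w phi + c * val w psi by rewrite linearD linearZ.
    by rewrite !mul1r sqr_normcD.
  rewrite Rintegral_lin//.
  - by rewrite mul1r Rintegral_lin// !mul1r.
  - exact: integrable_lin.
  - by have [+ _] := dc; under eq_fun do rewrite mul0r addr0.
have := diffraction_Rnorm (phi + c *: psi); rewrite lhs rhs.
rewrite -diffraction_Rnorm -(diffraction_Rnorm psi).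
rewrite (_ : \int[dif]_chi W psi chi = \int[dif]_chi W phi chi); last first.
  by congr Rintegral; apply/funext => chi.
exact: aux.
Qed.

(** Polarisation with [c = 1] gives the real parts, and with [c] the imaginary unit the negatives of
    the imaginary parts. The second argument on the right is the translate by [s] of the first under
    the representation. *)
Lemma diffraction_character phi s :
  cintegral dif (fun chi : BD => (chi : D) s * (W phi chi)%:C) =
  L2_dot m (fun w => val w phi) (fun w => val w (Cc_shift (- s) phi)).
Proof.
have h1 := @diffraction_polarised phi s 1 (Normc.normc1 _).
have hi : normc ('i%C : R[i]) = 1 by rewrite /= expr0n add0r expr1n sqrtr1.
have h2 := @diffraction_polarised phi s _ hi.
move: h1 h2; rewrite !mul1r !ReM /= !mul0r !mul1r !sub0r => h1 /oppr_inj h2.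
by apply/eqP; rewrite eq_complex; apply/andP; split; apply/eqP.
Qed.

Lemma weight_continuous phi : continuous (W phi : D -> R).
Proof.
move=> chi; apply: (@continuous_comp _ _ _ (fun chi : D => fourierV haar phi chi : R[i]^o)
  (fun z : R[i]^o => normc z ^+ 2)); first exact: fourierV_continuous.
apply: (@continuous_comp _ _ _ (fun z : R[i]^o => normc z) (fun x : R => x ^+ 2)).
  have := @normcB_continuous R 0 (fourierV haar phi chi).
  by under eq_fun do rewrite subr0.
exact: exprn_continuous.
Qed.

(** The sets where some weight is positive cover the dual group, possibly uncountably many of them.
    Inner regularity reduces [B] to its compact subsets, for which finitely many suffice. *)
Lemma diffraction_null (B : set BD) : measurable B ->
  dif B = 0%E <-> forall phi, \int[dif]_(x in B) W phi x = 0.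
Proof.
move=> mB; split=> [B0 phi|WB].
  rewrite /Rintegral null_set_integral//.
  by apply/measurable_EFinP; apply: measurable_funTS; exact: fourier_weight_measurable.
have [[_ dif_regular] _] := difP.
rewrite (dif_regular B mB); apply/eqP; rewrite eq_le; apply/andP; split; last first.
  apply: ereal_sup_ubound; exists set0; last exact: measure0.
  by split; [exact: compact0|].
apply: ge_ereal_sup => _ [K [cK KB] <-].
have mI (V : set D) : open V -> measurable ((V : set BD) `&` B).
  by move=> oV; apply: measurableI => //; exact: (open_borel (dual1 R G) oV).
(* The open set [V] provides measurability for the arbitrary sets [A] of the compactness principle;
   intersecting with [B] keeps the null set provided by the vanishing integral over [B]. *)
pose P (A : set D) := exists V : set D, [/\ open V, A `<=` V & dif (V `&` B) = 0%E].
have [V [oV KV dV]] : P K.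
  apply: (@compact_ind D K P cK).
  - by move=> A A' AA [V [oV AV dV]]; exists V; split => //; exact: subset_trans AV.
  - by exists set0; split; [exact: open0|by []|rewrite set0I measure0].
  - move=> A A' [V [oV AV dV]] [V' [oV' AV' dV']]; exists (V `|` V').
    split; [exact: openU|exact: setUSS|].
    apply/eqP; rewrite eq_le measure_ge0 andbT setIUl.
    apply: le_trans (measureU2 _ (mI V oV) (mI V' oV')) _; rewrite -[leRHS]adde0.
    by apply: leeD; rewrite le_eqVlt; apply/orP; left; apply/eqP; [exact: dV|exact: dV'].
  - move=> chi _; have [phi phi1] := fourierV_nonzero G_hausdorff chi sigma1.
    pose V := [set psi : D | 0 < W phi psi].
    have oV : open V.
      apply: (@open_comp D R (W phi) [set x | 0 < x]); last exact: open_gt.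
      by move=> psi _; exact: weight_continuous.
    exists V; first by apply: open_nbhs_nbhs; split => //; rewrite /V /= phi1.
    exists V; split => //.
    have iB : dif.-integrable B (EFin \o W phi).
      by apply: integrableS (weight_integrable phi).
    have : (\int[dif]_(x in B) `|(W phi x)%:E|)%E = 0%E.
      rewrite (eq_integral (EFin \o W phi)); last first.
        by move=> x _; rewrite /= ger0_norm ?fourier_weight_ge0.
      by rewrite -[LHS]fineK ?integrable_fin_num//; congr EFin; exact: WB.
    move/(ae_eq_integral_abs _ mB (measurable_int _ iB)) => -[N [mN N0 hN]].
    apply: (subset_measure0 (mI V oV) mN _ N0) => x [Vx Bx]; apply: hN => /= /(_ Bx) [].
    by move=> Wx; move: Vx; rewrite /V /= Wx ltxx.
rewrite -dV; apply: le_measure; rewrite ?inE.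
- exact: compact_borelDual.
- exact: mI.
- by move=> x Kx; split; [exact: KV|exact: KB].
Qed.

(** Compares two weighted measures with equal integrals against characters: [rho] with density 1 and
    [dif] with density [W phi]. Both are inner regular with bounded integrable density, hence
    tight. *)
Lemma spectral_null phi (rho : {finite_measure set BD -> \bar R}) (B : set BD) :
  radon rho -> measurable B ->
  (forall s, cintegral rho (fun chi : BD => (chi : D) s) =
    L2_dot m (fun w => val w phi) (fun w => val w (Cc_shift (- s) phi))) ->
  fine (rho B) = 0 <-> \int[dif]_(x in B) W phi x = 0.
Proof.
move=> [_ rho_regular] mB rhoE.
have [[_ dif_regular] _] := difP.
pose one : BD -> R := fun=> 1.
have one0 x : 0 <= one x by exact: ler01.
have onei : rho.-integrable setT (EFin \o one).
  exact: finite_measure_integrable_cst.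
have W0 := fourier_weight_ge0 haar phi; have Wi := weight_integrable phi.
have [M hM] := fourier_weight_le G_hausdorff haarP phi.
have t1 : tight rho one := inner_regular_tight rho_regular one0 (fun=> lexx 1) onei.
have t2 : tight dif (W phi) := inner_regular_tight dif_regular W0 hM Wi.
have chE s : cintegral rho (fun chi : BD => (chi : D) s * (one chi)%:C) =
    cintegral dif (fun chi : BD => (chi : D) s * (W phi chi)%:C).
  rewrite diffraction_character -rhoE; congr cintegral.
  by apply/funext => chi; rewrite mulr1.
have trigE := trig01_Rintegral_eq one0 W0 onei Wi chE.
have -> : fine (rho B) = \int[rho]_(x in B) one x.
  by rewrite (Rintegral_cst _ mB) mul1r.
split.
- exact: (null_Rintegral W0 one0 Wi onei t2 t1 (fun g tg => esym (trigE g tg)) mB).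
- exact: (null_Rintegral one0 W0 onei Wi t1 t2 trigE mB).
Qed.

End DiffractionSpectrum.

Unset Implicit Arguments.

Theorem theorem6 (R : realType) (G : topologicalZmodType)
    (G_hausdorff : hausdorff_space G)
    (G_locally_compact : locally_compact [set: G])
    (G_sigma_compact : sigma_compact G)
    (haar : {measure set borelG G -> \bar R})
    (haarP : is_haar haar)
    (X : tmds R G)
    (m : probability (borelOmega X) R)
    (m_regular : inner_regular m)
    (m_invariant : act_invariant m)
    (sigma : Cc R G)
    (sigma1 : cintegral haar sigma = 1)
    (diffraction : {measure set borelDual R G -> \bar R})
    (diffractionP : is_diffraction m haar sigma diffraction)
    (E : set (borelDual R G) -> (borelOmega X -> R[i]) -> (borelOmega X -> R[i]))
    (E_stone : is_stone_pvm m (U_space m) E) :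
  forall B : set (borelDual R G), measurable B ->
    ((forall f, U_space m f -> ae_equal m (E B f) (fun=> 0)) <->
     diffraction B = 0%E).
Proof.
move=> B mB; have [E_pvm E_char] := E_stone.
pose S : set (borelOmega X -> R[i]) := [set h | exists phi : Cc R G,
  h = fun w => f_phi phi (val w)].
have S_sub : forall f, S f -> L2_closure m S f.
  move=> _ [phi ->]; split; first exact: (tmds_eval_L2 G_hausdorff m (Cc_refl phi)).
  move=> e e0; exists (fun w => f_phi phi (val w)); first by exists phi.
  under eq_integral do rewrite subrr Normc.normc0 expr0n.
  by rewrite integral0 lte_fin.
(* [f_phi phi] evaluates at [Cc_refl phi], so the reflected function appears in the weight. *)
have spectral phi : L2_dot m (fun w => f_phi phi (val w)) (E B (fun w => f_phi phi (val w))) = 0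
    <-> \int[diffraction]_(x in B) fourier_weight haar (Cc_refl phi) x = 0.
  have Uphi : U_space m (fun w => f_phi phi (val w)) by apply: S_sub; exists phi.
  have [rho rhoE] := pvm_measure E_pvm Uphi.
  have [rho_radon ->] := rhoE; last exact: mB.
  (* By conversion, [translation_rep s] applied to [f_phi phi] is evaluation at
     [Cc_shift (- s) (Cc_refl phi)], which is the form of the hypothesis of [spectral_null]. *)
  have h := spectral_null G_hausdorff haarP m_invariant sigma1 diffractionP rho_radon mB
    (fun s => esym (E_char _ _ Uphi rhoE s)).
  split=> [e|/h ->//]; apply/h.
  by have := congr1 (@complex.Re R) e.
rewrite (diffraction_null G_hausdorff haarP m_invariant sigma1 diffractionP mB).
split=> [E0 phi|W0].
  (* Reflection is an involution, so every weight is attached to some [f_phi]. *)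
  have {1}-> : phi = Cc_refl (Cc_refl phi).
    by apply/val_inj/funext => x /=; rewrite opprK.
  apply/spectral.
  have Uphi : U_space m (fun w => f_phi (Cc_refl phi) (val w)).
    by apply: S_sub; exists (Cc_refl phi).
  have Lphi := Uphi.1; have LE := (pvm_stable E_pvm mB Uphi).1.
  rewrite (L2_dot_ae Lphi LE (L2_0 m) (E0 _ Uphi)) -[RHS](cintegral0 m).
  by congr cintegral; apply/funext => w; rewrite mulr0.
(* Vanishing weighted integrals make [E B] kill the generators, and density extends this to the
   closure. *)
by apply: (pvm_closure_zero S_sub E_pvm mB) => _ [phi ->]; apply/spectral.
Qed.
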